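(* There exists $\varepsilon_0>0$ such that the following holds for every fixed $\varepsilon\in(0,\varepsilon_0)$. Let $p=p(n)\in[0,1]$ and $G\sim G(n,p)$. (i) If $p\ge (1+\varepsilon)\log n/n$, then a.a.s. $\mathrm{sp}(G)=\lceil \log_2 n\rceil$. (ii) If $(1-\varepsilon)\log n/n\le p\le (1+\varepsilon)\log n/n$, then a.a.s. $$\mathrm{sp}(G)=(1+o(1))\max\Big(\log_2 n,\ \tfrac{2}{3}n^2p\,e^{-np}\Big).$$ (iii) For every $\delta>0$ there is a constant $C=C(\delta)$ such that, if $p\in[C/n,(1-\varepsilon)\log n/n]$, then a.a.s. $(2/3-\delta)n^2pe^{-np}\le \mathrm{sp}(G)\le (2/3+\delta)n^2pe^{-np}$.
   Context: A family of subsets $V_1,\dots,V_k$ of a set $V$ is a separating system of $V$ if for every two distinct $u,v\in V$ there is $i$ with $|V_i\cap\{u,v\}|=1$. For a graph $G$, $\mathrm{sp}(G)$ is the minimum size of a family $\mathcal P$ of paths in $G$ (paths consisting of a single vertex are allowed) such that $\{V(P):P\in\mathcal P\}$ is a separating system of $V(G)$. $G(n,p)$ is the binomial random graph on $n$ vertices where each edge is present independently with probability $p$. $\log$ is the natural logarithm. A.a.s. (asymptotically almost surely) means with probability tending to $1$ as $n\to\infty$. *)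

(* Defs.v *)
From HB Require Import structures.
From mathcomp Require Import all_boot all_order all_algebra.
From mathcomp Require Import boolp reals sequences exp.
Set Implicit Arguments. Unset Strict Implicit. Unset Printing Implicit Defensive.
Import Order.TTheory GRing.Theory Num.Theory.
Local Open Scope ring_scope.

(* A (simple) graph on 'I_n is a set of 2-element subsets of 'I_n. *)
Definition all_pairs (n : nat) : {set {set 'I_n}} := [set e : {set 'I_n} | #|e| == 2].

Definition adj (n : nat) (E : {set {set 'I_n}}) : rel 'I_n :=
  fun u v => [set u; v] \in E.

Definition is_path (n : nat) (E : {set {set 'I_n}}) (s : seq 'I_n) : bool :=
  if s is x :: s' then uniq s && path (adj E) x s' else false.

Definition separating (n : nat) (F : seq {set 'I_n}) : bool :=
  [forall u : 'I_n, forall v : 'I_n, (u != v) ==> has (fun S : {set 'I_n} => (u \in S) != (v \in S)) F].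

Definition sep_path_family (n : nat) (E : {set {set 'I_n}}) (k : nat) : Prop :=
  exists F : seq (seq 'I_n),
    [/\ size F = k, all (is_path E) F & separating [seq [set x in s] | s <- F]].

Lemma sep_path_family_exists (n : nat) (E : {set {set 'I_n}}) :
  exists k, `[< sep_path_family E k >].
Proof.
exists (size [seq [:: v] | v <- enum 'I_n]); apply/asboolP.
exists [seq [:: v] | v <- enum 'I_n]; split => //.
  by apply/allP => s /mapP [v _ ->].
apply/forallP => u; apply/forallP => v; apply/implyP => huv; apply/hasP.
exists [set x in [:: u]].
  apply/mapP; exists [:: u] => //; apply/mapP; by exists u; rewrite ?mem_enum.
by rewrite !inE eqxx [v == u]eq_sym (negbTE huv).
Qed.

Definition sp (n : nat) (E : {set {set 'I_n}}) : nat :=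
  ex_minn (sep_path_family_exists E).

Definition Gnp_prob {R : realType} (n : nat) (q : R)
    (A : {set {set 'I_n}} -> bool) : R :=
  \sum_(E : {set {set 'I_n}} | (E \subset all_pairs n) && A E)
     q ^+ #|E| * (1 - q) ^+ (#|all_pairs n| - #|E|)%N.

Definition aas {R : realType} (p : nat -> R)
    (A : forall n : nat, {set {set 'I_n}} -> bool) : Prop :=
  forall e : R, 0 < e -> exists N : nat, forall n : nat, (N <= n)%N ->
    1 - e <= Gnp_prob (p n) (A n).

Definition eventually (P : nat -> Prop) : Prop :=
  exists N : nat, forall n : nat, (N <= n)%N -> P n.

(* Main.v *)
(* Write [d = n p]. A leaf is an end of every path through it, so a path meets at
   most two leaves and separating [l] leaves takes about [2l/3] paths; there are
   about [n d e^-d] leaves, and separation alone takes [log2 n] sets.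

   For the upper bound, discard a set [X] of at most [n e^(-1.05 d)] vertices so
   that the remaining vertices of low degree are far apart and attached to
   vertices of high degree.  Posa rotations, with the few random edges
   needed for expansion fixed first and the boosters among the remaining edges
   used afterwards, make every set that gives each bulk vertex enough neighbours
   traceable, even together with two prescribed leaves as ends of the path.  So
   it suffices to find separating sets: when [d] is of order [log n], codes of
   length [log2 n] randomised by the local lemma keep all neighbourhoods large;
   for smaller [d] a polylogarithmic family from a colouring of the square of
   the graph is enough, and the number of paths is governed by the leaves.  In
   the densest range the bound follows from [p = (1 + eps) log n / n] by
   monotonicity. *)
Require Import Defs.
From HB Require Import structures.
From mathcomp Require Import all_boot all_order all_algebra.
From mathcomp Require Import zify ring lra.
From mathcomp Require Import boolp reals sequences exp.
Import Order.TTheory GRing.Theory Num.Theory.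
Set Implicit Arguments. Unset Strict Implicit. Unset Printing Implicit Defensive.
Local Open Scope ring_scope.

(** A set [X] of size [n e^(-1.05 d)] is smaller than the leaf count [n d e^-d] by the factor
    [d e^(d/20)], so one-vertex paths for [X] cost nothing in the limit; close to [d = log n] at
    most one vertex is discarded. The obstacle is that the vertex sets of the paths are chosen after
    the graph is known, so boosters are wanted for all hosts at once. The union over hosts is
    affordable because expansion is certified by a subgraph of at most [n d / 10000] edges: summed
    over all certificates, the probability of their presence is outweighed by the chance
    [e^(-n d / 288)] that a booster set of quadratic size misses the random graph. Since one path
    serves both to separate bulk vertices and, by its ends, to separate leaves, the two requirements
    enter (ii) as a maximum and not as a sum. All estimates are uniform in [p] over a range, so that
    a function [p] alternating between regimes can be treated separately for each [n]. *)

(** * Longest paths, rotations and the size of the set of reachable ends *)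

Section Posa.
Local Open Scope nat_scope.
Variable T : finType.
Implicit Types (e : rel T) (W S : {set T}) (s : seq T).

Definition gpath e W s := [&& uniq s, sorted e s & all (mem W) s].

Definition longest e W s :=
  gpath e W s /\ forall s', gpath e W s' -> size s' <= size s.

Definition nbhd e W S := [set u in W | [exists v in S, e v u]].

Definition hamiltonian e W :=
  exists s, [/\ uniq s, cycle e s & [set x in s] = W].

Definition expander e W m :=
  forall S, S \subset W -> #|S| <= m -> 2 * #|S| <= #|nbhd e W S :\: S|.

Lemma gpath_rev e W s : symmetric e -> gpath e W (rev s) = gpath e W s.
Proof.
move=> e_sym; rewrite /gpath rev_uniq rev_sorted all_rev.
by rewrite (eq_sorted (e' := e)) // => x y; rewrite e_sym.
Qed.

Lemma longest_rev e W s : symmetric e -> longest e W s -> longest e W (rev s).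
Proof.
by move=> e_sym [sp smax]; split; [rewrite gpath_rev | rewrite size_rev].
Qed.

Lemma longest_exists e W : exists s, longest e W s.
Proof.
pose P k := `[< exists2 s, gpath e W s & size s = k >].
have exP : exists k, P k by exists 0; apply/asboolP; exists [::].
have ubP k : P k -> k <= #|T|.
  by move=> /asboolP[s /and3P[us _ _] <-]; rewrite -(card_uniqP us) max_card.
case: (ex_maxnP exP ubP) => k /asboolP[s sp sk] kmax.
exists s; split=> // s' s'p; rewrite sk; apply: kmax.
by apply/asboolP; exists s'.
Qed.

Definition link (x y a b : T) := ((x == a) && (y == b)) || ((x == b) && (y == a)).

(** Adjacency along a path is taken undirected, so that reversing a segment does not change it
    inside the segment. *)
Fixpoint consec s (a b : T) :=
  if s is x :: s' then
    (if s' is y :: _ then link x y a b else false) || consec s' a b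
  else false.

Lemma consec_cat x l y r a b :
  consec ((x :: l) ++ y :: r) a b =
  [|| consec (x :: l) a b, link (last x l) y a b | consec (y :: r) a b].
Proof.
elim: l x => [|z l IHl] x /=; first by [].
by move: (IHl z) => /= ->; rewrite -!orbA.
Qed.

Lemma link_sym x y a b : link x y a b = link y x a b.
Proof. by rewrite /link orbC [(y == a) && _]andbC [(y == b) && _]andbC. Qed.

Lemma consec_rev s a b : consec (rev s) a b = consec s a b.
Proof.
elim: s => [|x s IHs] //; rewrite rev_cons -cats1.
case: s IHs => [|y s] IHs //.
have : rev (y :: s) != [::] by rewrite -size_eq0 size_rev.
case E: (rev (y :: s)) => [|w t] // _.
have lastE : last w t = y.
  have : last w (rev (y :: s)) = y by rewrite rev_cons last_rcons.
  by rewrite E.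
rewrite consec_cat lastE -E IHs /= orbF orbC link_sym.
by case: s {IHs E}.
Qed.

(* Posa rotations of a path, keeping its last vertex fixed. *)
Inductive reach e (s0 : seq T) : seq T -> Prop :=
| reach_refl : reach e s0 s0
| reach_rot z l u b : reach e s0 (z :: l ++ u :: b) -> e z u ->
    reach e s0 (rev (z :: l) ++ u :: b).

Lemma rot_gpath e W z l u b : symmetric e -> e z u ->
  gpath e W (z :: l ++ u :: b) -> gpath e W (rev (z :: l) ++ u :: b).
Proof.
move=> e_sym ezu; rewrite -cat_cons /gpath => /and3P[us ss aw]; apply/and3P; split.
- rewrite -(perm_uniq (s1 := (z :: l) ++ u :: b)) //.
  by rewrite perm_cat2r perm_sym perm_rev.
- have E : rev (z :: l) = head z (rev (z :: l)) :: behead (rev (z :: l)).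
    by rewrite rev_cons; case: (rev l).
  move: ss; rewrite /sorted /= cat_path /= => /and3P[pl _ pu].
  rewrite E /= cat_path /= pu andbT.
  have -> : last (head z (rev (z :: l))) (behead (rev (z :: l))) = z.
    have : last z (rev (z :: l)) = z by rewrite rev_cons last_rcons.
    by rewrite {1}E.
  rewrite ezu andbT.
  have : sorted e (rev (z :: l)).
    by rewrite rev_sorted (eq_sorted (e' := e)) // => x y; rewrite e_sym.
  by rewrite {1}E.
- by move: aw; rewrite !all_cat all_rev.
Qed.

Section Rotations.
Variables (e : rel T) (W : {set T}) (s0 : seq T).
Hypotheses (e_sym : symmetric e) (eirr : irreflexive e).
Hypothesis s0long : longest e W s0.

Lemma reach_gpath s : reach e s0 s -> gpath e W s.
Proof. by elim=> [|z l u b _ IH ezu]; [case: s0long | apply: rot_gpath]. Qed.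

Lemma reach_perm s : reach e s0 s -> perm_eq s s0.
Proof.
elim=> [|z l u b _ IH ezu] //; apply: perm_trans IH.
by rewrite -cat_cons perm_cat2r perm_rev.
Qed.

Lemma reach_longest s : reach e s0 s -> longest e W s.
Proof.
move=> rs; split; first exact: reach_gpath.
by rewrite (perm_size (reach_perm rs)); case: s0long.
Qed.

Lemma reach_last x s : reach e s0 s -> last x s = last x s0.
Proof.
elim=> [|z l u b _ IH ezu] //; rewrite -IH.
by rewrite -cat_cons !last_cat.
Qed.

Definition rends : {set T} := [set z | `[< exists s, reach e s0 (z :: s) >]].

Lemma rendsP z : reflect (exists s, reach e s0 (z :: s)) (z \in rends).
Proof. by rewrite inE; apply/asboolP. Qed.

(** A rotation at [u] destroys one path edge, between the new first vertex [w] and [u], and creates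
    one, between [z] and [u]. Both [z] and [w] are reached first vertices. So a vertex that is
    neither reached nor next to a reached one on [s0] could only be affected in the role of [u], and
    then [w] would be its neighbour already on [s0]. *)
Lemma reach_consec s : reach e s0 s -> forall v, v \notin rends ->
  (forall y, y \in rends -> ~~ consec s0 v y) ->
  forall y, consec s v y = consec s0 v y.
Proof.
elim=> [|z l u b rs IH ezu] // v vR vnR y.
have zR : z \in rends by apply/rendsP; exists (l ++ u :: b).
have [w [l' E]] : exists w l', rev (z :: l) = w :: l'.
  by rewrite rev_cons; case: (rev l) => [|a c]; [exists z, [::] | exists a, (rcons c z)].
have wR : w \in rends.
  by apply/rendsP; exists (l' ++ u :: b); rewrite -cat_cons -E; apply: reach_rot.
have wE : last z l = w.
  by rewrite -(last_cons z z l) -[z :: l]revK E rev_cons last_rcons.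
have zE : last w l' = z.
  by rewrite -(last_cons w w l') -E rev_cons last_rcons.
have vz : v != z by apply: contraNneq vR => ->.
have vw : v != w by apply: contraNneq vR => ->.
have vu : v != u.
  apply: contraTneq isT => vu.
  have := IH v vR vnR w; rewrite -cat_cons consec_cat wE vu.
  rewrite [X in _ || (X || _)]/link !eqxx /= !orbT => /esym cw.
  by have := vnR w wR; rewrite vu cw.
rewrite -(IH v vR vnR y) -cat_cons consec_cat E consec_cat -E consec_rev.
rewrite wE zE /link.
rewrite ![_ == v]eq_sym (negbTE vz) (negbTE vw) (negbTE vu).
by rewrite !andbF.
Qed.

(** By maximality a neighbour [u] of a reached first vertex [z] lies on the path, and rotating at
    [u] makes its predecessor [w] a first vertex. Either some neighbour of [u] on [s0] is a reached
    first vertex, or the path neighbours of [u] never changed and [w] is one of them. *)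
Lemma rends_nbhd u : u \in nbhd e W rends :\: rends ->
  exists2 y, y \in rends & consec s0 u y.
Proof.
rewrite !inE => /andP[uR /andP[uW /existsP[z /andP[zR ezu]]]].
have {}uR : u \notin rends by rewrite inE.
have [s rs] := rendsP z zR.
have us : u \in z :: s.
  apply: contraT => us; have [sp smax] := reach_longest rs.
  suff : gpath e W (u :: z :: s) by move/smax => /=; rewrite ltnn.
  case/and3P: sp => us' ss aw; apply/and3P; split; rewrite /= ?us ?uW //.
  by rewrite e_sym ezu.
have uz : u != z by apply: contraTneq ezu => ->; rewrite eirr.
move: us; rewrite inE (negbTE uz) /= => us.
case/splitPr: us rs => l b rs.
have rs' := reach_rot rs ezu.
have [w [l' E]] : exists w l', rev (z :: l) = w :: l'.
  by rewrite rev_cons; case: (rev l) => [|a c]; [exists z, [::] | exists a, (rcons c z)].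
have wR : w \in rends by apply/rendsP; exists (l' ++ u :: b); rewrite -cat_cons -E.
have wE : last z l = w.
  by rewrite -(last_cons z z l) -[z :: l]revK E rev_cons last_rcons.
case: (pselect (exists2 y, y \in rends & consec s0 u y)) => // nex.
have := reach_consec rs uR _ w.
rewrite -cat_cons consec_cat wE [X in _ || (X || _)]/link !eqxx /= !orbT => cw.
exists w => //; rewrite -cw // => y yR; apply/negP => cy.
by apply: nex; exists y.
Qed.

Lemma consec_nth x0 u y : uniq s0 -> consec s0 u y ->
  y \in s0 /\ ((u = nth x0 s0 (index y s0).+1) \/
  (y != head y s0 /\ u = nth x0 s0 (index y s0).-1)).
Proof.
elim: s0 => [|a [|b s] IHs] // /andP[anin us].
rewrite [consec _ _ _]/=; case/orP.
  case/orP=> /andP[/eqP ? /eqP ?]; subst.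
    split; first by rewrite !inE eqxx orbT.
    have uy : u != y by move: anin; rewrite inE negb_or => /andP[].
    by right; split; [rewrite /= eq_sym | rewrite /= (negbTE uy) eqxx].
  by split; [rewrite inE eqxx | left => /=; rewrite eqxx].
move=> /(IHs us)[yin H]; split; first by rewrite inE yin orbT.
have ay : a != y by apply: contraNneq anin => ->.
have -> : index y (a :: b :: s) = (index y (b :: s)).+1 by rewrite /= (negbTE ay).
case: H => [->|[yh ->]]; first by left.
right; split; first by rewrite /= eq_sym.
move: yh; rewrite [head _ _]/= => yh /=; rewrite eq_sym (negbTE yh) /=.
by [].
Qed.

(** Each reached first vertex has at most two neighbours on [s0], and the first vertex of [s0] has
    no predecessor, which makes the inequality strict. *)
Lemma rends_card : s0 != [::] -> #|nbhd e W rends :\: rends| < 2 * #|rends|.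
Proof.
case E: s0 => [|x0 s] // _.
have us0 : uniq s0 by case: s0long => /and3P[].
have x0R : x0 \in rends by apply/rendsP; exists s; rewrite -E; apply: reach_refl.
pose A1 := [set nth x0 s0 (index y s0).+1 | y in rends].
pose A2 := [set nth x0 s0 (index y s0).-1 | y in rends :\ x0].
have sub : nbhd e W rends :\: rends \subset A1 :|: A2.
  apply/subsetP => u /rends_nbhd[y yR /(consec_nth x0 us0)[yin []]] H.
    by rewrite inE; apply/orP; left; apply/imsetP; exists y.
  rewrite inE; apply/orP; right; apply/imsetP; exists y; last by case: H.
  by rewrite in_setD1 yR andbT; case: H; rewrite {1}E.
apply: leq_ltn_trans (subset_leq_card sub) _.
apply: leq_ltn_trans (leq_card_setU _ _) _.
rewrite mul2n -addnn -addnS leq_add ?leq_imset_card //.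
by rewrite [ltnRHS](cardsD1 x0) x0R add1n ltnS leq_imset_card.
Qed.

Lemma rends_large m : s0 != [::] -> expander e W m -> m < #|rends|.
Proof.
move=> s0n ex; rewrite ltnNge; apply/negP => le.
have sub : rends \subset W.
  apply/subsetP => z /rendsP[s /reach_gpath/and3P[_ _]].
  by rewrite /= => /andP[].
by have := ex _ sub le; rewrite leqNgt rends_card.
Qed.

End Rotations.
End Posa.

(** * Pairs whose addition lengthens a longest path or closes a Hamilton cycle *)

Section Boosters.
Local Open Scope nat_scope.
Variable T : finType.
Implicit Types (e : rel T) (W S : {set T}) (s : seq T) (G E F : {set {set T}}).

Definition long_ends e W : {set T * T} :=
  [set p | `[< exists2 s, longest e W (p.1 :: s) & last p.1 s = p.2 >]].

Definition boosters e W := [set [set p.1; p.2] | p in long_ends e W].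

Lemma long_endsP e W x y :
  reflect (exists2 s, longest e W (x :: s) & last x s = y) ((x, y) \in long_ends e W).
Proof. by rewrite inE; apply/asboolP. Qed.

Lemma card_unordered (A : {set T * T}) :
  #|A| <= 2 * #|[set [set p.1; p.2] | p in A]|.
Proof.
rewrite -sum1_card (partition_big_imset (fun p : T * T => [set p.1; p.2])) /=.
rewrite mulnC -sum_nat_const leq_sum // => f /imsetP[[a b] abA ->] /=.
rewrite sum1_card; apply: (@leq_trans #|[set (a, b); (b, a)]|); last first.
  by rewrite cards2; case: (_ != _).
apply: subset_leq_card; apply/subsetP => [[c d]]; rewrite unfold_in /= => /andP[_ /eqP E].
have : a \in [set c; d] by rewrite E !inE eqxx.
have : b \in [set c; d] by rewrite E !inE eqxx orbT.
have : c \in [set a; b] by rewrite -E !inE eqxx.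
have : d \in [set a; b] by rewrite -E !inE eqxx orbT.
rewrite !inE !xpair_eqE.
by do 4![case/orP=> /eqP ?]; subst; rewrite ?eqxx ?orbT.
Qed.

Lemma subset_of_card (A : {set T}) k : k <= #|A| ->
  exists B : {set T}, B \subset A /\ #|B| = k.
Proof.
case/card_geqP=> s [us <- sA]; exists [set x in s]; split.
  by apply/subsetP => x; rewrite inE => /sA.
by rewrite cardsE (card_uniqP us).
Qed.

Section Expander.
Variables (e : rel T) (W : {set T}) (m : nat).
Hypotheses (e_sym : symmetric e) (eirr : irreflexive e).
Hypothesis ex : expander e W m.

(** Rotations with one end fixed give more than [m] first vertices. Reversing each resulting path
    and rotating again gives more than [m] partners for each of them. *)
Lemma long_ends_card : W != set0 -> m.+1 ^ 2 <= #|long_ends e W|.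
Proof.
case/set0Pn=> w wW.
have [s0 s0l] := longest_exists e W.
have s0n : s0 != [::].
  apply/eqP => s0E; have [_ /(_ [:: w])] := s0l.
  by rewrite s0E /= /gpath /= wW => /(_ isT).
have Rl := rends_large e_sym eirr s0l s0n ex.
have Ru z : z \in rends e s0 -> m.+1 <= #|[set y | (z, y) \in long_ends e W]|.
  move=> /rendsP[s rs]; have sl := reach_longest e_sym s0l rs.
  have rl := longest_rev e_sym sl.
  have rn : rev (z :: s) != [::] by rewrite -size_eq0 size_rev.
  apply: leq_trans (rends_large e_sym eirr rl rn ex) _.
  apply: subset_leq_card; apply/subsetP => y /rendsP[t rt].
  have tl := longest_rev e_sym (reach_longest e_sym rl rt).
  rewrite inE; apply/long_endsP.
  have /= lE := reach_last y rt.
  have : last y (rev (z :: s)) = z by rewrite rev_cons last_rcons.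
  rewrite -lE => {lE}; case: t rt tl => [|b t] rt tl /= lE; rewrite ?lE in tl *.
    by exists [::].
  have := tl; rewrite -lE; case E: (rev (y :: b :: t)) tl => [|c q] tl.
    by move/eqP: E; rewrite -size_eq0 size_rev.
  move=> _; have : rev (c :: q) = y :: b :: t by rewrite -E revK.
  move=> E2; have cE : c = last b t.
    have : last y (rev (c :: q)) = c by rewrite rev_cons last_rcons.
    by rewrite E2.
  have qE : last c q = y.
    have : last c (rev (y :: b :: t)) = y by rewrite rev_cons last_rcons.
    by rewrite E.
  by exists q; rewrite -cE.
have -> : #|long_ends e W| = \sum_z #|[set y | (z, y) \in long_ends e W]|.
  rewrite -sum1dep_card; under [RHS]eq_bigr do rewrite -sum1dep_card.
  rewrite (pair_big_dep xpredT (fun z y => (z, y) \in long_ends e W) (fun _ _ => 1)) /=.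
  by apply: eq_bigl => -[a b]; rewrite inE.
apply: (@leq_trans (\sum_(z in rends e s0) m.+1)).
  by rewrite sum_nat_const -mulnn leq_mul2r Rl orbT.
rewrite [X in _ <= X](bigID (mem (rends e s0))) /=.
by apply: leq_trans (leq_addr _ _); apply: leq_sum.
Qed.

Lemma boosters_card : W != set0 -> m.+1 ^ 2 <= 2 * #|boosters e W|.
Proof. by move=> /long_ends_card/leq_trans; apply; apply: card_unordered. Qed.

Hypothesis m6 : #|W| < 6 * m.

(** A nonempty set that no edge leaves has more than [m] vertices, and then at least [3 * m], since
    it contains an [m]-subset together with its neighbours. The set and its complement cannot both
    be that large when [#|W| < 6 * m]. *)
Lemma expander_connected S : S \subset W -> S != set0 -> S != W ->
  exists u v, [/\ u \in S, v \in W :\: S & e u v].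
Proof.
move=> SW Sn SnW.
have small (A : {set T}) : A \subset W -> A != set0 -> #|A| <= m ->
    exists u v, [/\ u \in A, v \in W :\: A & e u v].
  move=> AW An Am; have := ex AW Am.
  have A0 : 0 < #|A| by rewrite card_gt0.
  move=> le; have : 0 < #|nbhd e W A :\: A| by lia.
  rewrite card_gt0 => /set0Pn[v]; rewrite !inE => /and3P[vA vW /existsP[u /andP[uA euv]]].
  by exists u, v; rewrite !inE vA vW.
have big (A : {set T}) : A \subset W -> m < #|A| ->
    (exists u v, [/\ u \in A, v \in W :\: A & e u v]) \/ 3 * m <= #|A|.
  move=> AW mA.
  have [B [BA Bm]] := subset_of_card (ltnW mA).
  have := ex (subset_trans BA AW) (eq_leq Bm).
  case: (boolP (nbhd e W B :\: B \subset A)) => [sub|].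
    move=> le; right; have : #|B| + #|nbhd e W B :\: B| <= #|A|.
      rewrite -cardsUI; have -> : B :&: (nbhd e W B :\: B) = set0.
        by apply/setP => x; rewrite !inE; case: (x \in B).
      by rewrite cards0 addn0 subset_leq_card // subUset BA.
    lia.
  case/subsetPn=> v; rewrite !inE => /and3P[vB vW /existsP[u /andP[uB euv]]] vA _.
  by left; exists u, v; rewrite !inE vA vW euv (subsetP BA).
case: (leqP #|S| m) => [/small|mS]; first exact.
have DW : W :\: S \subset W by rewrite subsetDl.
have Dn : W :\: S != set0.
  by rewrite setD_eq0; apply: contraNN SnW => WS; rewrite eqEsubset SW.
have WDD : W :\: (W :\: S) = S by rewrite setDDr setDv set0U (setIidPr SW).
have flip : (exists u v, [/\ u \in W :\: S, v \in W :\: (W :\: S) & e u v]) ->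
    exists u v, [/\ u \in S, v \in W :\: S & e u v].
  by case=> u [v [uD vS euv]]; exists v, u; rewrite e_sym; split=> //; rewrite -WDD.
case: (leqP #|W :\: S| m) => [/(small _ DW Dn)/flip //|mD].
case: (big _ SW mS) => // S3; case: (big _ DW mD) => [/flip //|D3].
by have := cardsID S W; rewrite (setIidPr SW); lia.
Qed.

(* Joining the ends of a longest path creates a cycle, which connectivity
   either shows to be spanning or opens into a longer path. *)
Lemma close_longest e' x s : (forall u v, e u v -> e' u v) -> symmetric e' ->
  longest e W (x :: s) -> e' (last x s) x ->
  hamiltonian e' W \/ exists2 s', gpath e' W s' & size (x :: s) < size s'.
Proof.
move=> ee' e'_sym [/and3P[us ss aw] smax] exl.
have cs : cycle e' (x :: s).
  by rewrite /= rcons_path exl andbT; apply: sub_path ss => u v /ee'.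
set S := [set y in x :: s].
have SW : S \subset W by apply/subsetP => y; rewrite inE => /(allP aw).
have Sn : S != set0 by apply/set0Pn; exists x; rewrite !inE eqxx.
case: (eqVneq S W) => [SE|SnW]; first by left; exists (x :: s).
right; have [u [v [uS /setDP[vW vS] euv]]] := expander_connected SW Sn SnW.
move: uS vS; rewrite !in_set => /rot_to[i t rE] vS.
have ut : uniq (u :: t) by rewrite -rE rot_uniq.
have ct : cycle e' (u :: t) by rewrite -rE rot_cycle.
have mt : u :: t =i x :: s by move=> y; rewrite -rE mem_rot.
exists (v :: u :: t); last by rewrite /= -[(size t).+1]/(size (u :: t)) -rE size_rot.
move: ct; rewrite [cycle _ _]/= rcons_path => /andP[pt _].
apply/and3P; split.
- by rewrite cons_uniq mt vS.
- by rewrite [sorted _ _]/= e'_sym ee'.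
- change (mem W v && all (mem W) (u :: t)); apply/andP; split; first exact: vW.
  by apply/allP => y yt; apply: (allP aw); rewrite -mt.
Qed.
End Expander.

(** Only genuine pairs inside [W] count, so [G] may contain arbitrary sets, for instance an empty
    set in the place of a virtual edge. *)
Definition erel W G : rel T :=
  fun u v => [&& u \in W, v \in W, u != v & [set u; v] \in G].

Lemma erel_sym W G : symmetric (erel W G).
Proof.
move=> u v; rewrite /erel eq_sym setUC.
by case: (u \in W); case: (v \in W).
Qed.

Lemma erel_irr W G : irreflexive (erel W G).
Proof. by move=> u; rewrite /erel eqxx !andbF. Qed.

Lemma erel_mono W G1 G2 u v : G1 \subset G2 -> erel W G1 u v -> erel W G2 u v.
Proof.
by move=> sub /and4P[uW vW uv uvG]; rewrite /erel uW vW uv (subsetP sub).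
Qed.

Lemma expander_mono W G1 G2 m : G1 \subset G2 ->
  expander (erel W G1) W m -> expander (erel W G2) W m.
Proof.
move=> sub ex S SW Sm; apply: leq_trans (ex S SW Sm) _.
apply: subset_leq_card; apply: setSD; apply/subsetP => u.
rewrite !inE => /andP[-> /existsP[v /andP[vS evu]]].
by apply/existsP; exists v; rewrite vS (erel_mono sub).
Qed.

Lemma hamiltonian_mono W G1 G2 : G1 \subset G2 ->
  hamiltonian (erel W G1) W -> hamiltonian (erel W G2) W.
Proof.
move=> sub [s [us cs sW]]; exists s; split=> //.
by apply: sub_cycle cs => u v; apply: erel_mono.
Qed.

Lemma gpath_size e W s : gpath e W s -> size s <= #|W|.
Proof.
case/and3P=> us _ aw; rewrite -(card_uniqP us); apply: subset_leq_card.
by apply/subsetP => z /(allP aw).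
Qed.

Lemma longest_nontrivial W G m x t : 0 < m -> expander (erel W G) W m ->
  longest (erel W G) W (x :: t) -> t != [::].
Proof.
move=> m0 ex [tp tmax]; apply: contraT; rewrite negbK => /eqP tE; subst t.
have xW : x \in W by case/and3P: tp => _ _ /andP[].
have := ex [set x]; rewrite sub1set cards1 => /(_ xW m0) le.
have : 0 < #|nbhd (erel W G) W [set x] :\: [set x]| by lia.
rewrite card_gt0 => /set0Pn[v]; rewrite !inE => /and3P[vx vW /existsP[u]].
rewrite inE => /andP[/eqP -> exv].
suff /tmax : gpath (erel W G) W [:: x; v] by [].
by rewrite /gpath /= inE eq_sym vx exv xW vW.
Qed.

(** [F] holds the virtual edge and [G] grows inside [E]. Each added booster lowers the deficit [k]
    of the longest path, so [G] never exceeds [K] edges and boosters are asked for only when [G] is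
    that small. *)
Lemma boosters_hamiltonian W F E m K :
  #|W| < 6 * m ->
  (forall G, G \subset E -> #|G| <= K -> expander (erel W (F :|: G)) W m ->
     ~ hamiltonian (erel W (F :|: G)) W ->
     exists2 f, f \in E & f \in boosters (erel W (F :|: G)) W) ->
  forall k G, G \subset E -> #|G| + k <= K -> expander (erel W (F :|: G)) W m ->
    (exists2 s, gpath (erel W (F :|: G)) W s & #|W| <= size s + k) ->
    hamiltonian (erel W (F :|: E)) W.
Proof.
move=> m6 Hb k G GE GK ex [s sp sk].
case: (pselect (hamiltonian (erel W (F :|: G)) W)) => [ham|nham].
  exact: hamiltonian_mono (setUS F GE) ham.
elim: k G GE GK ex s sp sk nham => [|k IHk] G GE GK ex s sp sk nham;
  have [f fE /imsetP[[x y] /long_endsP[t tl lE] /= fxy]] :=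
    Hb G GE (leq_trans (leq_addr _ _) GK) ex nham.
all: have [tp tmax] := tl.
all: pose G' := f |: G.
all: have GG' : F :|: G \subset F :|: G' by apply/setUS/subsetUr.
all: have G'E : G' \subset E by rewrite subUset sub1set fE.
all: have xW : x \in W by case/and3P: tp => _ _ /andP[].
all: have yW : y \in W by case/and3P: tp => _ _ /allP; apply; rewrite -lE mem_last.
all: have tn : t != [::] by apply: (longest_nontrivial _ ex tl); move: m6; clear; lia.
all: have xy : y != x.
1,3: apply: contraNneq tn => yx; case/and3P: tp; case: t lE {tl tmax} => // z t lE.
1,2: have xt : x \in z :: t by rewrite -[X in X \in _]yx -[X in X \in _]lE; exact: (mem_last z t).
1,2: by rewrite cons_uniq xt.
all: have exy : erel W (F :|: G') (last x t) x
  by rewrite lE /erel yW xW xy in_setU !inE fxy setUC eqxx orbT.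
all: have [ham|[s' s'p s's]] := close_longest (@erel_sym W _) ex m6
  (fun u v => @erel_mono W _ _ u v GG') (@erel_sym W _) tl exy.
1,3: exact: hamiltonian_mono (setUS F G'E) ham.
(* With no deficit left, a longer path would have more than [#|W|] vertices. *)
- by have := gpath_size s'p; have := tmax _ sp; move: sk s's; clear; lia.
- case: (pselect (hamiltonian (erel W (F :|: G')) W)) => [ham|nham'].
    exact: hamiltonian_mono (setUS F G'E) ham.
  apply: (IHk G' G'E _ (expander_mono GG' ex) s' s'p _ nham').
    by apply: leq_trans GK; rewrite cardsU1 addnS -addSn leq_add2r; case: (_ \in _).
  by have := tmax _ sp; move: sk s's; clear; lia.
Qed.
End Boosters.

(** * Binomial random subsets *)

Section ProductSpace.
Variables (R : realType) (T : finType).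
Implicit Types (D E S U : {set T}) (p q : R) (f g : {set T} -> R).

Definition Ex D p f : R :=
  \sum_(E : {set T} | E \subset D) p ^+ #|E| * (1 - p) ^+ (#|D| - #|E|)%N * f E.

Definition Pr D p (A : {set T} -> bool) : R := Ex D p (fun E => (A E)%:R).

Lemma Ex_set0 p f : Ex set0 p f = f set0.
Proof.
rewrite /Ex (big_pred1 set0) => [|E]; last by rewrite subset0.
by rewrite cards0 subnn !expr0 !mul1r.
Qed.

(** Conditioning on the presence of [x]. Constants, monotonicity in [p] and the product formula
    follow from it by induction on [D]. *)
Lemma Ex_rec x D p f : x \notin D ->
  Ex (x |: D) p f = p * Ex D p (fun E => f (x |: E)) + (1 - p) * Ex D p f.
Proof.
move=> xD; rewrite /Ex (bigID (fun E : {set T} => x \in E)) /=; congr (_ + _).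
  rewrite (reindex_onto (fun E => x |: E) (fun E => E :\ x)) /=; last first.
    by move=> E /andP[_ xE]; rewrite setD1K.
  rewrite big_distrr /=; apply: eq_big => [E|E].
    rewrite setU11 andbT; apply/andP/idP => [[]|ED].
      move=> /subsetP sub /eqP <-; apply/subsetP => y.
      by rewrite !inE => /andP[yx]; rewrite (negbTE yx) /= => yE; have := sub y;
         rewrite !inE (negbTE yx) yE => /(_ isT).
    rewrite setUS //; split=> //; apply/eqP/setU1K.
    by apply: contraNN xD; apply: (subsetP ED).
  rewrite setU11 andbT => /andP[ED /eqP EE].
  have xE : x \notin E by rewrite -EE !inE eqxx.
  by rewrite !cardsU1 xD xE /= !add1n subSS exprS !mulrA.
rewrite big_distrr /=; apply: eq_big => [E|E].
  apply/andP/idP => [[/subsetP ED xE]|ED].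
    apply/subsetP => y yE; have := ED y yE; rewrite !inE => /orP[/eqP yx|//].
    by move: xE; rewrite -yx yE.
  split; first exact: subset_trans ED (subsetUr _ _).
  by apply: contraNN xD; apply: (subsetP ED).
case/andP=> ED xE; have {}ED : E \subset D.
  apply/subsetP => y yE; have := subsetP ED y yE; rewrite !inE => /orP[/eqP yx|//].
  by move: xE; rewrite -yx yE.
rewrite cardsU1 xD add1n subSn ?subset_leq_card // exprS !mulrA.
by rewrite (mulrC (1 - p)).
Qed.

Lemma finset_ind (P : {set T} -> Prop) : P set0 ->
  (forall x D, x \notin D -> P D -> P (x |: D)) -> forall D, P D.
Proof.
move=> P0 PS D; elim: {D}#|D| {-2}D (erefl #|D|) => [|k IH] D Dk.
  by move/eqP: Dk; rewrite cards_eq0 => /eqP ->.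
have /set0Pn[x xD] : D != set0 by rewrite -card_gt0 Dk.
rewrite -(setD1K xD); apply: PS; first by rewrite in_setD1 eqxx.
by apply: IH; have := cardsD1 x D; rewrite xD Dk => -[].
Qed.

Lemma eq_Ex D p f g : (forall E, E \subset D -> f E = g E) -> Ex D p f = Ex D p g.
Proof. by move=> fg; apply: eq_bigr => E ED; rewrite fg. Qed.

Lemma ExD D p f g : Ex D p (fun E => f E + g E) = Ex D p f + Ex D p g.
Proof. by rewrite -big_split /=; apply: eq_bigr => E _; rewrite mulrDr. Qed.

Lemma ExZ D p c f : Ex D p (fun E => c * f E) = c * Ex D p f.
Proof. by rewrite big_distrr /=; apply: eq_bigr => E _; rewrite mulrCA. Qed.

Lemma Ex_cst D p c : Ex D p (fun _ => c) = c.
Proof.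
elim/finset_ind: D => [|x D xD IH]; first by rewrite Ex_set0.
by rewrite Ex_rec // IH -mulrDl addrC subrK mul1r.
Qed.

Lemma Ex_sum (I : finType) (P : pred I) D p (F : I -> {set T} -> R) :
  Ex D p (fun E => \sum_(i | P i) F i E) = \sum_(i | P i) Ex D p (F i).
Proof.
rewrite exchange_big /=; apply: eq_bigr => E _; by rewrite big_distrr.
Qed.

Section Bounds.
Variable p : R.
Hypothesis p01 : 0 <= p <= 1.

Lemma Ex_le D f g : (forall E, E \subset D -> f E <= g E) -> Ex D p f <= Ex D p g.
Proof.
move=> fg; apply: ler_sum => E ED; apply: ler_wpM2l; last exact: fg.
by case/andP: p01 => p0 p1; rewrite mulr_ge0 // exprn_ge0 // subr_ge0.
Qed.

Lemma Pr_le D (A B : {set T} -> bool) :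
  (forall E, E \subset D -> A E -> B E) -> Pr D p A <= Pr D p B.
Proof.
move=> AB; apply: Ex_le => E ED; rewrite ler_nat.
by case: (A E) (AB E ED) => // ->.
Qed.

Lemma Pr_markov D (A : {set T} -> bool) g :
  (forall E, E \subset D -> 0 <= g E) ->
  (forall E, E \subset D -> A E -> 1 <= g E) -> Pr D p A <= Ex D p g.
Proof.
move=> g0 g1; apply: Ex_le => E ED.
by case E1: (A E); [apply: g1 | apply: g0].
Qed.

Lemma Pr_union D (I : finType) (P : pred I) (A : {set T} -> bool)
    (B : I -> {set T} -> bool) :
  (forall E, E \subset D -> A E -> exists2 i, P i & B i E) ->
  Pr D p A <= \sum_(i | P i) Pr D p (B i).
Proof.
move=> AB; rewrite -Ex_sum; apply: Pr_markov => E ED.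
  by apply: sumr_ge0 => i _; rewrite ler0n.
case/(AB E ED) => i Pi BiE; rewrite (bigD1 i) //= BiE.
by rewrite lerDl sumr_ge0 // => j _; rewrite ler0n.
Qed.

Lemma Pr_or D (A B C : {set T} -> bool) :
  (forall E, E \subset D -> C E -> A E || B E) ->
  Pr D p C <= Pr D p A + Pr D p B.
Proof.
move=> CAB; rewrite -ExD; apply: Pr_markov => E ED; first by rewrite addr_ge0.
case/(CAB E ED)/orP => ->; first by rewrite lerDl.
by rewrite lerDr.
Qed.

Lemma Pr_compl D (A : {set T} -> bool) : Pr D p (fun E => ~~ A E) = 1 - Pr D p A.
Proof.
apply/eqP; rewrite -subr_eq opprK eq_sym -{1}(Ex_cst D p 1) -ExD; apply/eqP.
by apply: eq_Ex => E _; case: (A E); rewrite ?add0r ?addr0.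
Qed.

Lemma Pr_chebyshev D (f : {set T} -> R) m a (A : {set T} -> bool) : 0 < a ->
  Ex D p f = m ->
  (forall E, E \subset D -> A E -> a <= `|f E - m|) ->
  Pr D p A <= (Ex D p (fun E => f E ^+ 2) - m ^+ 2) / a ^+ 2.
Proof.
move=> a0 fm Aa.
have -> : Ex D p (fun E => f E ^+ 2) - m ^+ 2 = Ex D p (fun E => (f E - m) ^+ 2).
  have -> : Ex D p (fun E => (f E - m) ^+ 2) =
      Ex D p (fun E => f E ^+ 2 + (((- 2 * m) * f E) + m ^+ 2)).
    by apply: eq_Ex => E _; ring.
  by rewrite ExD ExD ExZ Ex_cst fm; ring.
rewrite mulrC -ExZ; apply: Pr_markov => E ED.
  by rewrite mulr_ge0 ?sqr_ge0 // invr_ge0 sqr_ge0.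
move=> /(Aa E ED) le; rewrite mulrC ler_pdivlMr ?exprn_gt0 // mul1r.
by rewrite -[X in _ <= X]real_normK ?num_real // ler_pXn2r // nnegrE // ltW.
Qed.

End Bounds.

(** Induction on the ground set takes the place of a coupling of the two random sets. *)
Lemma Ex_mono D p q f : 0 <= q -> q <= p -> p <= 1 ->
  (forall E E1 : {set T}, E \subset E1 -> f E <= f E1) -> Ex D q f <= Ex D p f.
Proof.
move=> q0 qp p1; elim/finset_ind: D f => [|x D xD IH] f finc.
  by rewrite !Ex_set0.
have q01 : 0 <= q <= 1 by lra.
rewrite !Ex_rec //.
have le1 : Ex D q f <= Ex D q (fun E => f (x |: E)).
  by apply: Ex_le => // E _; apply/finc/subsetUr.
have le2 := IH f finc.
have le3 : Ex D q (fun E => f (x |: E)) <= Ex D p (fun E => f (x |: E)).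
  by apply: IH => E F EF; apply/finc/setUS.
nra.
Qed.

Lemma Ex_prod D p (a b : T -> R) :
  Ex D p (fun E => \prod_(e in D) (if e \in E then a e else b e)) =
  \prod_(e in D) (p * a e + (1 - p) * b e).
Proof.
elim/finset_ind: D => [|x D xD IH]; first by rewrite Ex_set0 !big_set0.
rewrite Ex_rec // big_setU1 //= -IH [in RHS]mulrDl -(mulrA p) -(mulrA (1 - p)) -(ExZ D p (a x)) -(ExZ D p (b x)); congr (_ * _ + _ * _).
  apply: eq_Ex => E ED; rewrite big_setU1 //= setU11; congr (_ * _).
  apply: eq_bigr => e eD; rewrite in_setU1.
  by case: eqVneq => // ex; rewrite -ex eD in xD.
apply: eq_Ex => E ED; rewrite big_setU1 //=.
by case: ifP => // xE; rewrite (subsetP ED) in xD.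
Qed.

(** The joint generating function of the numbers of selected elements in two disjoint sets. Combined
    with [Pr_markov] it is the source of the exponential tail bounds below. *)
Lemma Ex_pow2 D p S U (a b : R) : S \subset D -> U \subset D -> [disjoint S & U] ->
  Ex D p (fun E => a ^+ #|E :&: S| * b ^+ #|E :&: U|) =
  (1 - p + p * a) ^+ #|S| * (1 - p + p * b) ^+ #|U|.
Proof.
move=> SD UD dSU.
pose c e := if e \in S then a else if e \in U then b else 1.
have splitP (F : R -> R) : F 1 = 1 -> \prod_(e in D) F (c e) = F a ^+ #|S| * F b ^+ #|U|.
  move=> F1; rewrite (bigID (mem S)) /=; congr (_ * _).
    rewrite (eq_bigl (mem S)); last first.
      by move=> e /=; case: (boolP (e \in S)) => [eS|]; rewrite ?andbF // (subsetP SD).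
    rewrite (eq_bigr (fun=> F a)) ?prodr_const //.
    by move=> e /= eS; rewrite /c eS.
  rewrite (bigID (mem U)) /= [X in _ * X]big1 ?mulr1; last first.
    by move=> e /andP[/andP[_ eS] eU]; rewrite /c (negbTE eS) (negbTE eU).
  rewrite (eq_bigl (mem U)); last first.
    move=> e /=; case: (boolP (e \in U)) => [eU|]; rewrite ?andbF // andbT.
    by rewrite (subsetP UD) // (disjointFl dSU).
  rewrite (eq_bigr (fun=> F b)) ?prodr_const //.
  by move=> e /= eU; rewrite /c eU (disjointFl dSU).
transitivity (Ex D p (fun E => \prod_(e in D) (if e \in E then c e else 1))).
  apply: eq_Ex => E ED; rewrite -big_mkcondr /=.
  rewrite (eq_bigl (mem E)); last first.
    by move=> e /=; case: (boolP (e \in E)) => [eE|]; rewrite ?andbF // (subsetP ED).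
  rewrite (bigID (mem S)) /=; congr (_ * _).
    rewrite (eq_bigr (fun=> a)) ?prodr_const; last by move=> e /andP[_ eS]; rewrite /c eS.
    by congr (_ ^+ _); apply: eq_card => e; rewrite !inE.
  rewrite (bigID (mem U)) /= [X in _ * X]big1 ?mulr1; last first.
    by move=> e /andP[/andP[_ eS] eU]; rewrite /c (negbTE eS) (negbTE eU).
  rewrite (eq_bigr (fun=> b)) ?prodr_const; last first.
    by move=> e /andP[/andP[_ eS] eU]; rewrite /c eU (negbTE eS).
  congr (_ ^+ _); apply: eq_card => e; rewrite !inE [RHS]unfold_in.
  case: (boolP (e \in U)) => [eU|]; rewrite ?andbF // (disjointFl dSU eU).
  by rewrite !andbT.
rewrite Ex_prod -(splitP (fun c => 1 - p + p * c)); last by rewrite mulr1 subrK.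
by apply: eq_bigr => e _; rewrite mulr1 addrC.
Qed.

Lemma Ex_pow D p S (a : R) : S \subset D ->
  Ex D p (fun E => a ^+ #|E :&: S|) = (1 - p + p * a) ^+ #|S|.
Proof.
move=> SD; have := @Ex_pow2 D p S set0 a 1 SD (sub0set _).
rewrite disjoint_sym -setI_eq0 set0I => /(_ (eqxx _)).
rewrite cards0 expr0 mulr1 => <-.
by apply: eq_Ex => E _; rewrite expr1n mulr1.
Qed.

Lemma Pr_in_out D p S U : S \subset D -> U \subset D -> [disjoint S & U] ->
  Pr D p (fun E => (S \subset E) && [disjoint U & E]) =
  p ^+ #|S| * (1 - p) ^+ #|U|.
Proof.
move=> SD UD dSU.
transitivity (Ex D p (fun E => \prod_(e in D)
    (if e \in E then (if e \in U then 0 else 1) else (if e \in S then 0 else 1)))).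
  apply: eq_Ex => E ED; case: (boolP (_ && _)) => [/andP[SE UE]|].
    rewrite big1 // => e _; case: ifP => [eE|eE].
      by rewrite (disjointFl UE eE).
    by case: ifP => // eS; rewrite (subsetP SE) in eE.
  rewrite negb_and => /orP[/subsetPn[e eS eE]|].
    by rewrite (bigD1 e) ?(subsetP SD) //= (negbTE eE) eS mul0r.
  rewrite -setI_eq0 => /set0Pn[e /setIP[eU eE]].
  by rewrite (bigD1 e) ?(subsetP UD) //= eE eU mul0r.
rewrite Ex_prod (bigID (mem S)) /=; congr (_ * _).
  rewrite (eq_bigl (mem S)); last first.
    by move=> e /=; case: (boolP (e \in S)) => [eS|]; rewrite ?andbF // (subsetP SD).
  rewrite (eq_bigr (fun=> p)) ?prodr_const // => e /= eS.
  by rewrite eS (disjointFr dSU eS) mulr0 addr0 mulr1.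
rewrite (bigID (mem U)) /= [X in _ * X]big1 ?mulr1; last first.
  move=> e /andP[/andP[_ eS] eU]; rewrite (negbTE eS) (negbTE eU).
  by rewrite !mulr1 addrC subrK.
rewrite (eq_bigl (mem U)); last first.
  move=> e /=; case: (boolP (e \in U)) => [eU|]; rewrite ?andbF // andbT.
  by rewrite (subsetP UD) // (disjointFl dSU).
rewrite (eq_bigr (fun=> 1 - p)) ?prodr_const // => e /= eU.
by rewrite eU (disjointFl dSU eU) mulr0 add0r mulr1.
Qed.

(** The sum is read as an expectation for [p = 1 / 2], scaled by [2 ^+ #|D|], so that [Ex_rec]
    provides the induction step. *)
Lemma sum_subsets_pow D (x : R) : \sum_(E : {set T} | E \subset D) x ^+ #|E| = (1 + x) ^+ #|D|.
Proof.
elim/finset_ind: D => [|a D aD IH].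
  rewrite (big_pred1 set0) => [|E]; last by rewrite subset0.
  by rewrite cards0 !expr0.
have := @Ex_rec a D (1/2) (fun E => x ^+ #|E| * 2 ^+ #|a |: D|) aD.
have Ehalf (D' : {set T}) h : Ex D' (1/2) (fun E => h E * 2 ^+ #|D'|) = \sum_(E : {set T} | E \subset D') h E.
  apply: eq_bigr => E ED'; have -> : (1 - 1 / 2 : R) = 1 / 2 by lra.
  rewrite -exprD subnKC ?subset_leq_card // mulrCA -exprMn.
  have -> : (1 / 2 * 2 : R) = 1 by lra.
  by rewrite expr1n mulr1.
rewrite Ehalf => ->.
rewrite cardsU1 aD /= add1n.
have -> : Ex D (1/2) (fun E => x ^+ #|a |: E| * 2 ^+ (#|D|.+1)) =
   2 * x * Ex D (1/2) (fun E => x ^+ #|E| * 2 ^+ #|D|).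
  rewrite -ExZ; apply: eq_Ex => E ED; rewrite cardsU1.
  have -> : a \notin E by apply: contraNN aD; apply: (subsetP ED).
  by rewrite /= !exprS; ring.
have -> : Ex D (1/2) (fun E => x ^+ #|E| * 2 ^+ (#|D|.+1)) =
   2 * Ex D (1/2) (fun E => x ^+ #|E| * 2 ^+ #|D|).
  by rewrite -ExZ; apply: eq_Ex => E ED; rewrite exprS; ring.
by rewrite Ehalf IH exprS; field.
Qed.

End ProductSpace.

Lemma Gnp_probE (R : realType) n (p : R) A : Gnp_prob p A = Pr (all_pairs n) p A.
Proof.
rewrite /Gnp_prob /Pr /Ex big_mkcondr /=; apply: eq_bigr => E _.
by case: (A E); rewrite ?mulr1 ?mulr0.
Qed.

(** * A deterministic criterion for Hamilton cycles in large vertex subsets *)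

Section HamiltonHost.
Local Open Scope nat_scope.
Variable T : finType.
Implicit Types (W S Z : {set T}) (E G : {set {set T}}).

Definition edges_in E Z := [set e in E | e \subset Z].
Definition nb E (u : T) := [set w | (w != u) && ([set u; w] \in E)].

(** All hosts [W], all sets [f] and all small [G] are quantified together because they are chosen
    later in dependence on the graph. The set [f] is the virtual edge, which may lie outside [E]. *)
Definition booster_rich E K := forall W f G, #|T| <= 3 * #|W| -> G \subset E ->
  #|G| <= K -> expander (erel W (f |: G)) W (#|W| %/ 4) ->
  ~ hamiltonian (erel W (f |: G)) W ->
  exists2 g, g \in E & g \in boosters (erel W (f |: G)) W.

(** A certificate for the expansion of sets of more than [a] vertices; its size is bounded so that
    it fits into the edge budget of [booster_rich]. *)
Definition has_connector E K a := exists G, [/\ G \subset E, #|G| <= K &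
  forall S U : {set T}, [disjoint S & U] -> a <= #|S| -> a <= #|U| ->
    exists u v, [/\ u \in S, v \in U & [set u; v] \in G]].

Definition locally_sparse E a q := forall Z, 0 < #|Z| -> #|Z| <= 9 * a ->
  #|edges_in E Z| < q * #|Z|.

Lemma leq_card_bigcup (I J : finType) (P : {set I}) (F : I -> {set J}) k :
  (forall i, i \in P -> #|F i| <= k) -> #|\bigcup_(i in P) F i| <= k * #|P|.
Proof.
move=> Fk; rewrite mulnC -sum_nat_const.
elim/big_rec2: _ => [|i m Z iP le]; first by rewrite cards0.
by apply: leq_trans (leq_card_setU _ _) _; apply: leq_add (Fk i iP) le.
Qed.

Lemma card_bigcup_disjoint (I : finType) (P : {set I}) (F : I -> {set T}) k :
  (forall i, i \in P -> #|F i| = k) ->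
  (forall i j, i \in P -> j \in P -> i != j -> [disjoint F i & F j]) ->
  #|\bigcup_(i in P) F i| = k * #|P|.
Proof.
elim/finset_ind: P => [|x P xP IH] Fk Fd; first by rewrite big_set0 !cards0 muln0.
rewrite big_setU1 //= cardsU1 xP mulnDr muln1 -IH; first last.
- by move=> i j iP jP; apply: Fd; rewrite inE ?iP ?jP orbT.
- by move=> i iP; apply: Fk; rewrite inE iP orbT.
rewrite cardsU Fk ?setU11 // (_ : _ :&: _ = set0) ?cards0 ?subn0 //.
apply/eqP; rewrite setI_eq0; apply/bigcup_disjointP => i iP.
apply: Fd; rewrite ?inE ?eqxx ?iP ?orbT //.
by apply: contraNneq xP => ->.
Qed.

(** The factor 2 accounts for edges that are chosen from both of their ends. *)
Lemma star_edges E S (Q : T -> {set T}) q : (forall u, u \in S -> #|Q u| = q) ->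
  (forall u, u \in S -> Q u \subset nb E u) ->
  q * #|S| <= 2 * #|edges_in E (S :|: \bigcup_(u in S) Q u)|.
Proof.
move=> Qq QE; pose A := [set p : T * T | (p.1 \in S) && (p.2 \in Q p.1)].
have AE : #|A| = q * #|S|.
  rewrite -sum1dep_card -(pair_big_dep (mem S) (fun u w => w \in Q u) (fun _ _ => 1)) /=.
  rewrite mulnC -sum_nat_const; apply: eq_bigr => u uS.
  by rewrite sum1_card Qq.
rewrite -AE; apply: leq_trans (card_unordered A) _; rewrite leq_mul2l /=.
apply: subset_leq_card; apply/subsetP => e /imsetP[[u w]]; rewrite inE /= => /andP[uS wQ] ->.
have := subsetP (QE u uS) w wQ; rewrite !inE => /andP[_ ->] /=.
rewrite subUset !sub1set !inE uS /=; apply/orP; right.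
by apply/bigcupP; exists u.
Qed.

Section Host.
Variables (E : {set {set T}}) (K K1 a q : nat).
Hypotheses (boostE : booster_rich E K) (connE : has_connector E K1 a)
  (sparseE : locally_sparse E a q).
Hypotheses (q0 : 0 < q) (KK1 : K1 + (18 * q + 1) * #|T| <= K)
  (a12 : 12 * a <= #|T|) (T30 : 30 <= #|T|).

(* [L] collects the vertices of [W] of low degree; the vertex [v] of [L] keeps
   only its edges to [A v], one of which may be the virtual edge [f]. *)
Lemma host_hamiltonian (W : {set T}) (f : {set T}) (L : {set T}) (A : T -> {set T}) :
  #|T| <= 3 * #|W| -> L \subset W ->
  (forall v, v \in L -> #|A v| = 2 /\ A v \subset W :\: L) ->
  (forall v w, v \in L -> w \in A v -> [set v; w] \in f |: E) ->
  (forall v v', v \in L -> v' \in L -> v != v' -> [disjoint A v & A v']) ->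
  (forall u, u \in W :\: L -> 18 * q <= #|nb E u :&: W|) ->
  (forall u, u \in W :\: L -> #|nb E u :&: (L :|: \bigcup_(v in L) A v)| <= 1) ->
  hamiltonian (erel W (f |: E)) W.
Proof.
move=> W3 LW A2 AE Adisj degW few.
have [G1 [G1E G1K G1conn]] := connE.
have exQ u : exists B : {set T}, u \in W :\: L ->
    B \subset nb E u :&: W /\ #|B| = 18 * q.
  case: (boolP (u \in W :\: L)) => [uW|_]; last by exists set0.
  by have [B HB] := subset_of_card (degW u uW); exists B.
have [Q HQ] := choice exQ.
pose B u := if u \in L then A u else Q u.
pose G2 := \bigcup_(u in W) [set [set u; w] | w in B u].
(* Intersecting with [E] drops the virtual edge, which is kept separately as [f]. *)
pose G := G1 :|: (G2 :&: E).
have GE : G \subset E by rewrite subUset G1E subsetIr.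
have Bcard u : u \in W -> #|B u| <= 18 * q.
  move=> uW; rewrite /B; case: ifP => [uL|uL]; first by rewrite (A2 u uL).1; lia.
  by have [|_ ->] := HQ u; rewrite // inE uL.
have GK : #|G| + #|W| <= K.
  apply: leq_trans KK1; have WT : #|W| <= #|T| := max_card _.
  have : #|G| <= #|G1| + #|G2|.
    by apply: leq_trans (leq_card_setU _ _) _; rewrite leq_add2l subset_leq_card // subsetIl.
  have : #|G2| <= 18 * q * #|W|.
    apply: leq_card_bigcup => u uW; apply: leq_trans (leq_imset_card _ _) _.
    exact: Bcard.
  have : 18 * q * #|W| <= 18 * q * #|T| by rewrite leq_mul2l WT orbT.
  move: G1K WT; rewrite mulnDl mul1n; lia.
have BG u w : u \in W -> w \in B u -> [set u; w] \in f |: G.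
  move=> uW wB; have : [set u; w] \in f |: E.
    move: wB; rewrite /B; case: ifP => [uL|uL] wB; first exact: AE.
    have [|QE _] := HQ u; first by rewrite inE uL.
    by have := subsetP QE w wB; rewrite !inE => /andP[/andP[_ ->]]; rewrite orbT.
  rewrite !inE => /orP[-> //|->]; rewrite andbT; apply/orP; right; apply/orP; right.
  by apply/bigcupP; exists u => //; apply/imsetP; exists w.
have BW u w : u \in W -> w \in B u -> (w \in W) && (w != u).
  move=> uW; rewrite /B; case: ifP => [uL|uL] wB.
    have := subsetP (A2 u uL).2 w wB; rewrite inE => /andP[wL ->] /=.
    by apply: contraNneq wL => ->.
  have [|QE _] := HQ u; first by rewrite inE uL.
  by have := subsetP QE w wB; rewrite !inE => /andP[/andP[-> _] ->].
have Be u w : u \in W -> w \in B u -> erel W (f |: G) u w.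
  move=> uW wB; have /andP[wW wu] := BW u w uW wB.
  by rewrite /erel uW wW eq_sym wu BG.
apply: (@boosters_hamiltonian _ _ [set f] E (#|W| %/ 4) K _ _ #|W| G) => //.
- have := divn_eq #|W| 4; have := ltn_pmod #|W| (isT : 0 < 4); lia.
- by move=> G' G'E G'K; apply: boostE.
- move=> S SW Sm; set N := nbhd _ _ _.
  have NP u w : u \in S -> w \in W -> erel W (f |: G) u w -> w \in N.
    by move=> uS wW euw; rewrite inE wW; apply/existsP; exists u; rewrite uS.
  (* Sets with more than [a] vertices expand through the connector: fewer than [a] vertices of [W]
     lie outside [S] and its neighbourhood. Smaller sets expand by local sparsity. *)
  case: (leqP #|S| a) => Sa; last first.
    have le : #|W :\: (S :|: N)| < a.
      rewrite ltnNge; apply/negP => Za.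
      have [|u [v [uS]]] := G1conn S _ _ (ltnW Sa) Za.
        by rewrite -setI_eq0 setIDA setDUr (setIC _ W); apply/eqP/setP => x; rewrite !inE;
           case: (x \in S); rewrite ?andbF.
      rewrite inE in_setU negb_or => /andP[/andP[vS vN] vW] uvG.
      case/negP: vN; apply: (NP u) => //; rewrite /erel (subsetP SW) // vW.
      rewrite !inE uvG orbT andbT; by apply: contraNneq vS => <-.
    have NW : N \subset W by apply/subsetP => x; rewrite inE => /andP[].
    have : #|W| <= #|S| + #|N :\: S| + #|W :\: (S :|: N)|.
      rewrite -(cardsID (S :|: N) W) leq_add2r.
      apply: leq_trans (subset_leq_card (subsetIr _ _)) _.
      rewrite (_ : S :|: N = S :|: (N :\: S)) ?leq_card_setU //.
      by apply/setP => x; rewrite !(in_setU, in_setD); case: (x \in S).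
    have := divn_eq #|W| 4; lia.
  pose S1 := S :&: L; pose S2 := S :\: L.
  pose AS := \bigcup_(v in S1) A v; pose QS := \bigcup_(u in S2) Q u.
  have S2W u : u \in S2 -> u \in W :\: L.
    by rewrite !inE => /andP[-> /(subsetP SW)].
  have S12 : #|S1| + #|S2| = #|S| by rewrite cardsID.
  have AS2 : #|AS| = 2 * #|S1|.
    apply: card_bigcup_disjoint => [v|v v']; rewrite !inE => /andP[_ vL].
      by case: (A2 v vL).
    by case/andP=> _ v'L; apply: Adisj.
  (* Otherwise [S2] and its chosen neighbours would be fewer than [9 * #|S2|] vertices spanning at
     least [9 * q * #|S2|] edges, against local sparsity. *)
  have QS8 : 8 * #|S2| <= #|QS :\: S2|.
    have [->|S2n] := eqVneq S2 set0; first by rewrite cards0.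
    have := @star_edges E S2 Q (18 * q) _ _.
    have QT : #|S2 :|: QS| = #|S2| + #|QS :\: S2|.
      by rewrite -(cardsID S2 (S2 :|: QS)) setIUl setIid setDUl setDv set0U
        (setUidPl (subsetIr _ _)).
    rewrite -/QS => /(_ (fun u uS => (HQ u (S2W u uS)).2)).
    have QE u : u \in S2 -> Q u \subset nb E u.
      by move=> uS; apply: subset_trans (HQ u (S2W u uS)).1 (subsetIl _ _).
    move=> /(_ QE) le; rewrite leqNgt; apply/negP => lt.
    have := sparseE (Z := S2 :|: QS).
    have S20 : 0 < #|S2| by rewrite card_gt0.
    rewrite QT => H; have /H {H} : 0 < #|S2| + #|QS :\: S2| by lia.
    have le9 : #|S2| + #|QS :\: S2| <= 9 * #|S2| by lia.
    have S2a : #|S2| <= a by lia.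
    move=> H; have /H {H} : #|S2| + #|QS :\: S2| <= 9 * a by lia.
    have : q * (#|S2| + #|QS :\: S2|) <= q * (9 * #|S2|) by rewrite leq_mul2l le9 orbT.
    lia.
  have Qfew : #|QS :&: (S1 :|: AS)| <= #|S2|.
    have -> : QS :&: (S1 :|: AS) = \bigcup_(u in S2) (Q u :&: (S1 :|: AS)).
      by rewrite big_distrl.
    rewrite -[X in _ <= X]mul1n; apply: leq_card_bigcup => u uS.
    apply: leq_trans (few u (S2W u uS)); apply/subset_leq_card/setISS.
      exact: subset_trans (HQ u (S2W u uS)).1 (subsetIl _ _).
    apply: setUSS; first exact: subsetIr.
    by apply/bigcupsP => v; rewrite inE => /andP[_ vL]; apply: (bigcup_sup v).
  have sub1 : AS :\: S2 \subset N :\: S.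
    apply/subsetP => w; rewrite inE => /andP[wS2 /bigcupP[v]].
    rewrite inE => /andP[vS vL] wA; have vW := subsetP LW v vL.
    have := subsetP (A2 v vL).2 w wA; rewrite inE => /andP[wL wW].
    rewrite inE; apply/andP; split; first by move: wS2; rewrite inE wL.
    by apply: (NP v) => //; apply: Be => //; rewrite /B vL.
  have sub2 : (QS :\: S2) :\: (S1 :|: AS) \subset N :\: S.
    apply/subsetP => w; rewrite !in_setD in_setU negb_or.
    case/andP=> /andP[wS1 wA] /andP[wS2 /bigcupP[u uS2 wQ]].
    have := S2W u uS2; rewrite inE => /andP[uL uW].
    have wB : w \in B u by rewrite /B (negbTE uL).
    have /andP[wW _] := BW u w uW wB.
    apply/andP; split.
      by move: wS1 wS2; rewrite !inE; case: (w \in L); rewrite ?andbT ?andbF.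
    apply: (NP u) => //; last exact: Be.
    by move: uS2; rewrite inE => /andP[].
  have := leq_card_setU (AS :\: S2) ((QS :\: S2) :\: (S1 :|: AS)).
  (* The low vertices provide [2 * #|S1| - #|S2|] outer neighbours and the others at least
     [7 * #|S2|] different ones, in total at least [2 * #|S|]. *)
  have c1 : 2 * #|S1| <= #|AS :\: S2| + #|S2|.
    rewrite -AS2 -(cardsID S2 AS) addnC leq_add2l subset_leq_card //.
    exact: subsetIr.
  have c2 : 8 * #|S2| <= #|(QS :\: S2) :\: (S1 :|: AS)| + #|S2|.
    apply: leq_trans QS8 _; rewrite -(cardsID (S1 :|: AS) (QS :\: S2)) addnC leq_add2l.
    by apply: leq_trans Qfew; apply/subset_leq_card/setSI/subsetDl.
  have : #|(AS :\: S2) :|: ((QS :\: S2) :\: (S1 :|: AS))| =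
     #|AS :\: S2| + #|(QS :\: S2) :\: (S1 :|: AS)|.
    rewrite cardsU (_ : _ :&: _ = set0) ?cards0 ?subn0 //.
    apply/setP => x; rewrite !inE.
    by case: (x \in AS); rewrite ?orbT ?andbF.
  have := subset_leq_card (_ : (AS :\: S2) :|: ((QS :\: S2) :\: (S1 :|: AS)) \subset N :\: S).
  rewrite subUset sub1 sub2 => /(_ isT); lia.
- by exists [::]; rewrite ?leq_addl.
Qed.
End Host.
End HamiltonHost.

(** * Low-degree vertices *)

Lemma cardsU_disjoint (T : finType) (A B : {set T}) :
  (forall x, x \in A -> x \in B -> False) -> (#|A :|: B| = #|A| + #|B|)%N.
Proof.
move=> AB; apply/eqP; rewrite (leq_card_setU A B) disjoint_subset.
by apply/subsetP => x xA; rewrite inE; apply/negP => /(AB x xA).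
Qed.

Lemma cardsU1_notin (T : finType) (x : T) (A : {set T}) :
  x \notin A -> #|x |: A| = #|A|.+1.
Proof. by move=> xA; rewrite cardsU1 xA. Qed.

Section Clean.
Local Open Scope nat_scope.
Variable V : finType.
Variable E : {set {set V}}.
Hypothesis Epairs : forall e, e \in E -> #|e| = 2.
Implicit Types (Z X W : {set V}) (u v w x y : V).

Definition gadj u v := [set u; v] \in E.

Lemma adjC u v : gadj u v = gadj v u.
Proof. by rewrite /gadj setUC. Qed.

Lemma adj_neq u v : gadj u v -> u != v.
Proof.
by move=> /Epairs; rewrite cards2; case: (u != v).
Qed.

Lemma in_nb u w : (w \in nb E u) = gadj u w.
Proof.
rewrite inE; case: (boolP (gadj u w)) => [auw|]; last by rewrite /gadj => /negbTE ->; rewrite andbF.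
by rewrite eq_sym adj_neq.
Qed.

Lemma edges_in_mono Z Z' : Z \subset Z' -> edges_in E Z \subset edges_in E Z'.
Proof.
move=> ZZ; apply/subsetP => e; rewrite !inE => /andP[-> eZ].
exact: subset_trans eZ ZZ.
Qed.

Lemma edges_in_add x Z : x \notin Z ->
  #|edges_in E Z| + #|nb E x :&: Z| <= #|edges_in E (x |: Z)|.
Proof.
move=> xZ; pose g w := [set x; w].
have gi : {in nb E x :&: Z &, injective g}.
  move=> w w'; rewrite !inE => /andP[/andP[wx _] _] _ gww.
  have : w \in g w' by rewrite -gww !inE eqxx orbT.
  by rewrite !inE (negbTE wx) => /eqP.
rewrite -(card_in_imset gi).
have <- : #|edges_in E Z :|: g @: (nb E x :&: Z)| =
    #|edges_in E Z| + #|g @: (nb E x :&: Z)|.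
  apply: cardsU_disjoint => e; rewrite inE => /andP[_ eZ] /imsetP[w _ ee].
  by move: xZ; rewrite (subsetP eZ) // ee !inE eqxx.
apply: subset_leq_card; rewrite subUset edges_in_mono ?subsetUr //=.
apply/subsetP => e /imsetP[w]; rewrite !inE => /andP[/andP[_ exw] wZ] ->.
by rewrite exw subUset !sub1set !inE eqxx wZ orbT.
Qed.

Lemma edges_in_disjoint Z Z' : [disjoint Z & Z'] ->
  #|edges_in E Z| + #|edges_in E Z'| <= #|edges_in E (Z :|: Z')|.
Proof.
move=> dZ; have <- : #|edges_in E Z :|: edges_in E Z'| = #|edges_in E Z| + #|edges_in E Z'|.
  apply: cardsU_disjoint => e; rewrite !inE => /andP[eE eZ] /andP[_ eZ'].
  have e2 := Epairs eE.
  have : e \subset Z :&: Z' by rewrite subsetI eZ.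
  by move: dZ; rewrite -setI_eq0 => /eqP ->; rewrite subset0 => /eqP e0; rewrite e0 cards0 in e2.
by apply: subset_leq_card; rewrite subUset !edges_in_mono ?subsetUr ?subsetUl.
Qed.

Lemma edges_in_path x s : uniq (x :: s) -> path gadj x s ->
  size s <= #|edges_in E [set y in x :: s]|.
Proof.
elim: s x => [|y s IH] x //.
rewrite cons_uniq => /andP[xn us] /= /andP[axy ps].
have := IH y us ps; set Z := [set z in y :: s] => IHs.
have xZ : x \notin Z by rewrite inE.
have -> : [set z in [:: x, y & s]] = x |: Z by apply/setP => z; rewrite !inE.
apply: leq_trans (edges_in_add xZ); rewrite -addn1; apply: leq_add => //.
by rewrite card_gt0; apply/set0Pn; exists y; rewrite inE in_nb axy !inE eqxx.
Qed.

Lemma edges_in_cycle x y s : uniq [:: x, y & s] -> s != [::] ->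
  cycle gadj [:: x, y & s] -> size s + 2 <= #|edges_in E [set z in [:: x, y & s]]|.
Proof.
rewrite cons_uniq => /andP[xn us] sn /= /andP[axy]; rewrite rcons_path => /andP[ps al].
set Z := [set z in y :: s].
have xZ : x \notin Z by rewrite inE.
have -> : [set z in [:: x, y & s]] = x |: Z by apply/setP => z; rewrite !inE.
apply: leq_trans (edges_in_add xZ); apply: leq_add; first exact: edges_in_path.
have yl : y != last y s.
  case: s sn us {ps al xn Z xZ} => // z s _; rewrite cons_uniq => /andP[yn _].
  by apply: contraNneq yn => {1}->; exact: (mem_last z s).
apply: (@leq_trans #|[set y; last y s]|); first by rewrite cards2 yl.
apply/subset_leq_card/subsetP => z; rewrite in_set2 => /orP[]/eqP ->;
  rewrite inE in_nb inE.
  by rewrite axy inE eqxx.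
by rewrite adjC al mem_last.
Qed.

Variable h : nat.
Definition deg u := #|nb E u|.
Definition lowset := [set v | deg v <= h].
(* The weights make a set of size at most 5 rich as soon as it spans a path
   joining two low vertices, while a large rich set is still unlikely. *)
Definition rich Z := 11 * #|Z| <= 10 * #|edges_in E Z| + 9 * #|Z :&: lowset|.

Lemma richI Z k l : 11 * #|Z| <= 10 * k + 9 * l -> k <= #|edges_in E Z| ->
  l <= #|Z :&: lowset| -> rich Z.
Proof.
by move=> le ke ll; apply: leq_trans le _; apply: leq_add; rewrite leq_mul2l ?ke ?ll orbT.
Qed.

Definition clean X := [/\
  forall v, v \in lowset -> v \notin X -> [disjoint nb E v & X],
  forall u, u \notin X -> #|nb E u :&: X| <= 1 &
  forall Z, Z != set0 -> #|Z| <= 5 -> [disjoint Z & X] -> ~~ rich Z].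

(* A largest rich set of bounded size absorbs every vertex and every small rich
   set that would violate cleanness. *)
Lemma clean_exists z0 : 0 < z0 ->
  (forall Z, z0 <= #|Z| <= z0 + 5 -> ~~ rich Z) ->
  exists2 X : {set V}, #|X| < z0 & clean X.
Proof.
move=> z00 norich.
pose P Z := rich Z && (#|Z| <= z0 + 5).
have P0 : P set0 by rewrite /P /rich cards0.
have [X [Xr Xs Xmax]] : exists X : {set V},
    [/\ rich X, #|X| <= z0 + 5 & forall Z, P Z -> #|Z| <= #|X|].
  case: (@arg_maxnP _ set0 P (fun Z => #|Z|) P0) => X /andP[Xr Xs] Xmax.
  by exists X; split.
(* A rich set of size at most [z0 + 5] has size below [z0]. A rich set obtained from [X] by adding
   at most five vertices therefore still satisfies [P] and contradicts maximality. *)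
have Xlt : #|X| < z0.
  by rewrite ltnNge; apply: contraL Xr => le; apply: norich; rewrite le.
have nogrow Z : rich Z -> #|X| < #|Z| -> #|Z| <= #|X| + 5 -> False.
  move=> Zr lt le; have : P Z by rewrite /P Zr; lia.
  by move/Xmax => /= le2; move: lt; rewrite ltnNge le2.
exists X => //; split.
(* A low vertex with a neighbour in [X] gains weight [10 + 9], and in the next case a vertex with
   two neighbours gains [20]; both exceed the [11] that one more vertex costs. *)
- move=> v vL vX; apply: contraT => /pred0Pn[w /andP[/= wv wX]]; exfalso.
  apply: (nogrow (v |: X)); rewrite ?(cardsU1_notin vX) //; last by lia.
  rewrite /rich (cardsU1_notin vX) setIUl (setIidPl _) ?sub1set // cardsU1_notin; last first.
    by rewrite inE (negbTE vX).
  have := edges_in_add vX; have : 0 < #|nb E v :&: X|.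
    by rewrite card_gt0; apply/set0Pn; exists w; rewrite inE wv.
  move: Xr; rewrite /rich; lia.
- move=> u uX; rewrite leqNgt; apply/negP => u2.
  apply: (nogrow (u |: X)); rewrite ?(cardsU1_notin uX) //; last by lia.
  have := edges_in_add uX; rewrite /rich (cardsU1_notin uX).
  have : #|X :&: lowset| <= #|(u |: X) :&: lowset|.
    by apply/subset_leq_card/setSI/subsetUr.
  move: Xr; rewrite /rich; lia.
- move=> Z Zn Z5 dZ; apply/negP => Zr.
  have Z0 : 0 < #|Z| by rewrite card_gt0.
  have c : #|X :|: Z| = #|X| + #|Z|.
    by apply: cardsU_disjoint => x xX; rewrite (disjointFl dZ).
  apply: (nogrow (X :|: Z)); rewrite ?c; [|by lia|by lia].
  rewrite /rich c.
  have := @edges_in_disjoint X Z; rewrite disjoint_sym => /(_ dZ).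
  have -> : #|(X :|: Z) :&: lowset| = #|X :&: lowset| + #|Z :&: lowset|.
    rewrite setIUl; apply: cardsU_disjoint => z; rewrite !inE => /andP[zX _] /andP[zZ _].
    by rewrite (disjointFr dZ) in zX.
  by move: Xr Zr; rewrite /rich; lia.
Qed.

Section CleanSet.
Variable X : {set V}.
Hypothesis cleanX : clean X.

Definition lows := lowset :\: X.
Definition lows_nb := \bigcup_(v in lows) nb E v.

(** A path on [t] vertices, two of them low, has weight at least [10 * (t - 1) + 18], which reaches
    [11 * t] for the sizes [t <= 5] that cleanness controls. *)
Lemma path_not_rich x s : size s <= 4 -> uniq (x :: s) -> path gadj x s ->
  {in x :: s, forall z, z \notin X} ->
  2 <= #|[set y in x :: s] :&: lowset| -> False.
Proof.
move=> s4 us ps sX l2; have [_ _ c3] := cleanX.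
have sz : #|[set y in x :: s]| = (size s).+1 by rewrite cardsE (card_uniqP us).
have : ~~ rich [set y in x :: s].
  apply: c3; rewrite ?sz //; first by apply/set0Pn; exists x; rewrite !inE eqxx.
  rewrite disjoint_subset; apply/subsetP => z; rewrite !inE => zs.
  by apply: sX; rewrite inE.
move/negP; apply; apply: (richI _ (edges_in_path us ps) l2); rewrite sz; move: s4; set k := size s; lia.
Qed.

(** A cycle on [t] vertices spans [t] edges, so a single low vertex is enough:
    [10 * t + 9 >= 11 * t] for [t <= 5]. *)
Lemma cycle_not_rich x y s : size s <= 3 -> s != [::] -> uniq [:: x, y & s] ->
  cycle gadj [:: x, y & s] -> {in [:: x, y & s], forall z, z \notin X} ->
  1 <= #|[set z in [:: x, y & s]] :&: lowset| -> False.
Proof.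
move=> s4 sn us ps sX l2; have [_ _ c3] := cleanX.
have sz : #|[set z in [:: x, y & s]]| = (size s).+2 by rewrite cardsE (card_uniqP us).
have : ~~ rich [set z in [:: x, y & s]].
  apply: c3; rewrite ?sz //; first by apply/set0Pn; exists x; rewrite !inE eqxx.
  rewrite disjoint_subset; apply/subsetP => z; rewrite !inE => zs.
  by apply: sX; rewrite !inE.
move/negP; apply; apply: (richI _ (edges_in_cycle us sn ps) l2); rewrite sz; move: s4; set k := size s; lia.
Qed.

Lemma two_lows (s : seq V) v v' : v \in lows -> v' \in lows -> v != v' -> v \in s -> v' \in s ->
  2 <= #|[set y in s] :&: lowset|.
Proof.
rewrite !inE => /andP[_ vl] /andP[_ vl'] vv vs vs'.
apply: (@leq_trans #|[set v; v']|); first by rewrite cards2 vv.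
by apply/subset_leq_card; rewrite subUset !sub1set !inE vl vl' vs vs'.
Qed.

Lemma nb_lows_notX v w : v \in lows -> gadj v w -> w \notin X.
Proof.
rewrite inE => /andP[vX vl] avw; have [c1 _ _] := cleanX.
by rewrite (disjointFr (c1 v vl vX)) // in_nb.
Qed.

Lemma nb_lows_notlow v w : v \in lows -> gadj v w -> w \notin lowset.
Proof.
move=> vl avw; have wX := nb_lows_notX vl avw; apply/negP => wl.
have wl' : w \in lows by rewrite inE wX.
have vw := adj_neq avw.
apply: (@path_not_rich v [:: w]) => //.
- by rewrite /= inE vw.
- by rewrite /= avw.
- by move=> z; rewrite !inE => /orP[]/eqP -> //; move: vl; rewrite inE => /andP[].
- by apply: (@two_lows _ v w) => //; rewrite !inE eqxx ?orbT.
Qed.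

Lemma nb_lows_disjoint v v' : v \in lows -> v' \in lows -> v != v' ->
  [disjoint nb E v & nb E v'].
Proof.
move=> vl vl' vv; apply: contraT => /pred0Pn[w /andP[/=]]; rewrite !in_nb => aw aw'.
exfalso; have wX := nb_lows_notX vl aw; have wl := nb_lows_notlow vl aw.
have wv : w != v by apply: contraNneq wl => ->; move: vl; rewrite inE => /andP[].
have wv' : w != v' by apply: contraNneq wl => ->; move: vl'; rewrite inE => /andP[].
apply: (@path_not_rich v [:: w; v']) => //.
- by rewrite /= !inE negb_or eq_sym wv vv wv'.
- by rewrite /= aw adjC aw'.
- move=> z; rewrite !inE => /or3P[]/eqP -> //.
    by move: vl; rewrite inE => /andP[].
  by move: vl'; rewrite inE => /andP[].
- by apply: (@two_lows _ v v') => //; rewrite !inE eqxx ?orbT.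
Qed.

(** Two such neighbours would give a path through [u] on at most five vertices between two low
    vertices, or a cycle on three or four vertices through a low vertex. The longest of these paths
    is the reason for the bound 5 in [clean]. *)
Lemma few_lows_nb u : u \notin X -> u \notin lowset ->
  #|nb E u :&: (lows :|: lows_nb)| <= 1.
Proof.
move=> uX ul; apply/card_le1_eqP => w1 w2 /setIP[a1 H1] /setIP[a2 H2].
rewrite !in_nb in a1 a2; apply/eqP/negPn/negP => w12.
have {}w12 : w1 != w2 by rewrite eq_sym.
have near w : w \in lows :|: lows_nb -> exists2 v, v \in lows & w = v \/ gadj v w.
  rewrite inE => /orP[wl|/bigcupP[v vl]]; first by exists w => //; left.
  by rewrite in_nb => avw; exists v => //; right.
have [v1 vl1 e1] := near _ H1; have [v2 vl2 e2] := near _ H2.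
have notX v : v \in lows -> v \notin X by rewrite inE => /andP[].
have low v : v \in lows -> v \in lowset by rewrite inE => /andP[].
have uv v : v \in lows -> u != v by move=> /low vl; apply: contraNneq ul => ->.
have nn v w : v \in lows -> gadj v w -> (w \notin X) * (w \notin lowset).
  by move=> vl avw; rewrite (nb_lows_notX vl avw) (nb_lows_notlow vl avw).
have uw1 := adj_neq a1; have uw2 := adj_neq a2.
have onelow v (s : seq V) : v \in lows -> v \in s -> 1 <= #|[set z in s] :&: lowset|.
  by move=> /low vl vs; rewrite card_gt0; apply/set0Pn; exists v; rewrite inE vl andbT inE.
have vneq v w : v \in lows -> w \notin lowset -> v != w.
  by move=> /low vl wl; apply: contraNneq wl => <-.
have tri v w : v \in lows -> gadj u v -> gadj u w -> gadj v w -> False.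
  move=> vl auv auw avw; have [wX wl] := nn v w vl avw.
  apply: (@cycle_not_rich u v [:: w]) => //.
  - by rewrite /= !inE negb_or uv // (adj_neq auw) vneq.
  - by rewrite /= auv avw adjC auw.
  - by move=> z; rewrite !inE => /or3P[]/eqP -> //; apply: notX.
  - by apply: (onelow v) => //; rewrite !inE eqxx orbT.
case: (eqVneq v1 v2) => [v12|v12].
  subst v2; case: e1 e2 => [e1|e1] [e2|e2].
  - by rewrite e1 e2 eqxx in w12.
  - by subst w1; apply: (tri v1 w2).
  - by subst w2; apply: (tri v1 w1).
  have [wX1 wl1] := nn _ _ vl1 e1; have [wX2 wl2] := nn _ _ vl1 e2.
  apply: (@cycle_not_rich u w1 [:: v1; w2]) => //.
  - rewrite /= !inE !negb_or uw1 uv // uw2 w12 (eq_sym w1) vneq // vneq //.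
  - by rewrite /= a1 adjC e1 e2 adjC a2.
  - by move=> z; rewrite !inE => /or4P[]/eqP -> //; apply: notX.
  - by apply: (onelow v1) => //; rewrite !inE eqxx ?orbT.
have [uv1 uv2] := (uv _ vl1, uv _ vl2).
have ne x y : x != y -> (x != y) * (y != x) by rewrite (eq_sym y) => ->.
have sep v w : v \in lows -> w \notin lowset -> (v != w) * (w != v).
  by move=> vl wl; apply/ne/vneq.
case: e1 e2 => [e1|e1] [e2|e2].
- subst w1 w2; apply: (@path_not_rich v1 [:: u; v2]) => //.
  + by rewrite /= !inE negb_or !(ne _ _ uv1, uv2, v12).
  + by rewrite /= adjC a1 a2.
  + by move=> z; rewrite !inE => /or3P[]/eqP -> //; apply: notX.
  + by apply: (@two_lows _ v1 v2) => //; rewrite !inE eqxx ?orbT.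
- subst w1; have [wX2 wl2] := nn _ _ vl2 e2.
  apply: (@path_not_rich v1 [:: u; w2; v2]) => //.
  + by rewrite /= !inE !negb_or !(ne _ _ uv1, uv2, v12, uw2, sep v1 w2 vl1 wl2, sep v2 w2 vl2 wl2).
  + by rewrite /= adjC a1 a2 adjC e2.
  + by move=> z; rewrite !inE => /or4P[]/eqP -> //; apply: notX.
  + by apply: (@two_lows _ v1 v2) => //; rewrite !inE eqxx ?orbT.
- subst w2; have [wX1 wl1] := nn _ _ vl1 e1.
  apply: (@path_not_rich v1 [:: w1; u; v2]) => //.
  + by rewrite /= !inE !negb_or !(ne _ _ uv1, uv2, v12, ne _ _ uw1, sep v1 w1 vl1 wl1, sep v2 w1 vl2 wl1).
  + by rewrite /= e1 adjC a1 a2.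
  + by move=> z; rewrite !inE => /or4P[]/eqP -> //; apply: notX.
  + by apply: (@two_lows _ v1 v2) => //; rewrite !inE eqxx ?orbT.
have [wX1 wl1] := nn _ _ vl1 e1; have [wX2 wl2] := nn _ _ vl2 e2.
apply: (@path_not_rich v1 [:: w1; u; w2; v2]) => //.
- rewrite /= !inE !negb_or !(ne _ _ uv1, uv2, v12, ne _ _ uw1, uw2, w12).
  by rewrite !(sep v1 w1 vl1 wl1, sep v2 w1 vl2 wl1, sep v1 w2 vl1 wl2, sep v2 w2 vl2 wl2).
- by rewrite /= e1 adjC a1 a2 adjC e2.
- move=> z; rewrite 5!in_cons in_nil orbF => /or4P[/eqP->|/eqP->|/eqP->|/orP[/eqP->|/eqP->]] //; exact: notX.
- by apply: (@two_lows _ v1 v2) => //; rewrite !inE eqxx ?orbT.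
Qed.
End CleanSet.
End Clean.

(** * Vertex sets of paths: ample sets with inner low vertices and two leaf ends *)

Section Traces.
Local Open Scope nat_scope.
Variable V : finType.
Implicit Types (F L W X : {set V}) (u v w x y : V).

Definition traceable (E : {set {set V}}) W := exists x s,
  [/\ uniq (x :: s), path (gadj E) x s & [set y in x :: s] = W].

Lemma traceable1 E x : traceable E [set x].
Proof. by exists x, [::]; split=> //; apply/setP => y; rewrite !inE. Qed.

Variable E : {set {set V}}.
Hypothesis Epairs : forall e, e \in E -> #|e| = 2.

Lemma cycle_rev_tail (e : rel V) x t : symmetric e ->
  cycle e (x :: t) -> cycle e (x :: rev t).
Proof.
move=> e_sym ct; rewrite -(rot_cycle 1) rot1_cons -rev_cons.
by rewrite rev_cycle (eq_cycle (e' := e)) // => a b; rewrite e_sym.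
Qed.

(* Cutting a Hamilton cycle of [W] at its virtual edge leaves a Hamilton path
   of [W] from [x] to [b]. *)
Lemma cut_cycle W x a b : a != b -> x \in W -> 2 < #|W| ->
  (forall w, w \in W -> gadj E x w -> w = a) ->
  hamiltonian (erel W ([set x; b] |: E)) W ->
  exists s, [/\ uniq (x :: s), path (gadj E) x s, [set y in x :: s] = W & last x s = b].
Proof.
move=> ab xW W3 onlya [c [uc cc cW]].
have xc : x \in c by move: xW; rewrite -cW inE.
have [i t rE] := rot_to xc.
set e := erel _ _ in cc.
have e_sym : symmetric e by exact: erel_sym.
have ut : uniq (x :: t) by rewrite -rE rot_uniq.
have ct : cycle e (x :: t) by rewrite -rE rot_cycle.
have tW : [set y in x :: t] = W by rewrite -cW; apply/setP => y; rewrite !in_set -rE mem_rot.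
clear uc cc cW xc rE c i.
have xnb w : e x w -> w = a \/ w = b.
  case/and4P=> _ wW xw; rewrite in_setU1 => /orP[/eqP ee|exw]; last by left; apply: onlya.
  have : w \in [set x; b] by rewrite -ee !inE eqxx orbT.
  by rewrite !inE eq_sym (negbTE xw) => /eqP; right.
have main t' : uniq (x :: t') -> cycle e (x :: t') -> [set y in x :: t'] = W ->
    last x t' = b ->
    exists s, [/\ uniq (x :: s), path (gadj E) x s, [set y in x :: s] = W & last x s = b].
  case: t' => [|d t'] us /=; first by rewrite /e /erel eqxx !andbF.
  case/andP=> exd; rewrite rcons_path => /andP[pd eb] sW lb.
  have t'n : t' != [::].
    apply: contraTneq W3 => t'E; rewrite -sW t'E cardsE -leqNgt.
    exact: (leq_trans (card_size _)).
  have db : d != b.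
    rewrite -lb; case: t' t'n us {pd eb sW lb} => // z t' _ /= /and3P[_ dn _].
    by apply: contraNneq dn => ->; exact: (mem_last z t').
  have da : d = a by case: (xnb d exd) => // dE; rewrite dE eqxx in db.
  have edE : gadj E x d.
    case/and4P: exd => _ _ xd; rewrite in_setU1 => /orP[/eqP ee|//].
    have : d \in [set x; b] by rewrite -ee !inE eqxx orbT.
    by rewrite !inE eq_sym (negbTE xd) (negbTE db).
  exists (d :: t'); split=> //=; rewrite edE /=.
  apply: (@sub_in_path _ (predC1 x) e) pd; last first.
    by apply/allP => z zt; apply/eqP => zx; move: us; rewrite cons_uniq -zx zt.
  move=> z z' /= zx zx' /and4P[_ _ _]; rewrite in_setU1 => /orP[/eqP ee|//].
  have : x \in [set z; z'] by rewrite ee !inE eqxx.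
  by rewrite !inE ![x == _]eq_sym; move: zx zx'; rewrite !inE => /negbTE -> /negbTE ->.
case: (xnb (last x t)) => [|lE|lE]; last exact: (main t).
  by move: ct => /=; rewrite rcons_path => /andP[_]; rewrite e_sym.
have rW : [set y in x :: rev t] = W.
  by rewrite -tW; apply/setP => y; rewrite !in_set !in_cons mem_rev.
apply: (main (rev t)) => //.
- by move: ut; rewrite /= mem_rev rev_uniq.
- exact: cycle_rev_tail.
- case: t ut ct tW lE rW => [|d t] /= ut; first by rewrite /e /erel eqxx !andbF.
  case/andP=> exd _ tW lE _; rewrite rev_cons last_rcons.
  case: (xnb d exd) => // dE; exfalso.
  have tn : t = [::].
    case: t ut tW lE => // z t /and3P[_ dn _] _ /= lE.
    by rewrite dE -lE in dn; case/negP: dn; exact: (mem_last z t).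
  move: W3; rewrite -tW tn cardsE ltnNge => /negP; apply.
  exact: (leq_trans (card_size _)).
Qed.

Variables (K K1 a q h : nat).
Hypotheses (boostE : booster_rich E K) (connE : has_connector E K1 a)
  (sparseE : locally_sparse E a q).
Hypotheses (q0 : 0 < q) (KK1 : K1 + (18 * q + 1) * #|V| <= K)
  (a12 : 12 * a <= #|V|) (T30 : 30 <= #|V|).
Variable X : {set V}.
Hypothesis cleanX : clean E h X.

Local Notation lows := (lows E h X).
Local Notation lows_nb := (lows_nb E h X).
Definition bulk := ~: (X :|: lowset E h).
Definition leaves := [set v in lows | deg E v == 1].
Definition inner := [set v in lows | 1 < deg E v].

(** The degree condition concerns all bulk vertices, also those outside [F], so that it passes to
    every larger subset of the bulk. *)
Definition ample F := [/\ F \subset bulk, #|V| <= 3 * #|F| &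
  forall u, u \in bulk -> 18 * q <= #|nb E u :&: F|].

Lemma bulkP u : u \in bulk -> (u \notin X) * (u \notin lowset E h).
Proof. by rewrite in_setC in_setU negb_or => /andP[-> ->]. Qed.

Lemma lows_notbulk v : v \in lows -> v \notin bulk.
Proof. by rewrite in_setD in_setC in_setU negbK => /andP[_ ->]; rewrite orbT. Qed.

Lemma ample_hamiltonian F L f (A : V -> {set V}) : ample F -> L \subset lows ->
  (forall v, v \in L -> #|A v| = 2 /\ A v \subset F :&: lows_nb) ->
  (forall v w, v \in L -> w \in A v -> [set v; w] \in f |: E) ->
  (forall v v', v \in L -> v' \in L -> v != v' -> [disjoint A v & A v']) ->
  hamiltonian (erel (F :|: L) (f |: E)) (F :|: L).
Proof.
move=> [FN F3 degF] LL A2 AE Ad.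
have FL : (F :|: L) :\: L = F.
  rewrite setDUl setDv setU0; apply/setDidPl; rewrite disjoint_subset.
  apply/subsetP => u uF; rewrite inE; apply: contraL (subsetP FN u uF) => uL.
  exact/lows_notbulk/(subsetP LL).
apply: (host_hamiltonian boostE connE sparseE q0 KK1 a12 T30 (A := A) (L := L)) => //.
- by apply: leq_trans F3 _; rewrite leq_mul2l subset_leq_card // subsetUl.
- exact: subsetUr.
- move=> v vL; rewrite FL; have [-> /subset_trans ->//] := A2 v vL.
  exact: subsetIl.
- rewrite FL => u uF; apply: leq_trans (degF u (subsetP FN u uF)) _.
  by apply/subset_leq_card/setIS/subsetUl.
- rewrite FL => u uF; have [uX ul] := bulkP (subsetP FN u uF).
  apply: leq_trans (few_lows_nb Epairs cleanX uX ul); apply/subset_leq_card/setIS.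
  apply: setUSS => //; apply/bigcupsP => v vL.
  by apply: subset_trans (A2 v vL).2 (subsetIr _ _).
Qed.

Lemma inner_lows : inner \subset lows.
Proof. by apply/subsetP => v; rewrite inE => /andP[]. Qed.

Lemma leaves_lows : leaves \subset lows.
Proof. by apply/subsetP => v; rewrite inE => /andP[]. Qed.

Lemma inner_pair v : exists B : {set V}, v \in inner -> B \subset nb E v /\ #|B| = 2.
Proof.
case: (boolP (v \in inner)) => [|_]; last by exists set0.
by rewrite inE => /andP[_ /subset_of_card[B HB]]; exists B.
Qed.

Lemma nb_lows_nb v : v \in lows -> nb E v \subset lows_nb.
Proof. by move=> vl; apply: (bigcup_sup v). Qed.

Lemma traceable_ample F L : ample F -> L \subset inner -> L = set0 \/ lows_nb \subset F ->
  traceable E (F :|: L).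
Proof.
move=> aF LI LF; have [A HA] := choice inner_pair.
have LL := subset_trans LI inner_lows.
(* The empty set takes the place of the virtual edge and contributes no adjacency. *)
have [s [us cs sW]] : hamiltonian (erel (F :|: L) (set0 |: E)) (F :|: L).
  apply: (@ample_hamiltonian F L _ A aF LL) => [v vL|v w vL wA|v v' vL v'L vv].
  - have [sub ->] := HA v (subsetP LI v vL); split=> //; rewrite subsetI.
    have sub2 := subset_trans sub (nb_lows_nb (subsetP LL v vL)).
    by rewrite sub2 andbT; case: LF => [L0|/(subset_trans sub2)//]; rewrite L0 inE in vL.
  - have [/subsetP/(_ w wA)] := HA v (subsetP LI v vL).
    by rewrite !inE => /andP[_ ->]; rewrite orbT.
  - have := nb_lows_disjoint Epairs cleanX (subsetP LL v vL) (subsetP LL v' v'L) vv.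
    apply: disjointW; [by have [] := HA v (subsetP LI v vL) | by have [] := HA v' (subsetP LI v' v'L)].
case: s us cs sW => [|x s] us cs sW.
  have : F :|: L = set0 by rewrite -sW; apply/setP => y; rewrite !inE.
  have [_ F3 _] := aF; move/eqP; rewrite setU_eq0 => /andP[/eqP F0 _].
  by move: F3 T30; rewrite F0 cards0; case: #|V|.
exists x, s; split=> //; move: cs; rewrite /= rcons_path => /andP[ps _].
apply: sub_path ps => u w /and4P[_ _ _]; rewrite in_setU1 => /orP[/eqP e0|//].
by have := in_set0 u; rewrite -e0 !inE eqxx.
Qed.

Lemma leaf_nb x : x \in leaves -> exists2 w, nb E x = [set w] & gadj E x w.
Proof.
rewrite inE => /andP[_ /cards1P[w nE]]; exists w => //.
by rewrite -(in_nb Epairs) nE inE eqxx.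
Qed.

(** Let [x'] and [y'] be the neighbours of [x] and [y]. A virtual edge between [x] and [y'] makes
    [x] a vertex of degree two. A Hamilton cycle of the set without [y] then uses both edges at [x];
    cutting it at the virtual one leaves a path from [x] to [y'], which is prolonged to [y]. *)
Lemma traceable_leaves F x y : ample F -> lows_nb \subset F ->
  x \in leaves -> y \in leaves -> x != y -> traceable E (F :|: inner :|: [set x; y]).
Proof.
move=> aF nF xl yl xy; have [A HA] := choice inner_pair.
have [x' nx ax] := leaf_nb xl; have [y' ny ay] := leaf_nb yl.
have [xL yL] := (subsetP leaves_lows x xl, subsetP leaves_lows y yl).
have [FN F3 _] := aF.
have nleaf v : v \in leaves -> v \notin inner.
  by rewrite !inE => /andP[_ /eqP ->]; rewrite andbF.
have nF' v : v \in lows -> v \notin F.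
  by move=> /lows_notbulk; apply: contraNN => /(subsetP FN).
have x'F : x' \in F.
  by apply: (subsetP nF); apply: (subsetP (nb_lows_nb xL)); rewrite nx inE.
have y'F : y' \in F.
  by apply: (subsetP nF); apply: (subsetP (nb_lows_nb yL)); rewrite ny inE.
have x'n : x' \in lows_nb by apply: (subsetP (nb_lows_nb xL)); rewrite nx inE.
have y'n : y' \in lows_nb by apply: (subsetP (nb_lows_nb yL)); rewrite ny inE.
have x'y' : x' != y'.
  have := nb_lows_disjoint Epairs cleanX xL yL xy; rewrite nx ny.
  by rewrite disjoints1 inE.
pose L := x |: inner; pose A' v := if v == x then [set x'; y'] else A v.
have LL : L \subset lows by rewrite subUset sub1set xL inner_lows.
have inI v : v \in L -> v != x -> v \in inner by rewrite !inE => /orP[->|].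
have disj v : v \in L -> v != x -> [disjoint [set x'; y'] & A v].
  move=> vL vx; have vI := inI v vL vx; have vl := subsetP LL v vL.
  have vy : v != y by apply: contraTneq vI => ->; apply: nleaf.
  have subA : A v \subset nb E v by have [] := HA v vI.
  have dx := nb_lows_disjoint Epairs cleanX vl xL vx.
  have dy := nb_lows_disjoint Epairs cleanX vl yL vy.
  rewrite disjoint_sym disjoint_subset; apply/subsetP => z zA; rewrite !inE.
  have zv := subsetP subA z zA.
  move: (disjointFr dx zv) (disjointFr dy zv); rewrite nx ny !inE.
  by move=> -> ->.
have ham : hamiltonian (erel (F :|: L) ([set x; y'] |: E)) (F :|: L).
  apply: (@ample_hamiltonian F L _ A' aF LL).
  - move=> v vL; rewrite /A'; case: eqVneq => [vx|vx].
      by rewrite cards2 x'y'; split=> //; rewrite subUset !sub1set !in_setI x'F y'F x'n y'n.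
    have [sub ->] := HA v (inI v vL vx); split=> //; rewrite subsetI.
    have sub2 := subset_trans sub (nb_lows_nb (subsetP LL v vL)).
    by rewrite sub2 (subset_trans sub2 nF).
  - move=> v w vL; rewrite /A'; case: eqVneq => [->|vx].
      by rewrite !inE => /orP[]/eqP ->; rewrite ?eqxx // [_ \in E]ax orbT.
    move=> wA; have [/subsetP/(_ w wA)] := HA v (inI v vL vx).
    by rewrite !inE => /andP[_ ->]; rewrite orbT.
  - move=> v v' vL v'L vv; rewrite /A'; case: eqVneq => [vx|vx]; case: eqVneq => [v'x|v'x].
    + by rewrite vx v'x eqxx in vv.
    + exact: disj.
    + by rewrite disjoint_sym; apply: disj.
    + have vI := inI v vL vx; have v'I := inI v' v'L v'x.
      have := nb_lows_disjoint Epairs cleanX (subsetP LL v vL) (subsetP LL v' v'L) vv.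
      by apply: disjointW; [have [] := HA v vI | have [] := HA v' v'I].
have [|||s [us ps sW ls]] := @cut_cycle (F :|: L) x x' y' x'y' _ _ _ ham.
- by rewrite !inE eqxx orbT.
- have : #|F| <= #|F :|: L| by apply/subset_leq_card/subsetUl.
  by move: F3 T30; move: (#|F :|: L|) (#|F|) (#|V|); clear => x0 y0 z0; lia.
- by move=> w _ axw; apply/set1P; rewrite -nx in_nb.
have yW : y \notin F :|: L.
  by rewrite !in_setU in_set1 (negbTE (nF' y yL)) eq_sym (negbTE xy) (nleaf y yl).
exists x, (rcons s y); split.
- rewrite -rcons_cons rcons_uniq us andbT; apply: contraNN yW => ys.
  by rewrite -sW inE.
- by rewrite rcons_path ps ls adjC.
- rewrite -rcons_cons; apply/setP => z; rewrite inE mem_rcons in_cons.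
  have := congr1 (fun B : {set V} => z \in B) sW; rewrite inE => ->.
  by rewrite !inE; case: (z == x); case: (z == y); rewrite ?orbT ?orbF.
Qed.
End Traces.

(** * Assembling a separating family of traceable sets *)

Section Families.
Local Open Scope nat_scope.

Definition separates (V : finType) (Ws : seq {set V}) (u v : V) :=
  has (fun W : {set V} => (u \in W) != (v \in W)) Ws.

Lemma separatesC (V : finType) Ws (u v : V) : separates Ws u v = separates Ws v u.
Proof. by apply: eq_has => W; rewrite eq_sym. Qed.

Lemma separatesP (V : finType) (Ws : seq {set V}) W (u v : V) : W \in Ws ->
  u \in W -> v \notin W -> separates Ws u v.
Proof. by move=> WW uW vW; apply/hasP; exists W => //; rewrite uW (negbTE vW). Qed.

Lemma bits_inj k i j : i < 2 ^ k -> j < 2 ^ k ->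
  (forall b, b < k -> odd (i %/ 2 ^ b) = odd (j %/ 2 ^ b)) -> i = j.
Proof.
elim: k i j => [|k IH] i j; first by rewrite expn0 !ltnS !leqn0 => /eqP -> /eqP ->.
rewrite expnSr => ilt jlt H.
have oE : odd i = odd j by have := H 0 isT; rewrite expn0 !divn1.
have hE : i %/ 2 = j %/ 2.
  apply: IH; rewrite ?ltn_divLR // => b bk.
  by have := H b.+1; rewrite ltnS expnS !divnMA => /(_ bk).
by rewrite -(odd_double_half i) -(odd_double_half j) -!divn2 oE hE.
Qed.

Lemma bit_sets (V : finType) (A : {set V}) k : #|A| <= 2 ^ k ->
  exists Bs : seq {set V}, [/\ size Bs = k, forall B, B \in Bs -> B \subset A &
    forall u v, u \in A -> v \in A -> u != v -> separates Bs u v].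
Proof.
move=> Ak; pose ix v := index v (enum A).
pose B b := [set v in A | odd (ix v %/ 2 ^ b)].
exists [seq B b | b <- iota 0 k]; split.
- by rewrite size_map size_iota.
- by move=> _ /mapP[b _ ->]; apply/subsetP => v; rewrite inE => /andP[].
move=> u v uA vA uv; apply: contraT => /hasPn ns; case/negP: uv; apply/eqP.
have ixlt w : w \in A -> ix w < 2 ^ k.
  by move=> wA; apply: leq_trans Ak; rewrite cardE index_mem mem_enum.
have : ix u = ix v.
  apply: bits_inj (ixlt u uA) (ixlt v vA) _ => b bk.
  have /ns : B b \in [seq B b | b <- iota 0 k] by apply: map_f; rewrite mem_iota.
  by rewrite negbK !inE uA vA /= => /eqP.
by apply: (index_inj u); rewrite mem_enum.
Qed.

(** The two pairs of a triple, its first two and its last two members, give the three members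
    distinct traces. All three traces are nonempty, so different triples are told apart as well. *)
Lemma pair_pattern t a b : a < 3 * t -> b < 3 * t -> a != b ->
  exists j r, [/\ j < t, r < 2 & ((a == 3 * j + r) || (a == 3 * j + r + 1)) !=
                            ((b == 3 * j + r) || (b == 3 * j + r + 1))].
Proof.
move=> at3 bt3 ab.
have aE := divn_eq a 3; have am := ltn_pmod a (isT : 0 < 3).
have bE := divn_eq b 3; have bm := ltn_pmod b (isT : 0 < 3).
move: aE am bE bm; set ja := a %/ 3; set ra := a %% 3; set jb := b %/ 3; set rb := b %% 3.
move=> aE am bE bm.
have [ra0|ra0] := leqP ra 0.
  have [rb1|rb1] := eqVneq b a.+1.
    by exists ja, 1; split; lia.
  by exists ja, 0; split; lia.
have [ra1|ra1] := leqP ra 1.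
  have [rb1|rb1] := eqVneq b a.+1.
    by exists ja, 0; split; lia.
  by exists ja, 1; split; lia.
have [rb1|rb1] := eqVneq b.+1 a.
  by exists ja, 0; split; lia.
by exists ja, 1; split; lia.
Qed.

Section SpBound.
Variables (n : nat) (E : {set {set 'I_n}}).

Lemma sp_le (Ws : seq {set 'I_n}) : (forall W, W \in Ws -> traceable E W) ->
  (forall u v, u != v -> separates Ws u v) -> sp E <= size Ws.
Proof.
move=> tr sep; rewrite /sp; case: ex_minnP => m _; apply; apply/asboolP.
have [F [sF pF mF]] : exists F : seq (seq 'I_n), [/\ size F = size Ws,
    all (is_path E) F & [seq [set x in s] | s <- F] = Ws].
  elim: Ws tr {sep} => [|W Ws IH] tr; first by exists [::].
  have [|F [sF pF mF]] := IH; first by move=> W' W'W; apply: tr; rewrite inE W'W orbT.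
  have [x [s [us ps sW]]] := tr W (mem_head _ _).
  exists ((x :: s) :: F); split; rewrite /= ?sF ?sW ?mF //.
  by move: us => /= -> /=; rewrite [path _ _ _]ps.
exists F; split=> //; rewrite mF.
by apply/forallP => u; apply/forallP => v; apply/implyP => /sep.
Qed.

(** Membership in the sets of a separating family is an injective code of the vertices by bits. *)
Lemma sp_lower_log : n <= 2 ^ sp E.
Proof.
rewrite /sp; case: ex_minnP => m /asboolP[F [sF _ /forallP sepF]] _.
pose Ws := [seq [set x in s] | s <- F].
pose code (u : 'I_n) : m.-tuple bool := [tuple u \in nth set0 Ws i | i < m].
have ci : injective code.
  move=> u v cuv; apply/eqP; apply: contraT => uv.
  have /forallP/(_ v)/implyP/(_ uv)/hasP[W WW] := sepF u.
  have /= [i ilt iW] := nthP set0 WW; rewrite size_map sF in ilt.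
  have := congr1 (fun t => tnth t (Ordinal ilt)) cuv.
  by rewrite !tnth_mktuple /= /Ws -iW => ->; rewrite eqxx.
have := leq_card code ci; rewrite card_ord => /leq_trans; apply.
by rewrite card_tuple card_bool.
Qed.
End SpBound.

Section Assembly.
Variable V : finType.
Variable E : {set {set V}}.
Hypothesis Epairs : forall e, e \in E -> #|e| = 2.
Variables (K K1 a q h : nat).
Hypotheses (boostE : booster_rich E K) (connE : has_connector E K1 a)
  (sparseE : locally_sparse E a q).
Hypotheses (q0 : 0 < q) (KK1 : K1 + (18 * q + 1) * #|V| <= K)
  (a12 : 12 * a <= #|V|) (T30 : 30 <= #|V|).
Variable X : {set V}.
Hypothesis cleanX : clean E h X.

Local Notation lows := (lows E h X).
Local Notation lows_nb := (lows_nb E h X).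
Local Notation bulk := (bulk E h X).
Local Notation leaves := (leaves E h X).
Local Notation inner := (inner E h X).
Local Notation ample := (ample E q h X).

(** The bulk vertices that [FF] has to separate. Neighbours of low vertices lie in every member of
    [FF] instead, so that low vertices can be attached to each of them. *)
Definition unattached := bulk :\: lows_nb.
Definition isolated := [set v in lows | deg E v == 0].

Definition leaf_pair i : {set V} :=
  [set x in leaves | (index x (enum leaves) == 3 * (i %/ 2) + i %% 2) ||
                     (index x (enum leaves) == 3 * (i %/ 2) + i %% 2 + 1)].

Lemma leaf_pairE i : i < 2 * (#|leaves| %/ 3) ->
  exists x y, [/\ x \in leaves, y \in leaves, x != y & leaf_pair i = [set x; y]].
Proof.
move=> it; set k := 3 * (i %/ 2) + i %% 2.
have k1 : k + 1 < size (enum leaves).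
  rewrite -cardE /k; have := divn_eq i 2; have := ltn_pmod i (isT : 0 < 2).
  by have := leq_trunc_div #|leaves| 3; lia.
have [x0 _] : exists x, x \in leaves.
  by apply/set0Pn; rewrite -card_gt0 cardE; apply: leq_ltn_trans k1.
have k0 : k < size (enum leaves) by apply: leq_ltn_trans k1; rewrite leq_addr.
have inl j : j < size (enum leaves) -> nth x0 (enum leaves) j \in leaves.
  by move=> jl; rewrite -mem_enum mem_nth.
exists (nth x0 (enum leaves) k), (nth x0 (enum leaves) (k + 1)); split; rewrite ?inl //.
  by rewrite nth_uniq ?enum_uniq // addn1 neq_ltn ltnSn.
apply/setP => x; rewrite in_set2 [LHS]inE -/k.
apply/andP/orP => [[xl /orP[]/eqP xk]|].
- by left; rewrite -xk nth_index ?mem_enum.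
- by right; rewrite -xk nth_index ?mem_enum.
- by case=> /eqP ->; rewrite index_uniq ?enum_uniq // inl // eqxx ?orbT.
Qed.

(* The leaves are consumed in triples [x, y, z]: a path ending in [x, y] and one
   ending in [y, z] tell the three apart, at 2/3 of a path per leaf. *)
Lemma separating_family (FF : seq {set V}) k1 k2 :
  (forall F, F \in FF -> ample F /\ lows_nb \subset F) ->
  (forall u v, u \in unattached -> v \in unattached -> u != v -> separates FF u v) ->
  ample bulk -> ample unattached -> lows_nb \subset bulk ->
  #|lows| <= 2 ^ k1 -> #|lows_nb| <= 2 ^ k2 ->
  exists Ws : seq {set V}, [/\ forall W, W \in Ws -> traceable E W,
    forall u v, u != v -> separates Ws u v &
    size Ws <= #|X| + #|isolated| + maxn (size FF) (2 * (#|leaves| %/ 3)) + k1 + k2 + 5].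
Proof.
move=> FFa FFs aN aN0 nN lk1 lk2.
set t := #|leaves| %/ 3; set M := maxn _ _.
pose ls := enum leaves.
have [B1 [B1s B1sub B1sep]] := bit_sets (leq_trans (subset_leq_card (inner_lows E h X)) lk1).
have [B2 [B2s B2sub B2sep]] := bit_sets lk2.
pose lp i := if i < 2 * t then leaf_pair i else set0.
(* One path carries a member of [FF] and a pair of leaves, which is why [M] is a maximum. Beyond the
   end of [FF] the default [bulk] is used, and from index [2 * t] on there is no pair of leaves. *)
pose Wi i := nth bulk FF i :|: inner :|: lp i.
(* These vertices receive a path of their own. The at most two leaves outside the triples, together
   with the sets [bulk], [bulk :|: inner] and [unattached], account for the final [5] of the
   bound. *)
pose S := enum X ++ enum isolated ++ drop (3 * t) ls.
pose Ws := [seq [set x] | x <- S] ++ [seq Wi i | i <- iota 0 M] ++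
  [:: bulk; bulk :|: inner; unattached] ++ [seq bulk :|: B | B <- B1] ++
  [seq unattached :|: B | B <- B2].
have FFn i : ample (nth bulk FF i) /\ lows_nb \subset nth bulk FF i.
  case: (ltnP i (size FF)) => [iF|iF]; first by apply/FFa/mem_nth.
  by rewrite nth_default.
have tr_ample (F L : {set V}) : ample F -> L \subset inner -> L = set0 \/ lows_nb \subset F ->
    traceable E (F :|: L).
  exact: (traceable_ample Epairs boostE connE sparseE q0 KK1 a12 T30 cleanX).
exists Ws; split.
- move=> W; rewrite !mem_cat; case/or4P => [/mapP[x _ ->]|/mapP[i _ ->]| |/orP[]/mapP[B BB ->]].
  + exact: traceable1.
  + have [aF nF] := FFn i; rewrite /Wi /lp; case: ifP => it.
      have [x [y [xl yl xy ->]]] := leaf_pairE it.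
      exact: (traceable_leaves Epairs boostE connE sparseE q0 KK1 a12 T30 cleanX).
    by rewrite setU0; apply: tr_ample => //; right.
  + rewrite !inE => /or3P[]/eqP ->.
    * by rewrite -[bulk]setU0; apply: tr_ample; rewrite ?sub0set //; left.
    * by apply: tr_ample => //; right.
    * by rewrite -[unattached]setU0; apply: tr_ample; rewrite ?sub0set //; left.
  + by apply: tr_ample; [|exact: B1sub|right].
  + rewrite -[_ :|: B]setU0; apply: tr_ample; rewrite ?sub0set //; last by left.
    have [aN01 aN02 aN03] := aN0; split.
    * by rewrite subUset aN01 (subset_trans (B2sub B BB)).
    * by apply: leq_trans aN02 _; rewrite leq_mul2l subset_leq_card // subsetUl.
    * by move=> u uN; apply: leq_trans (aN03 u uN) _; apply/subset_leq_card/setIS/subsetUl.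
- have single u v : u \in S -> u != v -> separates Ws u v.
    move=> uS uv; apply: (@separatesP _ _ [set u]); rewrite ?inE // 1?eq_sym //.
    by rewrite /Ws mem_cat map_f.
  have inWi i : i < M -> Wi i \in Ws.
    by move=> iM; rewrite /Ws !mem_cat (map_f Wi) ?mem_iota ?orbT.
  have inN : bulk \in Ws by rewrite /Ws !mem_cat !inE eqxx !orbT.
  have inNI : bulk :|: inner \in Ws by rewrite /Ws !mem_cat !inE eqxx !orbT.
  have inN0 : unattached \in Ws by rewrite /Ws !mem_cat !inE eqxx !orbT.
  have inB1 B : B \in B1 -> bulk :|: B \in Ws.
    by move=> BB; rewrite /Ws !mem_cat (map_f (fun B => bulk :|: B)) ?orbT.
  have inB2 B : B \in B2 -> unattached :|: B \in Ws.
    by move=> BB; rewrite /Ws !mem_cat (map_f (fun B => unattached :|: B)) ?orbT.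
  have lown v : v \in lows -> (v \in bulk) = false.
    by move=> /lows_notbulk/negbTE.
  have nlow v : v \in bulk -> (v \in inner = false) * (forall i, v \in lp i = false).
    move=> vN; split.
      by apply: contraTF vN => /(subsetP (inner_lows E h X))/lown ->.
    move=> i; rewrite /lp; case: ifP => _; last by rewrite inE.
    apply: contraTF vN; rewrite inE => /andP[/(subsetP (leaves_lows E h X))/lown -> _].
    by [].
  have NN u v : u \in bulk -> v \notin bulk -> separates Ws u v.
    by move=> uN vN; apply: (separatesP inN).
  have N0N0 u v : u \in bulk -> v \in bulk -> u != v -> separates Ws u v.
    move=> uN vN uv.
    have freeE w : w \in bulk -> (w \in unattached) = (w \notin lows_nb).
      by move=> wN; rewrite in_setD wN andbT.
    case: (boolP (u \in lows_nb)) => uR; case: (boolP (v \in lows_nb)) => vR.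
    - have /hasP[B BB ne] := B2sep u v uR vR uv.
      apply/hasP; exists (unattached :|: B); first exact: inB2.
      by rewrite !in_setU !freeE // uR vR.
    - rewrite separatesC; apply: (separatesP inN0); first by rewrite freeE.
      by rewrite freeE // negbK.
    - by apply: (separatesP inN0); rewrite freeE // negbK.
    - have /hasP[F FF' ne] : separates FF u v by apply: FFs; rewrite ?freeE.
      have iF : index F FF < M by rewrite leq_max index_mem FF'.
      apply/hasP; exists (Wi (index F FF)); first exact: inWi.
      by rewrite /Wi !in_setU nth_index // !nlow // !orbF.
  have classify v : v \notin S -> v \notin bulk -> v \in inner \/
      v \in leaves /\ index v ls < 3 * t.
    rewrite /S !mem_cat !mem_enum !negb_or => /and3P[vX vI vd] vN.
    have vl : v \in lows.
      by rewrite in_setD vX; move: vN; rewrite in_setC in_setU negbK (negbTE vX).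
    case d: (deg E v) => [|[|k]].
    - by move: vI; rewrite inE vl d.
    - right; have vlv : v \in leaves by rewrite inE vl d.
      split=> //; rewrite ltnNge; apply: contra vd => le.
      have vls : v \in ls by rewrite mem_enum.
      rewrite -(nth_index v vls) -(subnKC le) -nth_drop mem_nth // size_drop.
      by rewrite ltn_sub2r ?index_mem // (leq_ltn_trans le) ?index_mem.
    - by left; rewrite inE vl d.
  have leafleaf u v : u \in leaves -> v \in leaves -> index u ls < 3 * t -> index v ls < 3 * t ->
      u != v -> separates Ws u v.
    move=> ul vl ut vt uv.
    have iuv : index u ls != index v ls.
      by apply: contraNneq uv => H; apply/eqP; apply: (index_inj u) H; rewrite mem_enum.
    have [j [r [jt r2 ne]]] := pair_pattern ut vt iuv.
    have i2 : (j * 2 + r) %/ 2 = j by rewrite divnMDl // divn_small // addn0.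
    have ir : (j * 2 + r) %% 2 = r by rewrite modnMDl modn_small.
    have it : j * 2 + r < 2 * t by move: jt r2; clear; lia.
    have iM : j * 2 + r < M by rewrite leq_max it orbT.
    have nin w : w \in leaves -> (w \in nth bulk FF (j * 2 + r) = false) * (w \in inner = false).
      move=> wl; split.
        have [[sub _ _] _] := FFn (j * 2 + r); have := lown w (subsetP (leaves_lows E h X) w wl).
        by apply: contraFF => /(subsetP sub).
      by move: wl; rewrite !inE => /andP[_ /eqP ->]; rewrite andbF.
    apply/hasP; exists (Wi (j * 2 + r)); first exact: inWi.
    rewrite /Wi !in_setU !nin // /lp it !orFb.
    by rewrite [u \in _]inE [v \in _]inE ul vl i2 ir.
  have innerleaf u v : u \in inner -> v \in leaves -> separates Ws u v.
    move=> uI vl; apply: (separatesP inNI); first by rewrite in_setU uI orbT.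
    rewrite in_setU (lown v (subsetP (leaves_lows E h X) v vl)).
    by move: vl; rewrite !inE => /andP[_ /eqP ->]; rewrite andbF.
  move=> u v uv.
  case: (boolP (u \in S)) => uS; first exact: single.
  case: (boolP (v \in S)) => vS; first by rewrite separatesC; apply: single; rewrite // eq_sym.
  case: (boolP (u \in bulk)) => uN; case: (boolP (v \in bulk)) => vN.
  + exact: N0N0.
  + exact: NN.
  + by rewrite separatesC; apply: NN.
  case: (classify u uS uN) => [uI|[ul ut]]; case: (classify v vS vN) => [vI|[vl vt]].
  + have /hasP[B BB ne] := B1sep u v uI vI uv.
    apply/hasP; exists (bulk :|: B); first exact: inB1.
    by rewrite !in_setU (negbTE uN) (negbTE vN).
  + exact: innerleaf.
  + by rewrite separatesC; apply: innerleaf.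
  + exact: leafleaf.
- rewrite /Ws !size_cat !size_map size_iota B1s B2s /= /S !size_cat -!cardE size_drop -cardE.
  have := divn_eq #|leaves| 3; have := ltn_pmod #|leaves| (isT : 0 < 3).
  rewrite -/t; move: (#|leaves|) => l; lia.
Qed.
End Assembly.
End Families.

(** * The local lemma and separating families *)

Section LocalLemma.
Local Open Scope nat_scope.
Variables (I J : finType) (A : I -> {set {set J}}) (D : I -> {set J}).

(** An event determined inside [C] is independent of one determined outside: [phi] exchanges the
    outer parts of two sets and matches pairs with first member in [P :&: Q] with pairs from [P] and
    [Q]. *)
Lemma independent_card (P Q : {set {set J}}) (C : {set J}) :
  (forall f g : {set J}, f :&: C = g :&: C -> (f \in P) = (g \in P)) ->
  (forall f g : {set J}, f :\: C = g :\: C -> (f \in Q) = (g \in Q)) ->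
  #|P :&: Q| * #|{set J}| = #|P| * #|Q|.
Proof.
move=> PC QC.
pose phi (x : {set J} * {set J}) :=
  ((x.1 :&: C) :|: (x.2 :\: C), (x.2 :&: C) :|: (x.1 :\: C)).
have phiK : involutive phi.
  by case=> f g; congr pair; apply/setP => x; rewrite /= !inE; case: (x \in C);
    rewrite ?andbT ?andbF ?orbF.
have phi1 x : (phi x).1 :&: C = x.1 :&: C.
  by apply/setP => y; rewrite /= !inE; case: (y \in C); rewrite ?andbT ?andbF ?orbF.
have phi2 x : (phi x).2 :\: C = x.1 :\: C.
  by apply/setP => y; rewrite /= !inE; case: (y \in C); rewrite ?andbT ?andbF ?orbF.
rewrite -cardsT -!cardsX -(card_imset _ (inv_inj phiK)).
apply: eq_card => x; rewrite [RHS]inE; apply/imsetP/andP => [[y]|[xP xQ]].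
  rewrite !inE andbT => /andP[yP yQ] ->.
  by rewrite (PC _ _ (phi1 y)) (QC _ _ (phi2 y)).
exists (phi x); last by rewrite phiK.
rewrite !inE andbT (PC _ _ (phi1 x)) xP /=.
by rewrite -(QC _ _ (phi2 (phi x))) phiK.
Qed.

Variable d : nat.
Hypothesis AD : forall i (f g : {set J}), f :&: D i = g :&: D i -> (f \in A i) = (g \in A i).
Hypothesis Asmall : forall i, 4 * d * #|A i| <= #|{set J}|.
Hypothesis Ddeg : forall i, #|[set j | (j != i) && ~~ [disjoint D j & D i]]| <= d.
Hypothesis d0 : 0 < d.

Definition avoiding (S : {set I}) := [set f : {set J} | [forall i in S, f \notin A i]].

Lemma avoiding_split (S S1 : {set I}) :
  #|avoiding (S :\: S1)| <= #|avoiding S| + \sum_(j in S1) #|A j :&: avoiding (S :\: S1)|.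
Proof.
apply: (@leq_trans #|avoiding S :|: \bigcup_(j in S1) (A j :&: avoiding (S :\: S1))|).
  apply/subset_leq_card/subsetP => f fa; rewrite in_setU.
  case: (boolP (f \in avoiding S)) => //= nf.
  move: nf; rewrite inE negb_forall => /existsP[i]; rewrite negb_imply negbK => /andP[iS fA].
  apply/bigcupP; exists i; last by rewrite inE fA.
  apply: contraT => iS1; move: fa; rewrite inE => /forall_inP/(_ i).
  by rewrite inE iS1 iS fA => /(_ isT).
apply: leq_trans (leq_card_setU _ _) _; rewrite leq_add2l.
elim/big_rec2: _ => [|i m Z iP le]; first by rewrite cards0.
by apply: leq_trans (leq_card_setU _ _) _; rewrite leq_add2l.
Qed.

Lemma avoiding_indep (S : {set I}) i : (forall j, j \in S -> [disjoint D j & D i]) ->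
  4 * d * #|A i :&: avoiding S| <= #|avoiding S|.
Proof.
move=> dS.
have avD (f g : {set J}) : f :\: D i = g :\: D i -> (f \in avoiding S) = (g \in avoiding S).
  move=> fg; rewrite !inE; apply: eq_forallb => j.
  case: (boolP (j \in S)) => //= jS; congr (~~ _); apply: AD.
  apply/setP => x; rewrite !inE; case: (boolP (x \in D j)) => xj; rewrite ?andbF // !andbT.
  have := congr1 (fun Z : {set J} => x \in Z) fg.
  by rewrite !inE (disjointFr (dS j jS) xj).
have ind := independent_card (fun f g => @AD i f g) avD.
have J0 : 0 < #|{set J}| by apply/card_gt0P; exists set0.
by rewrite -(leq_pmul2r J0) -mulnA ind mulnA (mulnC #|avoiding S|) leq_mul2r Asmall orbT.
Qed.

(** Among the sets avoiding [S], the bad set [A i] has proportion at most [1 / (2 d)]. The events of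
    [S] that are independent of [i] preserve the bound [1 / (4 d)]; by induction each of the at most
    [d] others removes a proportion of at most [1 / (2 d)], so together they at most halve the
    count. *)
Lemma lovasz_step k (S : {set I}) i : #|S| <= k -> i \notin S ->
  2 * d * #|A i :&: avoiding S| <= #|avoiding S|.
Proof.
elim: k S i => [|k IH] S i Sk iS.
  have /avoiding_indep : forall j, j \in S -> [disjoint D j & D i].
    by move=> j; move: Sk; rewrite leqn0 cards_eq0 => /eqP ->; rewrite inE.
  lia.
pose S1 := [set j in S | ~~ [disjoint D j & D i]]; pose S2 := S :\: S1.
have indep : 4 * d * #|A i :&: avoiding S2| <= #|avoiding S2|.
  apply: avoiding_indep => j; rewrite !inE.
  by case: (j \in S); rewrite ?andbF //= andbT negbK.
have sub : #|A i :&: avoiding S| <= #|A i :&: avoiding S2|.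
  apply/subset_leq_card/setIS/subsetP => f; rewrite !inE => /forall_inP H.
  by apply/forall_inP => j; rewrite inE => /andP[_ /H].
have [S10|S1n] := eqVneq S1 set0.
  have S2E : S2 = S by rewrite /S2 S10 setD0.
  by rewrite S2E in indep; lia.
have S1d : #|S1| <= d.
  apply: leq_trans (Ddeg i); apply/subset_leq_card/subsetP => j; rewrite !inE => /andP[jS ->].
  by rewrite andbT; apply: contraNneq iS => <-.
have S2k : #|S2| <= k.
  have : 0 < #|S1| by rewrite card_gt0.
  have S1S : S1 \subset S by apply/subsetP => j; rewrite inE => /andP[].
  by rewrite cardsD (setIidPr S1S); lia.
have := avoiding_split S S1; rewrite -/S2 => split_le.
have sum_le : 2 * d * (\sum_(j in S1) #|A j :&: avoiding S2|) <= d * #|avoiding S2|.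
  rewrite big_distrr /=; apply: (@leq_trans (\sum_(j in S1) #|avoiding S2|)).
    by apply: leq_sum => j jS1; apply: IH => //; rewrite in_setD jS1.
  by rewrite sum_nat_const leq_mul2r S1d orbT.
move: split_le sum_le indep sub d0.
move: (\sum_(j in S1) _) (#|A i :&: avoiding S|) (#|A i :&: avoiding S2|)
  (#|avoiding S2|) (#|avoiding S|) => s x y z w; nia.
Qed.

Lemma lovasz : exists f : {set J}, forall i, f \notin A i.
Proof.
suff H (S : {set I}) : 0 < #|avoiding S|.
  have := H setT; rewrite card_gt0 => /set0Pn[f]; rewrite inE => /forall_inP fA.
  by exists f => i; apply: fA; rewrite inE.
elim/finset_ind: S => [|i S iS IH].
  by apply/card_gt0P; exists set0; rewrite inE; apply/forall_inP => i; rewrite inE.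
have step := lovasz_step (leqnn _) iS.
have : #|avoiding S| <= #|avoiding (i |: S)| + #|A i :&: avoiding S|.
  apply: leq_trans (leq_card_setU _ _); apply/subset_leq_card/subsetP => f fS.
  rewrite in_setU in_setI fS andbT; case: (boolP (f \in A i)) => fA; rewrite ?orbT // orbF inE.
  apply/forall_inP => j; rewrite !inE => /orP[/eqP -> //|jS].
  by move: fS; rewrite inE => /forall_inP; apply.
move: step IH d0; move: (#|avoiding S|) (#|A i :&: avoiding S|) (#|avoiding _|) => x y z; nia.
Qed.
End LocalLemma.

(** * A tail bound for coins, and greedy colouring *)

Section CoinCount.
Variables (R : realType) (V : finType).

(** The weight [2 ^+ r * (1 / 2) ^+ #|f :&: C|] is at least 1 on the event, and under a uniform [f]
    each element of [C] contributes the factor [3 / 4] to its mean. *)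
Lemma few_heads (C : {set V}) r :
  (#|[set f : {set V} | (#|f :&: C| < r)%N]| * 4 ^ #|C| <= 2 ^ r * 3 ^ #|C| * 2 ^ #|V|)%N.
Proof.
set B := [set f | _].
have half : (1 - 1 / 2 : R) = 1 / 2 by lra.
have PrB : Pr setT (1 / 2) (fun f => f \in B) = #|B|%:R / 2 ^+ #|V| :> R.
  rewrite /Pr /Ex (eq_bigl xpredT) => [|f]; last exact: subsetT.
  rewrite (eq_bigr (fun f => (1 / 2) ^+ #|V| * (f \in B)%:R)); last first.
    by move=> f _; rewrite half -exprD subnKC ?subset_leq_card ?subsetT // cardsT.
  rewrite -big_distrr /= -natr_sum -big_mkcond sum1_card mulrC.
  by rewrite expr_div_n expr1n mul1r.
have le : Pr setT (1 / 2) (fun f => f \in B) <= 2 ^+ r * (3 / 4) ^+ #|C| :> R.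
  apply: (@le_trans _ _ (Ex setT (1 / 2) (fun f => 2 ^+ r * (1 / 2) ^+ #|f :&: C|))).
    apply: Pr_markov => [|f _|f _]; first by lra.
      by rewrite mulr_ge0 // exprn_ge0 //; lra.
    rewrite inE => lt; rewrite -(subnK (ltnW lt)) exprD -mulrA -exprMn.
    have -> : (2 * (1 / 2) : R) = 1 by lra.
    by rewrite expr1n mulr1 exprn_ege1 //; lra.
  rewrite ExZ ler_wpM2l ?exprn_ge0 // Ex_pow ?subsetT //.
  by have -> : (1 - 1 / 2 + 1 / 2 * (1 / 2) : R) = 3 / 4 by lra.
rewrite PrB ler_pdivrMr ?exprn_gt0 // in le.
rewrite -(ler_nat R) !natrM !natrX.
rewrite expr_div_n in le.
have p4 : (0 : R) < 4 ^+ #|C| by rewrite exprn_gt0.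
rewrite -(ler_pM2r p4) in le; apply: le_trans le _.
rewrite -!mulrA ler_wpM2l ?exprn_ge0 // ler_wpM2l ?exprn_ge0 //.
by rewrite mulrCA mulVf ?mulr1 // lt0r_neq0.
Qed.
End CoinCount.

Lemma greedy_coloring (V : finType) (r : rel V) D : symmetric r ->
  (forall w, (#|[set w' | (w' != w) && r w w']| <= D)%N) ->
  exists c : V -> 'I_D.+1, forall w w', w != w' -> r w w' -> c w != c w'.
Proof.
move=> r_sym rD.
suff H (S : {set V}) : exists c : V -> 'I_D.+1,
    {in S &, forall w w', w != w' -> r w w' -> c w != c w'}.
  by have [c cP] := H setT; exists c => w w'; apply: cP; rewrite inE.
elim/finset_ind: S => [|x S xS [c cP]].
  by exists (fun=> ord0) => w w'; rewrite inE.
have [i iP] : exists i, i \notin c @: [set w' | (w' != x) && r x w'].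
  have : (#|c @: [set w' | (w' != x) && r x w']| < #|'I_D.+1|)%N.
    by rewrite card_ord ltnS; apply: leq_trans (leq_imset_card _ _) (rD x).
  rewrite -cardsT ltnNge => nle; apply/existsP; apply: contraR nle.
  by rewrite negb_exists => /forallP all; apply: subset_leq_card; apply/subsetP => i _;
     have := all i; rewrite negbK.
have ic w : w != x -> r x w -> i != c w.
  move=> wx rxw; apply: contraNneq iP => ->; apply: imset_f.
  by rewrite inE wx.
exists (fun w => if w == x then i else c w) => w w'; rewrite !in_setU1.
case: (eqVneq w x) => [->|wx] /=; case: (eqVneq w' x) => [->|w'x] //=; rewrite ?eqxx //.
- by move=> _ _ _; apply: ic.
- by move=> _ _ _ rwx; rewrite eq_sym ic // r_sym.
- exact: cP.
Qed.

(** * The two families that separate the unattached vertices *)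

Section MainFamilies.
Local Open Scope nat_scope.
Variable R : realType.
Variable V : finType.
Variable E : {set {set V}}.
Hypothesis Epairs : forall e, e \in E -> #|e| = 2.
Variables (q h : nat).
Variable X : {set V}.
Hypothesis cleanX : clean E h X.
Variable De : nat.
Hypothesis maxdeg : forall u, deg E u <= De.

Local Notation lows := (lows E h X).
Local Notation lows_nb := (lows_nb E h X).
Local Notation bulk := (bulk E h X).
Local Notation unattached := (unattached E h X).
Local Notation ample := (ample E q h X).

Lemma lows_nb_bulk : lows_nb \subset bulk.
Proof.
apply/bigcupsP => v vl; apply/subsetP => w; rewrite in_nb // => avw.
rewrite in_setC in_setU negb_or (nb_lows_notX Epairs cleanX vl avw).
exact: (nb_lows_notlow Epairs cleanX vl avw).
Qed.

(** A bulk vertex has degree above [h] and loses at most one neighbour to [X] and at most one to the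
    low vertices and their neighbours. *)
Lemma unattached_nb u : u \in bulk -> h.-1 <= #|nb E u :&: unattached|.
Proof.
move=> uN; have [uX ul] := bulkP uN.
have [_ c2 _] := cleanX; have n1 := c2 u uX; have n2 := few_lows_nb Epairs cleanX uX ul.
have du : h < deg E u by move: ul; rewrite inE -ltnNge.
have : deg E u <= #|nb E u :&: X| + #|nb E u :&: (lows :|: lows_nb)| + #|nb E u :&: unattached|.
  apply: leq_trans (_ : #|(nb E u :&: X) :|: (nb E u :&: (lows :|: lows_nb)) :|: (nb E u :&: unattached)| <= _).
    apply/subset_leq_card/subsetP => w wn; rewrite !(in_setU, in_setI) wn /=.
    case: (boolP (w \in X)) => wX //=; case: (boolP (w \in lows)) => wl //=.
    case: (boolP (w \in lows_nb)) => wl' //=.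
    have wN : w \in bulk.
      by rewrite in_setC in_setU negb_or wX; move: wl; rewrite in_setD wX.
    by rewrite in_setD wl' wN.
  apply: leq_trans (leq_card_setU _ _) _; rewrite leq_add2r; exact: leq_card_setU.
lia.
Qed.

Lemma unattached_bulk : unattached \subset bulk. Proof. exact: subsetDl. Qed.

Section Coins.
Variables (k m : nat).
Hypotheses (k0 : 0 < k) (unattached_k : #|unattached| <= 2 ^ k).
Hypothesis m_small : 8 * De ^ 2 * k * 2 ^ (18 * q) * 3 ^ m <= 4 ^ m.
Hypothesis hm : 2 * m <= h.-1.
Hypothesis De0 : 0 < De.

Let ix (w : V) := index w (enum unattached).
(** The unattached vertices number [2 j] and [2 j + 1] share a coin. Coins are named by the vertices
    of [V], so that an outcome of all coins is a subset of [V]. *)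
Let coin (w : V) : V := nth w (enum V) (ix w)./2.
(** Bit [b] of the pair index, complemented according to the coin and once more for the odd member
    of the pair. Pair indices are below [2 ^ k.-1], so bit [k.-1] of the code reveals the
    complementation and the other bits can be decoded. Exactly one member of each pair lies in each
    half set, whatever the coin. *)
Let bit b w (f : {set V}) :=
  odd ((ix w)./2 %/ 2 ^ b) (+) (coin w \in f) (+) odd (ix w).
Let half_set b f := [set w in unattached | bit b w f].

Lemma ix_lt w : w \in unattached -> ix w < #|unattached|.
Proof. by move=> wF; rewrite cardE index_mem mem_enum. Qed.

Lemma ix_inj : {in unattached &, injective ix}.
Proof. by move=> w w' wF w'F; apply: (index_inj w); rewrite mem_enum. Qed.

Lemma half_lt w : w \in unattached -> (ix w)./2 < #|V|.
Proof.
move=> wF; apply: leq_ltn_trans (leq_trans (ix_lt wF) (max_card _)).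
by rewrite -divn2 leq_div.
Qed.

Lemma coin_inj w w' : w \in unattached -> w' \in unattached ->
  (coin w == coin w') = ((ix w)./2 == (ix w')./2).
Proof.
move=> wF w'F; have := half_lt wF; have := half_lt w'F; rewrite cardE => l' l.
by rewrite /coin (set_nth_default w w' l') nth_uniq ?enum_uniq.
Qed.

Lemma same_ix w w' : w \in unattached -> w' \in unattached ->
  coin w = coin w' -> odd (ix w) = odd (ix w') -> w = w'.
Proof.
move=> wF w'F /eqP; rewrite coin_inj // => /eqP he oe; apply: ix_inj => //.
by rewrite -(odd_double_half (ix w)) he oe odd_double_half.
Qed.

Lemma coin_fiber w0 : #|[set w in unattached | coin w == w0]| <= 2.
Proof.
rewrite -card_bool -(@card_in_imset _ _ (fun w => odd (ix w))) ?max_card //.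
move=> w w' /setIdP[wF /eqP cw] /setIdP[w'F /eqP cw'] oe.
by apply: same_ix => //; rewrite cw cw'.
Qed.

Lemma coin_image (B : {set V}) : B \subset unattached -> #|B| <= 2 * #|coin @: B|.
Proof.
move=> BF; rewrite -sum1_card (partition_big_imset coin) /= mulnC -sum_nat_const.
apply: leq_sum => c _; rewrite sum1_card; apply: leq_trans (coin_fiber c).
apply: subset_leq_card; apply/subsetP => w; rewrite unfold_in => /andP[wB cw].
by rewrite in_set cw (subsetP BF).
Qed.

Let few b u := [set f : {set V} | #|nb E u :&: half_set b f| < 18 * q].

(** One neighbour of [u] is selected for each of [m] distinct coins. Taking the symmetric difference
    with [S0] translates membership of these neighbours in [half_set b f] into heads of their coins,
    which leads to [few_heads]. *)
Lemma few_card b u : u \in bulk -> #|few b u| * 4 ^ m <= 2 ^ (18 * q) * 3 ^ m * 2 ^ #|V|.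
Proof.
move=> uN; set B := nb E u :&: unattached.
have BF : B \subset unattached by exact: subsetIr.
have mB : m <= #|coin @: B|.
  have := coin_image BF; have := unattached_nb uN; rewrite -/B.
  by move: hm; move: (#|B|) (#|coin @: B|) h.-1 => x y z; lia.
have [C [CB Cm]] := subset_of_card mB.
have exrep c : exists w, c \in C -> w \in B /\ coin w = c.
  case: (boolP (c \in C)) => [/(subsetP CB)/imsetP[w wB ->]|_]; first by exists w.
  by exists c.
have [rep repP] := choice exrep.
pose S0 := [set c in C | odd ((ix (rep c))./2 %/ 2 ^ b) (+) odd (ix (rep c))].
pose sd (f : {set V}) := (f :\: S0) :|: (S0 :\: f).
have sdK : involutive sd.
  by move=> f; apply/setP => x; rewrite !(in_setU, in_setD); case: (x \in f); case: (x \in S0).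
rewrite -Cm; apply: leq_trans (few_heads R C (18 * q)); rewrite leq_mul2r; apply/orP; right.
rewrite -(card_imset _ (inv_inj sdK)); apply: subset_leq_card.
apply/subsetP => g /imsetP[f fu ->]; move: fu; rewrite /few !in_set => fu; apply: leq_ltn_trans fu.
have repi : {in sd f :&: C &, injective rep}.
  move=> c c' /setIP[_ cC] /setIP[_ c'C] rr.
  by have [[_ e1] [_ e2]] := (repP c cC, repP c' c'C); rewrite -e1 rr e2.
rewrite -(card_in_imset repi); apply/subset_leq_card/subsetP => _ /imsetP[c /setIP[cs cC] ->].
have [cB cc] := repP c cC; rewrite in_setI; move: cB; rewrite in_setI => /andP[-> cF] /=.
rewrite in_set cF /= /bit cc; move: cs; rewrite !inE cC /=.
by case: (c \in f); case: (odd _); case: (odd _).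
Qed.

Let bad u := if u \in bulk then \bigcup_(b : 'I_k) few b u else set0.
Let dom u := if u \in bulk then coin @: (nb E u :&: unattached) else set0.

Lemma bad_dom u (f g : {set V}) : f :&: dom u = g :&: dom u -> (f \in bad u) = (g \in bad u).
Proof.
rewrite /bad /dom; case: ifP => _ fg; last by rewrite !inE.
have E1 b : nb E u :&: half_set b f = nb E u :&: half_set b g.
  apply/setP => w; rewrite !in_setI; case: (boolP (w \in nb E u)) => wn //=.
  rewrite [LHS]in_set [RHS]in_set; case: (boolP (w \in unattached)) => wF //=.
  have := congr1 (fun Z : {set V} => coin w \in Z) fg; rewrite !in_setI.
  rewrite /bit imset_f ?andbT; last by rewrite in_setI wn.
  by move=> ->.
by apply/bigcupP/bigcupP => -[b _]; rewrite inE => H; exists b => //; rewrite inE ?E1 // -E1.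
Qed.

Lemma bad_small u : 4 * (2 * De ^ 2) * #|bad u| <= #|{set V}|.
Proof.
rewrite /bad; case: ifP => uN; last by rewrite cards0 muln0.
have p4 : 0 < 4 ^ m by rewrite expn_gt0.
rewrite -(leq_pmul2r p4) -[#|{set V}|]cardsT -powersetT card_powerset cardsT.
have le : #|\bigcup_(b : 'I_k) few b u| * 4 ^ m <= k * (2 ^ (18 * q) * 3 ^ m * 2 ^ #|V|).
  apply: (@leq_trans ((\sum_(b : 'I_k) #|few b u|) * 4 ^ m)).
    rewrite leq_mul2r; apply/orP; right.
    elim/big_rec2: _ => [|i y Z _ le]; first by rewrite cards0.
    by apply: leq_trans (leq_card_setU _ _) _; rewrite leq_add2l.
  rewrite big_distrl /= -[X in X * _](card_ord k) -sum_nat_const.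
  by apply: leq_sum => b _; apply: few_card.
rewrite -mulnA; apply: leq_trans (leq_mul (leqnn _) le) _.
rewrite [X in _ <= X]mulnC; apply: leq_trans (leq_mul m_small (leqnn (2 ^ #|V|))).
by rewrite !mulnA [8]/(4 * 2) -!mulnA leq_mul2l; apply/orP; right; rewrite !mulnA.
Qed.

(** Dependence means that a neighbour of [u] and a neighbour of [j] share a coin: at most [De]
    choices for the first, two holders of its coin, and [De] choices for [j]. *)
Lemma bad_degree u :
  #|[set j | (j != u) && ~~ [disjoint dom j & dom u]]| <= 2 * De ^ 2.
Proof.
pose Z w := [set w' in unattached | coin w' == coin w].
apply: (@leq_trans #|\bigcup_(w in nb E u) \bigcup_(w' in Z w) nb E w'|).
  apply/subset_leq_card/subsetP => j; rewrite inE => /andP[_ /pred0Pn[c /andP[/=]]].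
  rewrite /dom; case: ifP => _; last by rewrite inE.
  case: ifP => _; last by rewrite [c \in set0]inE.
  case/imsetP=> w'; rewrite in_setI => /andP[w'n w'F] -> /imsetP[w].
  rewrite in_setI => /andP[wn wF] cc.
  apply/bigcupP; exists w => //; apply/bigcupP; exists w'; first by rewrite inE w'F cc eqxx.
  by rewrite in_nb // adjC -in_nb.
apply: leq_trans (_ : De * 2 * #|nb E u| <= _).
  apply: leq_card_bigcup => w _; apply: leq_trans (_ : De * #|Z w| <= _).
    by apply: leq_card_bigcup => w' _; apply: maxdeg.
  by rewrite leq_mul2l coin_fiber orbT.
rewrite -mulnn (mulnC De 2) -mulnA leq_mul2l /= leq_mul2l; apply/orP; right; exact: maxdeg.
Qed.

Lemma half_set_card b f : #|unattached| <= 2 * #|half_set b f| + 1.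
Proof.
have [->|[w0 _]] := set_0Vmem unattached; first by rewrite cards0.
set M := #|unattached|; pose e i := nth w0 (enum unattached) i.
have eF i : i < M -> e i \in unattached.
  by rewrite /M cardE => iM; rewrite -mem_enum mem_nth.
have ie i : i < M -> ix (e i) = i.
  by rewrite /M cardE => iM; rewrite /ix index_uniq ?enum_uniq.
pose g (j : 'I_(M./2)) := if bit b (e j.*2) f then e j.*2 else e j.*2.+1.
have j2 (j : 'I_(M./2)) : j.*2.+1 < M.
  have := ltn_ord j; have := odd_double_half M; rewrite -!muln2; move: (odd M : nat) => o; lia.
have gF (j : 'I_(M./2)) : (g j \in unattached) && ((ix (g j))./2 == j).
  rewrite /g; case: ifP => _; rewrite eF ?ie ?(ltnW (j2 j)) ?j2 //=.
    by rewrite doubleK.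
  by rewrite uphalf_double.
have gi : injective g.
  move=> j j' gg; apply: val_inj; have /andP[_ /eqP /= <-] := gF j.
  by rewrite gg; have /andP[_ /eqP] := gF j'.
have : M./2 <= #|half_set b f|.
  rewrite -{1}(card_ord M./2) -(card_imset _ gi); apply: subset_leq_card.
  apply/subsetP => _ /imsetP[j _ ->]; rewrite in_set; have /andP[-> _] /= := gF j.
  rewrite /g; case: ifP => // nb; move/negbT: nb.
  have c2 : coin (e j.*2.+1) = coin (e j.*2).
    apply/eqP; rewrite coin_inj ?eF ?j2 ?(ltnW (j2 j)) // !ie ?j2 ?(ltnW (j2 j)) //.
    by rewrite doubleK (uphalf_double j : (j.*2.+1)./2 = j).
  rewrite /bit c2 !ie ?j2 ?(ltnW (j2 j)) // doubleK (uphalf_double j : (j.*2.+1)./2 = j) /=.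
  by rewrite odd_double; case: (odd _); case: (_ \in f).
have := odd_double_half M; rewrite -muln2; case: (odd M); lia.
Qed.

(* Consecutive unattached vertices get complementary codes up to a coin flip;
   the local lemma chooses the flips so that every code bit is well spread over
   every neighbourhood. *)
Lemma coin_family : 2 * #|V| + 3 <= 3 * #|bulk| ->
  exists FF : seq {set V}, [/\ size FF = k,
    forall F, F \in FF -> ample F /\ lows_nb \subset F &
    forall u v, u \in unattached -> v \in unattached -> u != v -> separates FF u v].
Proof.
move=> bulk_large.
have d0 : 0 < 2 * De ^ 2 by rewrite muln_gt0 expn_gt0 De0.
have [f fP] := lovasz bad_dom bad_small bad_degree d0.
exists [seq lows_nb :|: half_set b f | b <- iota 0 k]; split.
- by rewrite size_map size_iota.
- move=> F /mapP[b bi ->]; move: bi; rewrite mem_iota => /= bk; split; last exact: subsetUl.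
  split.
  + rewrite subUset lows_nb_bulk; apply/subsetP => w /setIdP[wF _].
    exact: (subsetP unattached_bulk).
  + have dis : #|lows_nb :|: half_set b f| = #|lows_nb| + #|half_set b f|.
      by apply: cardsU_disjoint => w wL /setIdP[]; rewrite in_setD wL.
    have := half_set_card b f.
    have : #|bulk| <= #|lows_nb| + #|unattached|.
      rewrite -(cardsID lows_nb bulk) leq_add2r; apply/subset_leq_card/subsetIr.
    rewrite dis; move: bulk_large; move: (#|bulk|) (#|V|) (#|unattached|) (#|lows_nb|) (#|half_set b f|).
    by clear; move=> *; lia.
  + move=> u uN; rewrite leqNgt; apply/negP => lt.
    have := fP u; rewrite /bad uN => /bigcupP; apply; exists (Ordinal bk) => //.
    rewrite in_set; apply: leq_ltn_trans lt; apply/subset_leq_card/setIS/subsetUr.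
- move=> u v uF vF uv; apply: contraT => /hasPn ns; case/negP: uv; apply/eqP.
  have nl w : w \in unattached -> w \in lows_nb = false.
    by rewrite in_setD => /andP[/negbTE].
  have bitE b : b < k -> bit b u f = bit b v f.
    move=> bk; have /ns : lows_nb :|: half_set b f \in [seq lows_nb :|: half_set b f | b <- iota 0 k].
      by apply: (map_f (fun b => lows_nb :|: half_set b f)); rewrite mem_iota.
    by rewrite negbK !in_setU !nl // ![_ \in half_set _ _]in_set uF vF => /eqP.
  have hlt w : w \in unattached -> (ix w)./2 < 2 ^ k.-1.
    move=> /ix_lt lt; have := leq_trans lt unattached_k.
    by rewrite -[X in 2 ^ X](prednK k0) expnS -divn2 ltn_divLR // mulnC.
  have last w : w \in unattached -> odd ((ix w)./2 %/ 2 ^ k.-1) = false.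
    by move=> wF; rewrite divn_small // hlt.
  have := bitE k.-1; rewrite ltn_predL k0 => /(_ isT); rewrite /bit !last // !addFb => top.
  have he : (ix u)./2 = (ix v)./2.
    apply: bits_inj (hlt u uF) (hlt v vF) _ => b bk.
    have := bitE b; rewrite (leq_trans bk) ?leq_pred // => /(_ isT).
    by rewrite /bit -!addbA top => /addIb.
  have ce : coin u = coin v by apply/eqP; rewrite coin_inj // he.
  by apply: same_ix => //; move: top; rewrite ce => /addbI.
Qed.
End Coins.

(* Colour classes of the square of the graph: removing part of one class costs
   every vertex at most one neighbour. *)
Lemma color_family k : 18 * q + 1 <= h.-1 -> 3 <= h -> #|V| <= 2 ^ k ->
  2 * #|V| + 3 <= 3 * #|bulk| ->
  exists FF : seq {set V}, [/\ size FF <= (De ^ 2).+1 * k.+1,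
    forall F, F \in FF -> ample F /\ lows_nb \subset F &
    forall u v, u \in unattached -> v \in unattached -> u != v -> separates FF u v].
Proof.
move=> hq h3 Vk bulk_large.
pose r w w' := [exists u, (w \in nb E u) && (w' \in nb E u)].
have r_sym : symmetric r by move=> w w'; apply: eq_existsb => u; rewrite andbC.
have rD w : #|[set w' | (w' != w) && r w w']| <= De ^ 2.
  apply: (@leq_trans #|\bigcup_(u in nb E w) nb E u|).
    apply/subset_leq_card/subsetP => w'; rewrite inE => /andP[_ /existsP[u /andP[uw uw']]].
    by apply/bigcupP; exists u => //; rewrite in_nb // adjC -in_nb.
  apply: leq_trans (_ : De * #|nb E w| <= _).
    by apply: leq_card_bigcup => u _; apply: maxdeg.
  by rewrite -mulnn leq_mul2l; apply/orP; right; apply: maxdeg.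
have [c cP] := greedy_coloring r_sym rD.
pose C (j : 'I_(De ^ 2).+1) := [set w in unattached | c w == j].
have Csub j : C j \subset unattached by apply/subsetP => w; rewrite inE => /andP[].
have C1 j u : #|nb E u :&: C j| <= 1.
  apply/card_le1_eqP => w w' /setIP[wn /setIdP[_ /eqP wc]] /setIP[wn' /setIdP[_ /eqP wc']].
  apply/eqP; apply: contraT; rewrite eq_sym => ww.
  have := cP w w' ww; rewrite wc wc' eqxx; apply.
  by apply/existsP; exists u; rewrite wn.
(* Vertices of one colour have disjoint neighbourhoods of more than [h >= 3] vertices each. A class
   is therefore at most a quarter of the graph, and the bulk stays large without it. *)
have Ccard j : 4 * #|C j| <= #|V|.
  have exB w : exists B : {set V}, w \in C j -> B \subset nb E w /\ #|B| = 4.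
    case: (boolP (w \in C j)) => [wC|_]; last by exists set0.
    have [_ wl] := bulkP (subsetP unattached_bulk w (subsetP (Csub j) w wC)).
    have [|B HB] := @subset_of_card _ (nb E w) 4; last by exists B.
    by move: wl; rewrite inE -ltnNge; apply: leq_trans.
  have [B BP] := choice exB.
  rewrite -(@card_bigcup_disjoint _ _ (C j) B 4) ?max_card //.
    by move=> w /BP[].
  move=> w w' wC w'C ww; apply: disjointW (BP w wC).1 (BP w' w'C).1 _.
  apply: contraT => /pred0Pn[z /andP[/= zw zw']]; case/negP: ww; apply/eqP.
  move/card_le1_eqP: (C1 j z); apply; rewrite in_setI ?wC ?w'C andbT in_nb // adjC -in_nb //.
have ample_diff j (B : {set V}) : B \subset C j -> ample (bulk :\: B) /\ lows_nb \subset bulk :\: B.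
  move=> BC; split; last first.
    apply/subsetP => w wn; rewrite in_setD (subsetP lows_nb_bulk w wn) andbT.
    apply/negP => wB; have := subsetP (Csub j) w (subsetP BC w wB).
    by rewrite in_setD wn.
  split; first exact: subsetDl.
  - have := cardsD bulk B; have : #|bulk :&: B| <= #|C j|.
      by apply: subset_leq_card; apply: subset_trans BC; apply: subsetIr.
    move: (Ccard j) bulk_large.
    by move: (#|C j|) (#|bulk|) (#|V|) (#|bulk :&: B|) (#|bulk :\: B|); clear; move=> *; lia.
  - move=> u uN; have fu := unattached_nb uN.
    have : #|nb E u :&: unattached| <= #|nb E u :&: (bulk :\: B)| + #|nb E u :&: C j|.
      apply: leq_trans (leq_card_setU _ _); apply/subset_leq_card/subsetP => w.
      rewrite in_setU !in_setI in_setD => /andP[wn wF]; rewrite wn (subsetP unattached_bulk w wF) /=.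
      by case: (boolP (w \in B)) => // /(subsetP BC).
    move: (C1 j u) hq fu.
    by move: (#|nb E u :&: C j|) (#|nb E u :&: unattached|) (#|nb E u :&: (bulk :\: B)|) (h.-1);
       clear; move=> *; lia.
have exBits j : exists Bs : seq {set V}, [/\ size Bs = k, forall B, B \in Bs -> B \subset C j &
    forall u v, u \in C j -> v \in C j -> u != v -> separates Bs u v].
  by apply: bit_sets; apply: leq_trans Vk; apply: max_card.
have [Bits BitsP] := choice exBits.
(* At [b = k] the index is out of range and the default, the whole class [C j], is removed; these
   sets separate vertices of different colours. *)
pose F j b := bulk :\: nth (C j) (Bits j) b.
exists [seq F j b | j <- enum 'I_(De ^ 2).+1, b <- iota 0 k.+1]; split.
- by rewrite size_allpairs size_iota -cardE card_ord.
- move=> _ /allpairsP[[j b] [_ _ ->]] /=; apply: (ample_diff j).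
  have [sB subB _] := BitsP j; case: (ltnP b k) => bk.
    by apply: subB; apply: mem_nth; rewrite sB.
  by rewrite nth_default ?sB.
- move=> u v uF vF uv; have inC w : w \in unattached -> w \in C (c w) by move=> wF; rewrite inE wF /=.
  have inF j b : b <= k -> F j b \in [seq F j b | j <- enum 'I_(De ^ 2).+1, b <- iota 0 k.+1].
    by move=> bk; apply: allpairs_f; rewrite ?mem_enum // mem_iota.
  have [sB subB sepB] := BitsP (c u).
  have uN := subsetP unattached_bulk u uF; have vN := subsetP unattached_bulk v vF.
  case: (eqVneq (c u) (c v)) => cc.
    have /hasP[B BB ne] : separates (Bits (c u)) u v by apply: sepB; rewrite ?inC // cc inC.
    apply/hasP; exists (F (c u) (index B (Bits (c u)))).
      by apply: inF; rewrite -sB index_size.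
    by rewrite /F nth_index // !in_setD uN vN !andbT; case: (u \in B) ne; case: (v \in B).
  rewrite separatesC; apply: (separatesP (inF (c u) k (leqnn k))).
    rewrite /F nth_default ?sB // in_setD vN andbT; apply/negP => /setIdP[_].
    by rewrite eq_sym (negbTE cc).
  by rewrite /F nth_default ?sB // in_setD inC.
Qed.
End MainFamilies.

(** * The lower bound from leaves *)

Section LeafLower.
Local Open Scope nat_scope.
Variables (V : finType) (E : {set {set V}}).
Hypothesis Epairs : forall e, e \in E -> #|e| = 2.

Lemma path_inner_deg x s v : uniq (x :: s) -> path (gadj E) x s -> v \in x :: s ->
  v != x -> v != last x s -> 1 < deg E v.
Proof.
move=> us ps; rewrite inE => /orP[/eqP ->|vs vx vl]; first by rewrite eqxx.
case/splitPr: vs us ps vl => s1 [|y s2]; first by rewrite last_cat /= eqxx.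
move=> us; rewrite cat_path /= => /and3P[_ lv /andP[vy _]] _.
apply: (@leq_trans #|[set last x s1; y]|); last first.
  by apply/subset_leq_card; rewrite subUset !sub1set !in_nb // adjC lv vy.
rewrite cards2 (_ : last x s1 != y) //.
move: us; rewrite -cat_cons cat_uniq => /and3P[_ /hasPn H _].
have : y \notin x :: s1 by apply: H; rewrite !inE eqxx orbT.
by apply: contraNneq => <-; exact: mem_last.
Qed.

Lemma path_leaves x s : uniq (x :: s) -> path (gadj E) x s ->
  #|[set v in x :: s | deg E v == 1]| <= 2.
Proof.
move=> us ps; apply: (@leq_trans #|[set x; last x s]|); last first.
  by rewrite cards2; case: (_ != _).
apply/subset_leq_card/subsetP => v; rewrite !inE -in_cons => /andP[vs /eqP d1].
case: eqVneq => //= vx; apply: contraT => vl.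
by have := path_inner_deg us ps vs vx vl; rewrite d1.
Qed.

(** Double counting: the signatures have total size at most [2 * k], at most one of them is empty,
    at most [k] are singletons, and all others have at least two elements. *)
Lemma signature_count (k : nat) (P : 'I_k -> {set V}) (L : {set V}) :
  (forall i, #|P i :&: L| <= 2) ->
  (forall u v, u \in L -> v \in L -> u != v -> exists i, (u \in P i) != (v \in P i)) ->
  2 * #|L| <= 3 * k + 2.
Proof.
move=> P2 sep; pose sg v := [set i | v \in P i].
have sgi : {in L &, injective sg}.
  move=> u v uL vL suv; apply/eqP; apply: contraT => uv.
  have [i] := sep u v uL vL uv.
  have := congr1 (fun Z : {set 'I_k} => i \in Z) suv; rewrite !inE => ->.
  by rewrite eqxx.
have total : \sum_(v in L) #|sg v| <= 2 * k.
  have -> : \sum_(v in L) #|sg v| = \sum_(i < k) #|P i :&: L|.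
    rewrite (eq_bigr (fun v => \sum_(i < k) (v \in P i : nat))); last first.
      by move=> v _; rewrite -sum1dep_card big_mkcond; apply: eq_bigr => i _; case: (v \in _).
    rewrite exchange_big /=; apply: eq_bigr => i _.
    rewrite -sum1_card -big_mkcondr; apply: eq_bigl => v.
    by rewrite inE andbC.
  by rewrite mulnC -[X in X * _](card_ord k) -sum_nat_const; apply: leq_sum.
have a0 : #|[set v in L | #|sg v| == 0]| <= 1.
  apply/card_le1_eqP => u v /setIdP[uL /eqP u0] /setIdP[vL /eqP v0].
  by apply: sgi => //; rewrite (cards0_eq u0) (cards0_eq v0).
have a1 : #|[set v in L | #|sg v| == 1]| <= k.
  have inj1 : {in [set v in L | #|sg v| == 1] &, injective sg}.
    by move=> u v /setIdP[uL _] /setIdP[vL _]; apply: sgi.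
  rewrite -(card_in_imset inj1).
  apply: (@leq_trans #|[set [set i] | i in 'I_k]|); last first.
    by apply: leq_trans (leq_imset_card _ _) _; rewrite card_ord.
  apply/subset_leq_card/subsetP => Z /imsetP[v /setIdP[_ /cards1P[i ->]] ->].
  by apply/imsetP; exists i.
have : 2 * #|L| <= \sum_(v in L) #|sg v| + #|[set v in L | #|sg v| == 1]| +
    2 * #|[set v in L | #|sg v| == 0]|.
  rewrite -!sum1dep_card !big_mkcondr /= big_distrr /= -!big_split /= mulnC -sum_nat_const.
  by apply: leq_sum => v _; case: #|sg v| => [|[|m]] //=; lia.
lia.
Qed.
End LeafLower.

(* A path contains at most two leaves, and at most one leaf that no other path
   contains; all leaves but one are covered. *)
Lemma sp_lower_leaves n (E : {set {set 'I_n}}) : (forall e, e \in E -> #|e| = 2) ->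
  (2 * #|[set v | deg E v == 1]| <= 3 * sp E + 2)%N.
Proof.
move=> Ep; rewrite /sp; case: ex_minnP => k /asboolP[F [sF /allP pF /forallP sepF]] _.
pose P (i : 'I_k) : {set 'I_n} := [set x in nth [::] F i].
apply: (@signature_count _ k P) => [i|u v _ _ uv].
  have iF : (i < size F)%N by rewrite sF.
  have := pF _ (mem_nth [::] iF); rewrite /P; case: (nth [::] F i) => [|x s] //= /andP[us ps].
  apply: leq_trans (path_leaves Ep us ps); apply/subset_leq_card/subsetP => v.
  by rewrite !inE.
have /forallP/(_ v)/implyP/(_ uv)/hasP[W /mapP[s sF' ->]] := sepF u.
have := nthP [::] sF' => -[i iF <-] ne; rewrite sF in iF.
by exists (Ordinal iF).
Qed.

(** * Uniform asymptotics *)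

Section Whp.
Variable R : realType.
Implicit Types (n : nat) (p e : R).

Definition graph n := {set {set 'I_n}}.

Definition PrG n p (Q : graph n -> Prop) : R :=
  Pr (all_pairs n) p (fun E => `[< Q E >]).

Lemma PrG_le n p (Q Q' : graph n -> Prop) : 0 <= p <= 1 ->
  (forall E : graph n, E \subset all_pairs n -> Q E -> Q' E) -> PrG p Q <= PrG p Q'.
Proof. by move=> p01 H; apply: Pr_le => // E EE /asboolP QE; apply/asboolP/H. Qed.

Lemma PrG_or n p (Q1 Q2 Q : graph n -> Prop) : 0 <= p <= 1 ->
  (forall E : graph n, E \subset all_pairs n -> Q E -> Q1 E \/ Q2 E) ->
  PrG p Q <= PrG p Q1 + PrG p Q2.
Proof.
move=> p01 H; apply: Pr_or => // E EE /asboolP/(H E EE)[] QE; apply/orP.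
  by left; apply/asboolP.
by right; apply/asboolP.
Qed.

Lemma PrG_union n p (I : finType) (P : pred I) (Q : graph n -> Prop)
    (B : I -> graph n -> Prop) : 0 <= p <= 1 ->
  (forall E : graph n, E \subset all_pairs n -> Q E -> exists2 i, P i & B i E) ->
  PrG p Q <= \sum_(i | P i) PrG p (B i).
Proof.
move=> p01 H; apply: Pr_union => // E EE /asboolP/(H E EE)[i Pi BE].
by exists i => //; apply/asboolP.
Qed.

Lemma PrG_markov n p (Q : graph n -> Prop) g : 0 <= p <= 1 ->
  (forall E : graph n, E \subset all_pairs n -> 0 <= g E) ->
  (forall E : graph n, E \subset all_pairs n -> Q E -> 1 <= g E) ->
  PrG p Q <= Ex (all_pairs n) p g.
Proof. by move=> p01 g0 g1; apply: Pr_markov => // E EE /asboolP; apply: g1. Qed.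

(* Uniform version of "asymptotically almost surely": the threshold on [n] is
   the same for all [p] in the range [rng]. *)
Definition whp (rng : nat -> R -> Prop) (A : forall n, R -> graph n -> Prop) :=
  forall e, 0 < e -> exists N : nat, forall n p, (N <= n)%N -> 0 <= p <= 1 ->
    rng n p -> PrG p (fun E => ~ A n p E) <= e.

Definition ultimately (rng : nat -> R -> Prop) (P : nat -> R -> Prop) :=
  exists N : nat, forall n p, (N <= n)%N -> 0 <= p <= 1 -> rng n p -> P n p.

Lemma whp_and rng A B : whp rng A -> whp rng B ->
  whp rng (fun n p E => A n p E /\ B n p E).
Proof.
move=> wA wB e e0; have e2 : 0 < e / 2 by lra.
have [N1 H1] := wA _ e2; have [N2 H2] := wB _ e2.
exists (maxn N1 N2) => n p; rewrite geq_max => /andP[n1 n2] p01 r.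
have a := H1 n p n1 p01 r; have b := H2 n p n2 p01 r.
have := @PrG_or n p (fun E => ~ A n p E) (fun E => ~ B n p E)
  (fun E => ~ (A n p E /\ B n p E)) p01 (fun E _ => proj1 (not_andP _ _)).
lra.
Qed.

Lemma whp_weaken rng rng' A B : whp rng A ->
  ultimately rng' (fun n p => rng n p) ->
  ultimately rng' (fun n p => forall E : graph n, E \subset all_pairs n ->
     A n p E -> B n p E) -> whp rng' B.
Proof.
move=> wA [N1 H1] [N2 H2] e e0; have [N HN] := wA e e0.
exists (maxn N (maxn N1 N2)) => n p; rewrite !geq_max => /and3P[nN n1 n2] p01 r.
apply: le_trans (HN n p nN p01 (H1 n p n1 p01 r)); apply: PrG_le => // E EE nB HA.
by apply: nB; apply: (H2 n p n2 p01 r E).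
Qed.

Lemma whp_bound rng A (err : nat -> R -> R) :
  ultimately rng (fun n p => PrG p (fun E => ~ A n p E) <= err n p) ->
  (forall e, 0 < e -> ultimately rng (fun n p => err n p <= e)) -> whp rng A.
Proof.
move=> [N1 H1] H2 e e0; have [N2 {}H2] := H2 e e0.
exists (maxn N1 N2) => n p; rewrite geq_max => /andP[n1 n2] p01 r.
exact: le_trans (H1 n p n1 p01 r) (H2 n p n2 p01 r).
Qed.

Lemma ultimately_large rng (K : R) : ultimately rng (fun n p => K <= n%:R).
Proof.
exists (Num.truncn `|K|).+1 => n p nK _ _.
apply: le_trans (ler_norm K) _; apply: le_trans (ltW (_ : _ < (Num.truncn `|K|).+1%:R)) _.
  by case/andP: (truncn_itv (normr_ge0 K)).
by rewrite ler_nat.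
Qed.

Lemma expRN_small (x e : R) : 0 < e -> e^-1 <= x -> expR (- x) <= e.
Proof.
move=> e0 xe; rewrite expRN -(invrK e) lef_pV2 ?posrE ?expR_gt0 ?invr_gt0 //.
by have := expR_ge1Dx x; lra.
Qed.

Lemma one_sub_le_expR (x : R) : 1 - x <= expR (- x).
Proof. by have := expR_ge1Dx (- x). Qed.

Lemma pow_le_expR (x y : R) k : 0 <= x -> x <= expR y -> x ^+ k <= expR (k%:R * y).
Proof.
move=> x0 xy; rewrite expRM_natl.
by case: k => [|k]; rewrite ?expr0 // ler_pXn2r ?nnegrE ?expR_ge0.
Qed.

Lemma card_all_pairs n : (#|all_pairs n| = 'C(n, 2))%N.
Proof. by rewrite /all_pairs card_draws card_ord. Qed.

Lemma bin2_le n : 'C(n, 2)%:R <= n%:R ^+ 2 / 2 :> R.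
Proof.
rewrite ler_pdivlMr // -natrX -natrM ler_nat bin2 muln2.
have := odd_double_half (n * n.-1); have : (n * n.-1 <= n ^ 2)%N.
  by rewrite -mulnn leq_mul2l leq_pred orbT.
lia.
Qed.
End Whp.

(** A booster that is already present would lengthen the longest path or close a Hamilton cycle.
    Boosters are thus disjoint from the prescribed edges [G], and the presence of [G] is independent
    of the absence of boosters. *)
Lemma booster_new (T : finType) (W : {set T}) (G : {set {set T}}) m f :
  (#|W| < 6 * m)%N -> expander (erel W G) W m -> ~ hamiltonian (erel W G) W ->
  f \in boosters (erel W G) W -> #|f| = 2 /\ f \notin G.
Proof.
move=> m6 ex nham /imsetP[[x y] /long_endsP[t tl lE] /= ->].
have tn : t != [::] by apply: (longest_nontrivial _ ex tl); lia.
have [tp tmax] := tl.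
have xW : x \in W by case/and3P: tp => _ _ /andP[].
have yW : y \in W by case/and3P: tp => _ _ /allP; apply; rewrite -lE mem_last.
have yx : y != x.
  apply: contraNneq tn => yx; case/and3P: tp; case: t lE {tl tmax} => // z t lE.
  have xt : x \in z :: t by rewrite -[X in X \in _]yx -[X in X \in _]lE; exact: (mem_last z t).
  by rewrite cons_uniq xt.
split; first by rewrite cards2 eq_sym yx.
apply/negP => fG; have exy : erel W G (last x t) x by rewrite lE /erel yW xW yx setUC.
have [//|[s' s'p]] := close_longest (@erel_sym _ W G) ex m6 (fun _ _ H => H)
  (@erel_sym _ W G) tl exy.
by rewrite ltnNge tmax.
Qed.

(** * Boosters for all hosts simultaneously *)

Section BoosterUnion.
Variable R : realType.

Definition boost_bad n K (x : {set 'I_n} * {set 'I_n} * graph n) :=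
  `[< [/\ (n <= 3 * #|x.1.1|)%N, x.2 \subset all_pairs n, (#|x.2| <= K)%N,
     expander (erel x.1.1 (x.1.2 |: x.2)) x.1.1 (#|x.1.1| %/ 4) &
     ~ hamiltonian (erel x.1.1 (x.1.2 |: x.2)) x.1.1] >].

(** From [#|W| >= n / 3] and [m = #|W| %/ 4] follows [m.+1 >= n / 12], hence there are at least
    [n ^ 2 / 288] boosters, all outside [G]. *)
Lemma booster_event n (p : R) K x : 0 <= p <= 1 -> (30 <= n)%N -> @boost_bad n K x ->
  PrG p (fun E => x.2 \subset E /\
     forall g, g \in E -> g \notin boosters (erel x.1.1 (x.1.2 |: x.2)) x.1.1)
  <= p ^+ #|x.2| * expR (- (p * n%:R ^+ 2 / 288)).
Proof.
move: x => [[W f] G] p01 n30 /asboolP[/= W3 GP GK ex nham].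
set B := boosters _ _; set m := (#|W| %/ 4)%N in ex.
have arith w : (n <= 3 * w -> (w < 6 * (w %/ 4)) && (0 < w) && (n <= 12 * (w %/ 4).+1))%N.
  by clear -n30; lia.
have /andP[/andP[m6 W0] m12] := arith _ W3.
have new g : g \in B -> #|g| = 2 /\ g \notin f |: G by apply: (booster_new m6 ex nham).
have BP : B \subset all_pairs n by apply/subsetP => g /new[g2 _]; rewrite inE g2.
have dGB : [disjoint G & B].
  rewrite disjoint_subset; apply/subsetP => g gG; rewrite inE; apply/negP => /new[_].
  by rewrite inE gG orbT.
have Wn : W != set0 by rewrite -card_gt0.
have Bcard := boosters_card (@erel_sym _ W (f |: G)) (@erel_irr _ W (f |: G)) ex Wn.
rewrite -/B in Bcard.
apply: (@le_trans _ _ (p ^+ #|G| * (1 - p) ^+ #|B|)).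
  rewrite -(Pr_in_out p GP BP dGB) ; apply: Pr_le => // E EP /asboolP[GE nB].
  rewrite GE disjoint_subset; apply/subsetP => g gB; rewrite inE.
  by apply/negP => /nB; rewrite gB.
apply: ler_wpM2l; first by rewrite exprn_ge0 //; case/andP: p01.
apply: le_trans (pow_le_expR _ _ (one_sub_le_expR p)) _; first by rewrite subr_ge0; case/andP: p01.
rewrite ler_expR mulrN lerN2 [X in _ <= X]mulrC -mulrA ler_wpM2l //; first by case/andP: p01.
have : (n ^ 2 <= 288 * #|B|)%N.
  move: m12 Bcard; rewrite -/m; rewrite -!mulnn; clear; move: (#|B|) m.+1 => b k; nia.
rewrite -(ler_nat R) natrX natrM => le; lra.
Qed.

(** Let [D = n (n p)]. The restriction to [K <= D / 10000] edges is exploited through the weight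
    [th ^+ #|G|] with [th = exp (- 10)]: introducing it costs [exp (D / 1000)], and the weighted sum
    over all graphs is at most [exp (D / 2000)]. Both are beaten by [exp (- D / 288)]. The [4 ^ n]
    pairs [W], [f] give the term [2 n]. *)
Lemma booster_rich_fail n (p : R) K : 0 <= p <= 1 -> (30 <= n)%N ->
  K%:R <= n%:R * (n%:R * p) / (100 * 100) ->
  PrG p (fun E : graph n => ~ booster_rich E K) <= expR (n%:R * (2 - n%:R * p / 600)).
Proof.
move=> p01 n30 Kle; have p0 : 0 <= p by case/andP: p01.
set th : R := expR (- 10).
have th0 : 0 < th by apply: expR_gt0.
apply: (@le_trans _ _ (\sum_(x | @boost_bad n K x) (p ^+ #|x.2| * expR (- (p * n%:R ^+ 2 / 288))))).
  apply: le_trans (PrG_union (I := ({set 'I_n} * {set 'I_n} * graph n)%type)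
    (P := @boost_bad n K) (B := fun x E => x.2 \subset E /\
     forall g, g \in E -> g \notin boosters (erel x.1.1 (x.1.2 |: x.2)) x.1.1) p01 _) _.
    move=> E EP nb; apply: contrapT => H; apply: nb => W f G W3 GE GK ex nham.
    apply: contrapT => nob; apply: H; exists (W, f, G).
      apply/asboolP; split=> //=; first by rewrite card_ord in W3.
      exact: subset_trans EP.
    split=> //= g gE; apply/negP => gB; apply: nob; by exists g.
  apply: ler_sum => x bx; exact: (booster_event p01 n30 bx).
rewrite -big_distrl /=.
have th_small : th <= 1 / 1000.
  rewrite /th expRN -[1 / 1000]invrK lef_pV2 ?posrE ?expR_gt0 ?invr_gt0 ?divr_gt0 //.
  have -> : (1 / 1000)^-1 = 1000 :> R by rewrite div1r invrK.
  have -> : 10 = 10%:R * 1 :> R by rewrite mulr1.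
  rewrite expRM_natl; apply: (@le_trans _ _ (2 ^+ 10)); first by rewrite -natrX ler_nat.
  by rewrite ler_pXn2r ?nnegrE ?expR_ge0 // (le_trans _ (expR_ge1Dx 1)).
have thK : 1 <= expR (n%:R * (n%:R * p) / 1000) * th ^+ K.
  rewrite /th -expRM_natl -expRD -[X in X <= _]expR0 ler_expR; lra.
set D := n%:R * (n%:R * p) in Kle thK *.
have sumle : \sum_(x | @boost_bad n K x) p ^+ #|x.2| <=
    expR (n%:R * 2) * (expR (D / 1000) * expR (D / 2000)).
  apply: (@le_trans _ _ (\sum_(x : {set 'I_n} * {set 'I_n} * graph n | x.2 \subset all_pairs n)
      (expR (D / 1000) * (th * p) ^+ #|x.2|))).
    rewrite [X in _ <= X](bigID (@boost_bad n K)) /= -[X in X <= _]addr0; apply: lerD; last first.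
      by apply: sumr_ge0 => x _; rewrite mulr_ge0 ?expR_ge0 // exprn_ge0 // mulr_ge0 // ltW.
    rewrite (eq_bigl (@boost_bad n K)); last first.
      by move=> x /=; case: (boolP (boost_bad K x)) => [/asboolP[_ ->]|]; rewrite ?andbF.
    apply: ler_sum => x /asboolP[_ _ xK _ _].
    rewrite exprMn mulrA -[X in X <= _]mul1r ler_wpM2r ?exprn_ge0 //.
    apply: le_trans thK _; rewrite ler_wpM2l ?expR_ge0 //.
    apply: ler_wiXn2l => //; first exact: ltW.
    by apply: le_trans th_small _; lra.
  rewrite -(pair_big_dep (fun _ : {set 'I_n} * {set 'I_n} => true)
    (fun _ (G : graph n) => G \subset all_pairs n)
    (fun _ (G : graph n) => expR (D / 1000) * (th * p) ^+ #|G|)) /=.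
  rewrite sumr_const -big_distrr /= sum_subsets_pow card_all_pairs.
  rewrite -[X in X <= _]mulr_natl ler_pM //.
  - by rewrite mulr_ge0 ?expR_ge0 // exprn_ge0 // addr_ge0 // mulr_ge0 // ltW.
  - rewrite card_prod -!cardsT -powersetT card_powerset cardsT card_ord -expnD natrX.
    rewrite expRM_natl addnn -mul2n exprM lerXn2r ?nnegrE ?expR_ge0 ?exprn_ge0 //.
    rewrite -[X in expR X]mulr1 expRM_natl ler_pXn2r ?nnegrE ?expR_ge0 //.
    by apply: le_trans (expR_ge1Dx 1); lra.
  - rewrite ler_wpM2l ?expR_ge0 //; apply: le_trans (pow_le_expR _ _ (expR_ge1Dx _)) _.
      by rewrite addr_ge0 // mulr_ge0 // ltW.
    rewrite ler_expR; have := bin2_le R n; have := th_small.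
    rewrite /D; set c := ('C(n, 2))%:R => ths cle.
    have c0 : 0 <= c by rewrite /c ler0n.
    have le1 : c * (th * p) <= n%:R ^+ 2 / 2 * (1 / 1000 * p).
      by apply: ler_pM => //; [rewrite mulr_ge0 // ltW | rewrite ler_wpM2r].
    by apply: le_trans le1 _; rewrite expr2; lra.
apply: le_trans (ler_wpM2r (expR_ge0 _) sumle) _.
rewrite -!expRD ler_expR expr2.
have D0 : 0 <= D by rewrite /D !mulr_ge0.
have -> : p * (n%:R * n%:R) / 288 = D / 288 by rewrite /D; ring.
have -> : n%:R * (2 - n%:R * p / 600) = 2 * n%:R - D / 600 by rewrite /D; field.
lra.
Qed.

Lemma whp_booster_rich :
  whp (fun n (p : R) => 1800 <= n%:R * p)
    (fun n p E => booster_rich E (Num.truncn (n%:R * (n%:R * p) / (100 * 100)))).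
Proof.
apply: (whp_bound (err := fun n p => expR (- n%:R))).
  exists 30%N => n p n30 p01 d; have p0 : 0 <= p by case/andP: p01.
  have D0 : 0 <= n%:R * (n%:R * p) / (100 * 100) by rewrite divr_ge0 // !mulr_ge0.
  have /andP[tle _] := truncn_itv D0.
  apply: le_trans (booster_rich_fail p01 n30 tle) _; rewrite ler_expR.
  have : 0 <= n%:R :> R by rewrite ler0n.
  move: (n%:R : R) d => x d x0; nra.
move=> e e0; have [N H] := @ultimately_large R (fun n p => 1800 <= n%:R * p) e^-1.
by exists N => n p nN p01 r; apply: expRN_small (H n p nN p01 r).
Qed.
End BoosterUnion.

(** * Binomial coefficients and unions over vertex sets of a given size *)

Section Tools.
Variable R : realType.

Lemma expR_half_le2 : expR (1 / 2) <= 2 :> R.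
Proof.
have := one_sub_le_expR (1 / 2 : R); rewrite expRN => le.
have e0 := expR_gt0 (1 / 2 : R).
have := ler_wpM2l (ltW e0) le; rewrite mulfV ?lt0r_neq0 //; lra.
Qed.

Lemma ffact_le n t : (n ^_ t <= n ^ t)%N.
Proof.
elim: t => [|t IH]; first by rewrite ffactn0.
by rewrite ffactnSr expnSr leq_mul // leq_subr.
Qed.

(** The induction step is [(1 + 1 / s) ^ s <= e]. *)
Lemma pow_self_le t : (t ^ t)%:R <= expR t%:R * t`!%:R :> R.
Proof.
elim: t => [|[|t] IH]; first by rewrite expn0 fact0 expR0 mulr1.
  by rewrite exp1n (_ : 1`! = 1%N) // mulr1; apply: le_trans (expR_ge1Dx 1); lra.
rewrite expnS (factS t.+1) (natrM _ t.+2 t.+1`!) (natrM _ t.+2 (t.+2 ^ t.+1)); set s := t.+1 in IH *.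
have s0 : 0 < s%:R :> R by rewrite ltr0n.
rewrite mulrCA ler_wpM2l ?ler0n //.
have -> : (s.+1 ^ s)%:R = (1 + s%:R^-1) ^+ s * (s ^ s)%:R :> R.
  rewrite !natrX -exprMn mulrDl mul1r mulVf ?lt0r_neq0 //.
  by rewrite -[s.+1]addn1 natrD addrC.
have -> : expR s.+1%:R = expR 1 * expR s%:R :> R by rewrite -expRD -natr1 addrC.
rewrite -mulrA; apply: ler_pM => //; first by rewrite exprn_ge0 // addr_ge0 // invr_ge0 ltW.
apply: le_trans (pow_le_expR _ _ (expR_ge1Dx _)) _; first by rewrite addr_ge0 // invr_ge0 ltW.
by rewrite mulfV ?lt0r_neq0.
Qed.

Lemma binom_le n t : (0 < t)%N -> 'C(n, t)%:R <= (expR 1 * n%:R / t%:R) ^+ t :> R.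
Proof.
move=> t0; have tR : 0 < t%:R :> R by rewrite ltr0n.
have f0 : 0 < t`!%:R :> R by rewrite ltr0n fact_gt0.
rewrite expr_div_n exprMn -expRM_natl mulr1 ler_pdivlMr ?exprn_gt0 // -(ler_pM2r f0).
have -> : 'C(n, t)%:R * t%:R ^+ t * t`!%:R = (n ^_ t)%:R * (t ^ t)%:R :> R.
  by rewrite -bin_ffact natrM natrX mulrAC.
have -> : expR t%:R * n%:R ^+ t * t`!%:R = n%:R ^+ t * (expR t%:R * t`!%:R) :> R.
  by rewrite mulrA (mulrC (expR _)).
by apply: ler_pM; rewrite ?ler0n ?pow_self_le // -natrX ler_nat ffact_le.
Qed.

Lemma PrG_union_sets n (p : R) t (Q : graph n -> Prop) (B : {set 'I_n} -> graph n -> Prop) (g : R) :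
  0 <= p <= 1 ->
  (forall E : graph n, E \subset all_pairs n -> Q E -> exists2 Z : {set 'I_n}, #|Z| = t & B Z E) ->
  (forall Z : {set 'I_n}, #|Z| = t -> PrG p (B Z) <= g) ->
  PrG p Q <= 'C(n, t)%:R * g.
Proof.
move=> p01 QB Bg.
apply: le_trans (PrG_union (I := {set 'I_n}) (P := fun Z => #|Z| == t) (B := B) p01 _) _.
  by move=> E EP /(QB E EP)[Z Zt BZ]; exists Z => //; apply/eqP.
apply: (@le_trans _ _ (\sum_(Z : {set 'I_n} | #|Z| == t) g)).
  by apply: ler_sum => Z /eqP; apply: Bg.
rewrite sumr_const -[X in X <= _]mulr_natl.
have := card_draws 'I_n t; rewrite card_ord cardsE => -> //.
Qed.

Definition pairs_in n (Z : {set 'I_n}) := [set e in all_pairs n | e \subset Z].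

Lemma card_pairs_in n (Z : {set 'I_n}) : (#|pairs_in Z| = 'C(#|Z|, 2))%N.
Proof. by rewrite -cards_draws; apply: eq_card => e; rewrite !inE andbC. Qed.

Lemma edges_inE n (E : graph n) (Z : {set 'I_n}) : E \subset all_pairs n ->
  edges_in E Z = E :&: pairs_in Z.
Proof.
move=> EP; apply/setP => e; rewrite !in_set; case: (boolP (e \in E)) => //= eE.
by have := subsetP EP e eE; rewrite inE => ->.
Qed.

Lemma pairs_in_sub n (Z : {set 'I_n}) : pairs_in Z \subset all_pairs n.
Proof. by apply/subsetP => e; rewrite inE => /andP[]. Qed.
End Tools.

(** * A sparse subgraph that joins all pairs of large sets *)

Section Connector.
Variable R : realType.

Definition pairs_between n (S U : {set 'I_n}) : graph n :=
  [set [set x.1; x.2] | x in setX S U].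

Lemma card_pairs_between n (S U : {set 'I_n}) : [disjoint S & U] ->
  (#|pairs_between S U| = #|S| * #|U|)%N.
Proof.
move=> dSU; rewrite card_in_imset ?cardsX //.
move=> [u v] [u' v']; rewrite !inE /= => /andP[uS vU] /andP[u'S v'U] ee.
have : u \in [set u'; v'] by rewrite -ee !inE eqxx.
have : v \in [set u'; v'] by rewrite -ee !inE eqxx orbT.
rewrite !inE => /orP[/eqP vu'|/eqP ->]; first by rewrite vu' (disjointFr dSU u'S) in vU.
by case/orP=> /eqP uE; [rewrite uE | rewrite -uE (disjointFr dSU uS) in v'U].
Qed.

Lemma pairs_between_sub n (S U : {set 'I_n}) : [disjoint S & U] ->
  pairs_between S U \subset all_pairs n.
Proof.
move=> dSU; apply/subsetP => e /imsetP[[u v]]; rewrite !inE /= => /andP[uS vU] ->.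
have uv : u != v by apply: contraTneq uS => ->; rewrite (disjointFl dSU vU).
by rewrite cards2 uv.
Qed.

Lemma Ex_increasing n (q p : R) (Q : graph n -> Prop) : 0 <= q -> q <= p -> p <= 1 ->
  (forall E E' : graph n, E \subset E' -> Q E -> Q E') ->
  PrG p (fun E => ~ Q E) <= PrG q (fun E => ~ Q E).
Proof.
move=> q0 qp p1 Qinc; have q01 : 0 <= q <= 1 by rewrite q0 (le_trans qp).
have p01 : 0 <= p <= 1 by rewrite (le_trans q0).
have compl r : 0 <= r <= 1 ->
    PrG r (fun E => ~ Q E) = 1 - Ex (all_pairs n) r (fun E => (`[< Q E >])%:R).
  move=> r01; rewrite -[Ex _ _ _]/(Pr _ _ _) -Pr_compl //.
  by apply: eq_Ex => E _; rewrite asbool_neg.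
rewrite !compl // lerD2l lerN2; apply: Ex_mono => // E E' EE.
rewrite ler_nat; case: (boolP `[< Q E >]) => // /asboolP QE.
by rewrite (asboolT (Qinc _ _ EE QE)).
Qed.

Lemma many_edges n (r : R) k : 0 <= r <= 1 ->
  PrG r (fun E : graph n => (k < #|E|)%N) <= expR (n%:R ^+ 2 / 2 * r - k.+1%:R / 2).
Proof.
move=> r01; have r0 : 0 <= r by case/andP: r01.
apply: (@le_trans _ _ (Ex (all_pairs n) r (fun E => expR (- (k.+1%:R / 2)) * 2 ^+ #|E :&: all_pairs n|))).
  apply: PrG_markov => // E EP; first by rewrite mulr_ge0 ?expR_ge0 // exprn_ge0.
  rewrite (setIidPl EP) => kE; apply: (@le_trans _ _ (expR (- (k.+1%:R / 2)) * 2 ^+ k.+1)).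
    rewrite expRN mulrC ler_pdivlMr ?expR_gt0 // mul1r.
    have -> : k.+1%:R / 2 = k.+1%:R * (1 / 2) :> R by rewrite div1r.
    by rewrite expRM_natl lerXn2r ?nnegrE ?expR_ge0 // expR_half_le2.
  by rewrite ler_wpM2l ?expR_ge0 // ler_weXn2l //; lra.
rewrite ExZ Ex_pow // card_all_pairs.
rewrite [X in _ <= expR X]addrC expRD ler_pM ?expR_ge0 ?exprn_ge0 //; first by rewrite addr_ge0 ?subr_ge0 ?mulr_ge0 //; case/andP: r01.
have -> : 1 - r + r * 2 = 1 + r by ring.
apply: le_trans (pow_le_expR _ _ (expR_ge1Dx _)) _; first by rewrite addr_ge0.
by rewrite ler_expR ler_wpM2r // bin2_le.
Qed.

Lemma no_connection n (r : R) a : 0 <= r <= 1 ->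
  PrG r (fun E : graph n => exists S U : {set 'I_n}, [/\ [disjoint S & U], (a <= #|S|)%N,
     (a <= #|U|)%N & forall u v, u \in S -> v \in U -> [set u; v] \notin E])
  <= expR (2 * n%:R - r * a%:R ^+ 2).
Proof.
move=> r01; have r0 : 0 <= r by case/andP: r01.
pose P (x : {set 'I_n} * {set 'I_n}) := [&& [disjoint x.1 & x.2], (a <= #|x.1|)%N & (a <= #|x.2|)%N].
apply: (@le_trans _ _ (\sum_(x | P x) expR (- (r * a%:R ^+ 2)))).
  apply: le_trans (PrG_union (P := P) (B := fun x E => [disjoint pairs_between x.1 x.2 & E]) r01 _) _.
    move=> E EP [S [U [dSU aS aU nE]]]; exists (S, U); first by rewrite /P /= dSU aS aU.
    rewrite disjoint_subset; apply/subsetP => e /imsetP[[u v]]; rewrite !inE /= => /andP[uS vU] ->.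
    exact: nE.
  apply: ler_sum => -[S U] /and3P[/= dSU aS aU].
  have BP := pairs_between_sub dSU.
  apply: (@le_trans _ _ (r ^+ #|(set0 : graph n)| * (1 - r) ^+ #|pairs_between S U|)).
    rewrite -(Pr_in_out r (sub0set _) BP); last by rewrite -setI_eq0 set0I.
    by apply: Pr_le => // E _ /asboolP ->; rewrite sub0set.
  rewrite cards0 expr0 mul1r.
  apply: le_trans (pow_le_expR _ _ (one_sub_le_expR r)) _; first by rewrite subr_ge0; case/andP: r01.
  rewrite ler_expR mulrN lerN2 card_pairs_between //.
  rewrite [X in _ <= X]mulrC ler_wpM2l // -natrX ler_nat -mulnn; exact: leq_mul.
rewrite expRD; apply: (@le_trans _ _ (\sum_(x : {set 'I_n} * {set 'I_n}) expR (- (r * a%:R ^+ 2)))).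
  rewrite [X in _ <= X](bigID P) /= lerDl; apply: sumr_ge0 => x _; exact: expR_ge0.
rewrite sumr_const -[X in X <= _]mulr_natl ler_wpM2r ?expR_ge0 //.
rewrite card_prod -!cardsT -powersetT card_powerset cardsT card_ord -expnD natrX.
rewrite mulrC expRM_natl addnn -mul2n exprM lerXn2r ?nnegrE ?expR_ge0 ?exprn_ge0 //.
rewrite -[X in expR X]mulr1 expRM_natl lerXn2r ?nnegrE ?expR_ge0 //.
by apply: le_trans (expR_ge1Dx 1); lra.
Qed.

(** Having a connector is an increasing property, so it may be proved at the smaller probability
    [r = p / 40000]. There the whole random graph has few enough edges and is itself a connector. *)
Lemma whp_connector (al : R) : 0 < al -> exists C : R,
  whp (fun n p => C <= n%:R * p)
    (fun n p E => has_connector E (Num.truncn (n%:R * (n%:R * p) / (20 * 100 * 10)))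
                                  (Num.truncn (al * n%:R))).
Proof.
move=> al0; have al2 : 0 < al ^+ 2 by rewrite exprn_gt0.
(* The first summand makes [r (al n / 2) ^ 2] at least [3 n], against the [2 n] from the choice of
   two sets. The second makes the exponent [n (n p) / 80000] of the edge count at least [n]. *)
exists ((480 * 100 * 10) / al ^+ 2 + (80 * 100 * 10)).
apply: (whp_bound (err := fun n p => 2 * expR (- n%:R))); last first.
  move=> e e0; have e2 : 0 < e / 2 by lra.
  have [N H] := @ultimately_large R (fun n p => (480 * 100 * 10) / al ^+ 2 + (80 * 100 * 10) <= n%:R * p) (e / 2)^-1.
  exists N => n p nN p01 r; have := expRN_small e2 (H n p nN p01 r); lra.
have [N HN] := @ultimately_large R (fun n p => (480 * 100 * 10) / al ^+ 2 + (80 * 100 * 10) <= n%:R * p) (2 / al).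
exists N => n p nN p01 dC; have {HN} nal := HN n p nN p01 dC.
have [p0 p1] := andP p01.
set K1 := Num.truncn _; set a := Num.truncn _.
have n0 : 0 <= n%:R :> R by rewrite ler0n.
have D0 : 0 <= n%:R * (n%:R * p) / (20 * 100 * 10) by rewrite divr_ge0 // !mulr_ge0.
have /andP[_ K1lt] := truncn_itv D0; rewrite -/K1 in K1lt.
have an0 : 0 <= al * n%:R by rewrite mulr_ge0 // ltW.
have /andP[_ alt] := truncn_itv an0; rewrite -/a in alt.
pose r := p / (40 * 100 * 10).
have r0 : 0 <= r by rewrite /r; lra.
have r01 : 0 <= r <= 1 by rewrite /r; lra.
apply: le_trans (Ex_increasing (q := r) r0 _ p1 _) _.
- by rewrite /r; lra.
- move=> E E' EE [G [GE GK conn]]; exists G; split=> //; exact: subset_trans EE.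
apply: le_trans (PrG_or (Q1 := fun E => (K1 < #|E|)%N) (Q2 := fun E : graph n =>
    exists S U : {set 'I_n}, [/\ [disjoint S & U], (a <= #|S|)%N,
     (a <= #|U|)%N & forall u v, u \in S -> v \in U -> [set u; v] \notin E]) r01 _) _.
  move=> E _ nc; case: (ltnP K1 #|E|) => EK; first by left.
  right; apply: contrapT => H; apply: nc; exists E; split=> // S U dSU aS aU.
  apply: contrapT => H2; apply: H; exists S, U; split=> // u v uS vU.
  by apply/negP => uvE; apply: H2; exists u, v.
have -> : 2 * expR (- n%:R) = expR (- n%:R) + expR (- n%:R) :> R by ring.
have Cd : (480 * 100 * 10) / al ^+ 2 <= n%:R * p by lra.
have Cal : 0 <= (480 * 100 * 10) / al ^+ 2 by rewrite divr_ge0 ?mulr_ge0 // ltW.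
have Cd2 : 80 * 100 * 10 <= n%:R * p by lra.
apply: lerD.
- apply: le_trans (many_edges n K1 r01) _; rewrite ler_expR.
  rewrite /r expr2; move: (n%:R : R) n0 Cd2 K1lt D0 => x x0 Cd2 K1lt D0; nra.
- apply: le_trans (no_connection n a r01) _; rewrite ler_expR.
  have a2 : al * n%:R / 2 <= a%:R.
    rewrite -natr1 in alt; rewrite ler_pdivrMr // in nal; lra.
  have : (al * n%:R / 2) ^+ 2 <= a%:R ^+ 2 by rewrite lerXn2r ?nnegrE //; lra.
  move=> le2.
  have : r * (al * n%:R / 2) ^+ 2 <= r * a%:R ^+ 2 by rewrite ler_wpM2l.
  rewrite ler_pdivrMr // in Cd.
  have : (480 * 100 * 10) * n%:R <= (n%:R * p * al ^+ 2) * n%:R by rewrite ler_wpM2r.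
  have -> : r * (al * n%:R / 2) ^+ 2 = (n%:R * p * al ^+ 2) * n%:R / (160 * 100 * 10) by rewrite /r; field.
  lra.
Qed.
End Connector.

(** * Small sets span few edges *)

Section Sparse.
Variable R : realType.

Lemma dense_set_prob n (p la : R) (Z : {set 'I_n}) k : 0 <= p <= 1 -> 1 <= la ->
  PrG p (fun E : graph n => (k <= #|edges_in E Z|)%N) <=
  la^-1 ^+ k * expR (#|Z|%:R ^+ 2 / 2 * (p * la)).
Proof.
move=> p01 la1; have [p0 p1] := andP p01.
have la0 : 0 < la by apply: lt_le_trans la1; lra.
have li : 0 <= la^-1 by rewrite invr_ge0 ltW.
apply: (@le_trans _ _ (Ex (all_pairs n) p (fun E => la^-1 ^+ k * la ^+ #|E :&: pairs_in Z|))).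
  apply: PrG_markov => // E EP; first by rewrite mulr_ge0 ?exprn_ge0 // ltW.
  rewrite edges_inE // => le; rewrite -(subnKC le) exprD mulrA -exprMn mulVf ?lt0r_neq0 //.
  by rewrite expr1n mul1r exprn_ege1.
rewrite ExZ ler_wpM2l ?exprn_ge0 // Ex_pow ?pairs_in_sub // card_pairs_in.
apply: le_trans (_ : (1 + p * la) ^+ 'C(#|Z|, 2) <= _).
  have pla : 0 <= p * la by rewrite mulr_ge0 // ltW.
  by apply: lerXn2r; rewrite ?nnegrE; lra.
apply: le_trans (pow_le_expR _ _ (expR_ge1Dx _)) _.
  by rewrite addr_ge0 ?mulr_ge0 ?(ltW la0).
by rewrite ler_expR ler_wpM2r ?bin2_le ?mulr_ge0 ?(ltW la0).
Qed.

Lemma geometric_half m : \sum_(j < m) (1 / 2 : R) ^+ j <= 2.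
Proof.
suff -> : \sum_(j < m) (1 / 2 : R) ^+ j = 2 - 2 * (1 / 2) ^+ m.
  have : 0 <= (1 / 2 : R) ^+ m by apply: exprn_ge0; rewrite divr_ge0.
  lra.
elim: m => [|m IH]; first by rewrite big_ord0 expr0; lra.
by rewrite big_ord_recr /= IH exprS; lra.
Qed.

(** For [la = eta n / t] the exponential factor becomes [exp (t eta n p / 2)], at most [exp (q t)].
    As [q >= 2], one set has probability at most [(e / la) ^ (2 t)], and this pays for the at most
    [(e n / t) ^ t] sets. *)
Lemma dense_sets_prob n (p eta : R) q t : 0 <= p <= 1 -> (0 < t)%N -> 0 < eta <= 1 ->
  (2 <= q)%N -> eta * (n%:R * p) / 2 <= q%:R ->
  expR 1 ^+ 3 / eta ^+ 2 * t%:R <= n%:R ->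
  PrG p (fun E : graph n => exists2 Z : {set 'I_n}, #|Z| = t & (q * t <= #|edges_in E Z|)%N)
  <= (expR 1 ^+ 3 / eta ^+ 2 * t%:R / n%:R) ^+ t.
Proof.
move=> p01 t0 /andP[eta0 eta1] q2 etaq tn.
have [p0 p1] := andP p01.
have e1 : 1 <= expR 1 :> R by apply: le_trans (expR_ge1Dx 1); lra.
have e0 : 0 < expR 1 :> R by apply: expR_gt0.
have tR : 0 < t%:R :> R by rewrite ltr0n.
set b := expR 1 ^+ 3 / eta ^+ 2 in tn *.
have b0 : 0 < b by rewrite divr_gt0 // exprn_gt0.
have n0 : 0 < n%:R :> R by apply: lt_le_trans tn; rewrite mulr_gt0.
pose la := eta * n%:R / t%:R.
have la_e : expR 1 <= la.
  rewrite /la ler_pdivlMr //; have : eta * (b * t%:R) <= eta * n%:R by rewrite ler_wpM2l // ltW.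
  apply: le_trans; rewrite mulrA ler_wpM2r ?(ltW tR) //.
  have -> : eta * b = expR 1 * (expR 1 * (expR 1 / eta)) by rewrite /b; field; rewrite lt0r_neq0.
  rewrite -[X in X <= _]mulr1 ler_wpM2l ?(ltW e0) // -[X in X <= _]mulr1.
  by apply: ler_pM => //; rewrite ler_pdivlMr // mul1r (le_trans eta1).
have la1 : 1 <= la by apply: le_trans la_e.
have la0 : 0 < la by apply: lt_le_trans la1.
apply: le_trans (PrG_union_sets (t := t) (g := (expR 1 / la) ^+ (2 * t)) p01
   (B := fun Z E => (q * t <= #|edges_in E Z|)%N) _ _) _.
- by move=> E _ [Z Zt H]; exists Z.
- move=> Z Zt; apply: le_trans (dense_set_prob Z (q * t) p01 la1) _.
  rewrite Zt; have -> : t%:R ^+ 2 / 2 * (p * la) = t%:R * (eta * (n%:R * p) / 2).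
    by rewrite /la; field; rewrite lt0r_neq0.
  apply: (@le_trans _ _ (la^-1 ^+ (q * t) * expR 1 ^+ (q * t))).
    rewrite ler_wpM2l ?exprn_ge0 ?invr_ge0 ?(ltW la0) // -expRM_natl mulr1 ler_expR natrM mulrC.
    by rewrite ler_wpM2r ?(ltW tR).
  rewrite -exprMn mulrC; apply: ler_wiXn2l.
  + by rewrite divr_ge0 ?(ltW la0) ?(ltW e0).
  + by rewrite ler_pdivrMr // mul1r.
  + by rewrite leq_mul2r q2 orbT.
apply: le_trans (ler_wpM2r _ (binom_le R n t0)) _.
  by rewrite exprn_ge0 // divr_ge0 ?(ltW la0) ?(ltW e0).
rewrite exprM -exprMn le_eqVlt; apply/orP; left; apply/eqP; congr (_ ^+ _).
by rewrite /la /b; field; rewrite !lt0r_neq0.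
Qed.

(** The factor [36 = 4 * 9] makes the base [b t / n] at most [1 / 4] for all [t <= 9 a]. The term
    with [t = j.+1] is then at most [b / n] times [j.+1 / 4 ^ j], which is at most [1 / 2 ^ j]. *)
Lemma whp_sparse (eta al : R) : 0 < eta <= 1 -> 0 < al ->
  36 * (expR 1 ^+ 3 / eta ^+ 2) * al <= 1 ->
  whp (fun n p => 2 <= eta * (n%:R * p))
    (fun n p E => locally_sparse E (Num.truncn (al * n%:R)) (Num.truncn (eta * (n%:R * p)))).
Proof.
move=> eta01 al0; set b := expR 1 ^+ 3 / eta ^+ 2 => bal.
have /andP[eta0 eta1] := eta01.
have b0 : 0 < b by rewrite divr_gt0 // exprn_gt0 // expR_gt0.
apply: (whp_bound (err := fun n p => 2 * b / n%:R)); last first.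
  move=> e e0; have [N H] := @ultimately_large R (fun n p => 2 <= eta * (n%:R * p)) (2 * b / e).
  exists (maxn N 1) => n p; rewrite geq_max => /andP[nN n1] p01 r; have := H n p nN p01 r.
  by rewrite !ler_pdivrMr ?ltr0n // (mulrC e).
exists 1%N => n p n1 p01 d2; have [p0 p1] := andP p01.
have n0 : 0 < n%:R :> R by rewrite ltr0n.
set a := Num.truncn _; set q := Num.truncn _.
have an0 : 0 <= al * n%:R by rewrite mulr_ge0 ?ltW.
have /andP[ale _] := truncn_itv an0; rewrite -/a in ale.
have ed0 : 0 <= eta * (n%:R * p) by rewrite mulr_ge0 ?mulr_ge0 ?(ltW eta0) ?(ltW n0).
have /andP[qle qlt] := truncn_itv ed0; rewrite -/q in qle qlt.
have q2 : (2 <= q)%N by rewrite -ltnS -(ltr_nat R); apply: le_lt_trans qlt.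
have q2R : 2 <= q%:R :> R by rewrite (ler_nat R 2).
have etaq : eta * (n%:R * p) / 2 <= q%:R by rewrite -natr1 in qlt; lra.
apply: (@le_trans _ _ (\sum_(j < 9 * a) b / n%:R * (1 / 2) ^+ j)); last first.
  rewrite -big_distrr /= -[X in _ <= X]mulrA [X in _ <= X]mulrC.
  by rewrite ler_wpM2l ?geometric_half // divr_ge0 ?ltW.
apply: le_trans (PrG_union (I := 'I_(9 * a)) (P := xpredT) (B := fun j E => exists2 Z : {set 'I_n},
   #|Z| = j.+1 & (q * j.+1 <= #|edges_in E Z|)%N) p01 _) _.
  move=> E _ ns; apply: contrapT => H; apply: ns => Z Z0 Z9; rewrite ltnNge; apply/negP => le.
  have jlt : (#|Z|.-1 < 9 * a)%N by rewrite prednK.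
  by apply: H; exists (Ordinal jlt) => //; exists Z; rewrite /= prednK.
apply: ler_sum => j _; have j9 := ltn_ord j.
have jR : j.+1%:R <= 9 * a%:R :> R by rewrite -natrM ler_nat.
have bj : b * j.+1%:R <= n%:R / 4.
  have : b * j.+1%:R <= b * (9 * (al * n%:R)) by rewrite ler_wpM2l ?(ltW b0) //; lra.
  have : 36 * b * al * n%:R <= 1 * n%:R by rewrite ler_wpM2r // ltW.
  by move: (b * j.+1%:R) => x; lra.
apply: le_trans (dense_sets_prob p01 (ltn0Sn j) eta01 q2 etaq _) _.
  by rewrite -/b; apply: le_trans bj _; lra.
rewrite -/b exprS.
have x4 : b * j.+1%:R / n%:R <= 1 / 4 by rewrite ler_pdivrMr //; lra.
have x0 : 0 <= b * j.+1%:R / n%:R by apply: divr_ge0; [apply: mulr_ge0; [exact: ltW|] | exact: ltW].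
apply: (@le_trans _ _ (b * j.+1%:R / n%:R * (1 / 4) ^+ j)).
  by rewrite ler_wpM2l // lerXn2r ?nnegrE //; lra.
have -> : b * j.+1%:R / n%:R = b / n%:R * j.+1%:R by rewrite mulrAC.
rewrite -mulrA ler_wpM2l //; first by apply: divr_ge0; exact: ltW.
have -> : (1 / 4 : R) = 1 / 2 * (1 / 2) by lra.
rewrite exprMn mulrA -[X in _ <= X]mul1r ler_wpM2r ?exprn_ge0 //; first by lra.
rewrite expr_div_n expr1n mulrC mul1r ler_pdivrMl ?exprn_gt0 // mulr1 -natrX ler_nat.
exact: ltn_expl.
Qed.
End Sparse.

(** * Tail bounds for low sets, rich sets and the maximum degree *)

Section Degrees.
Variable R : realType.

Lemma pairs_in_between_disjoint n (Z S : {set 'I_n}) : S \subset Z ->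
  [disjoint pairs_in Z & pairs_between S (~: Z)].
Proof.
move=> SZ; rewrite disjoint_subset; apply/subsetP => e; rewrite in_set => /andP[_ eZ].
rewrite inE; apply/imsetP => -[[u v]]; rewrite in_setX /= in_setC => /andP[_ vZ] ee.
by case/negP: vZ; apply: (subsetP eZ); rewrite ee !inE eqxx orbT.
Qed.

Lemma between_sub n (Z S : {set 'I_n}) : S \subset Z ->
  pairs_between S (~: Z) \subset all_pairs n.
Proof.
move=> SZ; apply: pairs_between_sub; rewrite disjoint_subset; apply/subsetP => u /(subsetP SZ) uZ.
by rewrite !inE uZ.
Qed.

Lemma card_between n (Z S : {set 'I_n}) : S \subset Z ->
  (#|pairs_between S (~: Z)| = #|S| * (n - #|Z|))%N.
Proof.
move=> SZ; rewrite card_pairs_between; last first.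
  by rewrite disjoint_subset; apply/subsetP => u /(subsetP SZ) uZ; rewrite !inE uZ.
by rewrite [#|~: Z|]cardsCs setCK card_ord.
Qed.

Lemma low_between n (E : graph n) (Z S : {set 'I_n}) h : S \subset Z ->
  S \subset lowset E h -> (#|E :&: pairs_between S (~: Z)| <= h * #|S|)%N.
Proof.
move=> SZ Sl; apply: (@leq_trans #|\bigcup_(v in S) [set [set v; w] | w in nb E v]|).
  apply/subset_leq_card/subsetP => e /setIP[eE /imsetP[[v w]]].
  rewrite in_setX /= in_setC => /andP[vS wZ] ee.
  apply/bigcupP; exists v => //; apply/imsetP; exists w => //.
  rewrite inE -ee eE andbT; apply: contraNneq wZ => ->; exact: (subsetP SZ).
apply: leq_card_bigcup => v vS; apply: leq_trans (leq_imset_card _ _) _.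
by have := subsetP Sl v vS; rewrite inE.
Qed.

(* [th^-h E[th^Z]] for a binomial [Z ~ Bin(m, p)], hence a bound on [P(Z <= h)]. *)
Definition low_weight (th p : R) h m : R := th^-1 ^+ h * (1 - p + p * th) ^+ m.

Lemma low_set_prob n (p th : R) h (Z : {set 'I_n}) : 0 <= p <= 1 -> 0 <= th <= 1 ->
  0 < th \/ h = 0%N ->
  PrG p (fun E : graph n => Z \subset lowset E h) <=
  low_weight th p h (n - #|Z|) ^+ #|Z|.
Proof.
move=> p01 /andP[th0 th1] thh; have [p0 p1] := andP p01.
have ti : 0 <= th^-1 by rewrite invr_ge0.
apply: (@le_trans _ _ (Ex (all_pairs n) p
    (fun E => th^-1 ^+ (h * #|Z|) * th ^+ #|E :&: pairs_between Z (~: Z)|))).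
  apply: PrG_markov => // E EP; first by rewrite mulr_ge0 ?exprn_ge0.
  move=> Zl; have le := low_between (subxx Z) Zl.
  case: thh => [tp|h0]; last first.
    by move: le; rewrite h0 mul0n leqn0 => /eqP ->; rewrite !expr0 mulr1.
  rewrite -(subnK le) exprD -mulrA -exprMn mulVf ?lt0r_neq0 // expr1n mulr1.
  by rewrite exprn_ege1 // invf_ge1.
rewrite ExZ Ex_pow ?between_sub // card_between // /low_weight exprMn -!exprM.
by rewrite (mulnC #|Z|).
Qed.

(** The excess weight is put into the exponent of [mu] and summed over the possible low parts [S] of
    [Z]. Pairs inside [Z] and pairs from [S] to the complement of [Z] are disjoint, so the
    expectation factors, and the sum over [S] is a binomial expansion. *)
Lemma rich_set_prob n (p th mu : R) h (Z : {set 'I_n}) : 0 <= p <= 1 -> 0 < th <= 1 ->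
  1 <= mu ->
  PrG p (fun E : graph n => rich E h Z) <=
  mu^-1 ^+ (11 * #|Z|) * (1 + p * mu ^+ 10) ^+ 'C(#|Z|, 2) *
  (1 + mu ^+ 9 * low_weight th p h (n - #|Z|)) ^+ #|Z|.
Proof.
move=> p01 /andP[th0 th1] mu1; have [p0 p1] := andP p01.
have mu0 : 0 < mu by apply: lt_le_trans mu1.
have ti : 0 <= th^-1 by rewrite invr_ge0 ltW.
have mi : 0 <= mu^-1 by rewrite invr_ge0 ltW.
have q0 : 0 <= 1 - p + p * mu ^+ 10.
  by rewrite addr_ge0 ?subr_ge0 // mulr_ge0 // exprn_ge0 // ltW.
have lw0 m : 0 <= low_weight th p h m.
  rewrite /low_weight mulr_ge0 ?exprn_ge0 // addr_ge0 ?subr_ge0 // mulr_ge0 // ltW //.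
pose term (S : {set 'I_n}) (E : graph n) : R := mu^-1 ^+ (11 * #|Z|) * (mu ^+ 9 * th^-1 ^+ h) ^+ #|S| *
  ((mu ^+ 10) ^+ #|E :&: pairs_in Z| * th ^+ #|E :&: pairs_between S (~: Z)|).
have term0 S E : 0 <= term S E.
  by rewrite /term !mulr_ge0 ?exprn_ge0 // ?mulr_ge0 ?exprn_ge0 // ltW.
apply: (@le_trans _ _ (Ex (all_pairs n) p (fun E => \sum_(S : {set 'I_n} | S \subset Z) term S E))).
  apply: PrG_markov => // E EP; first by apply: sumr_ge0.
  rewrite /rich edges_inE // => rE; set S := Z :&: lowset E h in rE.
  have SZ : S \subset Z by apply: subsetIl.
  rewrite (bigD1 S) //=; apply: ler_wpDr; first by apply: sumr_ge0.
  have le := low_between SZ (subsetIr Z (lowset E h)).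
  have thle : 1 <= (th^-1 ^+ h) ^+ #|S| * th ^+ #|E :&: pairs_between S (~: Z)|.
    rewrite -exprM -(subnK le) exprD -mulrA -exprMn mulVf ?lt0r_neq0 // expr1n mulr1.
    by rewrite exprn_ege1 // invf_ge1.
  have mule : 1 <= mu^-1 ^+ (11 * #|Z|) * (mu ^+ 9) ^+ #|S| * (mu ^+ 10) ^+ #|E :&: pairs_in Z|.
    rewrite -!exprM -mulrA -exprD addnC -(subnKC rE) exprD mulrA -exprMn mulVf ?lt0r_neq0 //.
    by rewrite expr1n mul1r exprn_ege1.
  have -> : term S E = mu^-1 ^+ (11 * #|Z|) * (mu ^+ 9) ^+ #|S| * (mu ^+ 10) ^+ #|E :&: pairs_in Z| *
      ((th^-1 ^+ h) ^+ #|S| * th ^+ #|E :&: pairs_between S (~: Z)|).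
    by rewrite /term exprMn -!mulrA; do 2! congr (_ * _); rewrite mulrCA.
  by rewrite -[1]mulr1; apply: ler_pM.
rewrite Ex_sum.
have ExT (S : {set 'I_n}) : S \subset Z -> Ex (all_pairs n) p (term S) =
    mu^-1 ^+ (11 * #|Z|) * (1 - p + p * mu ^+ 10) ^+ 'C(#|Z|, 2) *
    (mu ^+ 9 * low_weight th p h (n - #|Z|)) ^+ #|S|.
  move=> SZ; rewrite /term ExZ Ex_pow2 ?pairs_in_sub ?between_sub ?pairs_in_between_disjoint //.
  rewrite card_pairs_in card_between // (mulnC #|S|) (exprM _ (n - #|Z|) #|S|) mulrACA /low_weight.
  by rewrite (mulrA (mu ^+ 9)) (exprMn #|S| (mu ^+ 9 * th^-1 ^+ h)).
rewrite (eq_bigr _ ExT) -big_distrr /= sum_subsets_pow.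
have mun k : 0 <= mu ^+ k by apply/exprn_ge0/ltW.
apply: ler_wpM2r; first by apply/exprn_ge0/addr_ge0 => //; apply: mulr_ge0.
apply: ler_wpM2l; first exact: exprn_ge0.
apply: lerXn2r; rewrite ?nnegrE //; first by apply/addr_ge0 => //; apply: mulr_ge0.
by rewrite lerD2r gerBl.
Qed.

Lemma deg_star n (E : graph n) u : E \subset all_pairs n ->
  deg E u = #|E :&: pairs_between [set u] (~: [set u])|.
Proof.
move=> EP; rewrite /deg.
have gi : {in nb E u &, injective (fun w => [set u; w])}.
  move=> w w'; rewrite !inE => /andP[wu _] /andP[w'u _] ww.
  have : w \in [set u; w'] by rewrite -ww !inE eqxx orbT.
  by rewrite !inE (negbTE wu) => /eqP.
rewrite -(card_in_imset gi); apply: eq_card => e; rewrite in_setI.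
apply/imsetP/andP => [[w]|[eE /imsetP[[u' w]]]].
  rewrite inE => /andP[wu uwE] ->; split=> //; apply/imsetP; exists (u, w) => //.
  by rewrite !inE /= eqxx wu.
rewrite !inE /= => /andP[/eqP -> wu] ee; exists w => //.
by rewrite inE wu -ee eE.
Qed.

Lemma maxdeg_prob n (p : R) D : 0 <= p <= 1 ->
  PrG p (fun E : graph n => exists u, (D <= deg E u)%N) <=
  n%:R * expR (n%:R * p - D%:R / 2).
Proof.
move=> p01; have [p0 p1] := andP p01.
apply: le_trans (PrG_union (I := 'I_n) (P := xpredT) (B := fun u E => (D <= deg E u)%N) p01 _) _.
  by move=> E _ [u Du]; exists u.
rewrite mulr_natl -[X in _ *+ X](card_ord n) -sumr_const; apply: ler_sum => u _.
set S := pairs_between [set u] (~: [set u]).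
apply: (@le_trans _ _ (Ex (all_pairs n) p (fun E => expR (- (D%:R / 2)) * 2 ^+ #|E :&: S|))).
  apply: PrG_markov => // E EP; first by rewrite mulr_ge0 ?expR_ge0 // exprn_ge0.
  rewrite deg_star // -/S => le; apply: (@le_trans _ _ (expR (- (D%:R / 2)) * 2 ^+ D)).
    rewrite expRN mulrC ler_pdivlMr ?expR_gt0 // mul1r.
    have -> : D%:R / 2 = D%:R * (1 / 2) :> R by rewrite div1r.
    by rewrite expRM_natl lerXn2r ?nnegrE ?expR_ge0 // expR_half_le2.
  by rewrite ler_wpM2l ?expR_ge0 // ler_weXn2l //; lra.
rewrite ExZ Ex_pow ?between_sub // card_between // cards1 mul1n.
rewrite [X in _ <= expR X]addrC expRD ler_wpM2l ?expR_ge0 //.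
have -> : 1 - p + p * 2 = 1 + p by ring.
apply: le_trans (pow_le_expR _ _ (expR_ge1Dx _)) _; first by rewrite addr_ge0.
by rewrite ler_expR ler_wpM2r // ler_nat leq_subr.
Qed.
End Degrees.

(** * Low-degree vertices are few with high probability *)

Section Asymptotics.
Variable R : realType.

(** The term of degree [k.+1] of the exponential series already dominates. *)
Lemma poly_exp (A c : R) k : 0 < c ->
  exists C : R, 1 <= C /\ forall d, C <= d -> A * d ^+ k <= expR (c * d).
Proof.
move=> c0; have f0 : 0 < (k.+1)`!%:R :> R by rewrite ltr0n fact_gt0.
have ck : 0 < c ^+ k.+1 by rewrite exprn_gt0.
exists (1 + `|A| * (k.+1)`!%:R / c ^+ k.+1); split.
  by rewrite lerDl divr_ge0 ?mulr_ge0 ?(ltW f0) ?(ltW ck).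
move=> d dC; have A0 : 0 <= `|A| * (k.+1)`!%:R / c ^+ k.+1.
  by rewrite divr_ge0 ?mulr_ge0 ?(ltW f0) ?(ltW ck).
have d0 : 0 <= d by lra.
have cd0 : 0 <= c * d by rewrite mulr_ge0 // ltW.
apply: le_trans (le_trans _ (expR_ge1Dxn k cd0)); last exact: lexx.
apply: (@le_trans _ _ ((c * d) ^+ k.+1 / (k.+1)`!%:R)); last by rewrite lerDr.
rewrite ler_pdivlMr // exprMn exprS (exprS d) mulrCA !mulrA.
have dk : 0 <= d ^+ k by rewrite exprn_ge0.
apply: (@le_trans _ _ (`|A| * (k.+1)`!%:R * d ^+ k)).
  by rewrite mulrAC ler_wpM2r // ler_wpM2r ?(ltW f0) // ler_norm.
rewrite ler_wpM2r // -mulrA -exprS mulrC -ler_pdivrMr //.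
lra.
Qed.

Lemma ultimately_ln (rng : nat -> R -> Prop) (K : R) :
  ultimately rng (fun n _ => K <= ln n%:R).
Proof.
have [N H] := @ultimately_large R rng (expR K).
exists (maxn N 1) => n p; rewrite geq_max => /andP[nN n1] p01 r.
rewrite -(expRK K) ler_ln ?posrE ?expR_gt0 ?ltr0n //.
exact: H nN p01 r.
Qed.

Lemma expR_ln_nat n : (0 < n)%N -> expR (ln n%:R) = n%:R :> R.
Proof. by move=> n0; rewrite lnK // posrE ltr0n. Qed.

Lemma low_weight_ge0 (th p : R) h m : 0 <= p <= 1 -> 0 <= th -> 0 <= low_weight th p h m.
Proof.
move=> /andP[p0 p1] th0; rewrite /low_weight mulr_ge0 ?exprn_ge0 ?invr_ge0 //.
by rewrite addr_ge0 ?subr_ge0 ?mulr_ge0.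
Qed.

(** With [d = n p], the factor [tau^-1 ^+ h] is at most [exp (tau d)], because
    [tau^-1 <= exp (tau^-1)] and [h <= tau ^ 2 d]; this dictates the cut-off [hcut]. The other
    factor is at most [exp (- (1 - tau) ^ 2 d)]. *)
Lemma low_weight_le n (tau p : R) h z : 0 <= p <= 1 -> 0 < tau <= 1 / 3 ->
  h%:R <= tau ^+ 2 * (n%:R * p) -> z%:R <= tau * n%:R ->
  low_weight tau p h (n - z) <= expR (- ((1 - 3 * tau) * (n%:R * p))).
Proof.
move=> /andP[p0 p1] /andP[t0 t1] hle zle; have n0 : 0 <= n%:R :> R by [].
have np0 : 0 <= n%:R * p by rewrite mulr_ge0.
apply: (@le_trans _ _ (expR (tau * (n%:R * p)) * expR (- ((1 - tau) ^+ 2 * (n%:R * p))))).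
  rewrite /low_weight; apply: ler_pM.
  - by rewrite exprn_ge0 // invr_ge0 ltW.
  - by rewrite exprn_ge0 // addr_ge0 ?subr_ge0 ?mulr_ge0 // ltW.
  - have ti0 : 0 <= tau^-1 by rewrite invr_ge0 ltW.
    have ti : tau^-1 <= expR tau^-1 by apply: le_trans (expR_ge1Dx _); rewrite lerDr.
    apply: le_trans (pow_le_expR h ti0 ti) _.
    by rewrite ler_expR ler_pdivrMr // mulrAC -expr2.
  - have q0 : 0 <= 1 - p + p * tau by rewrite addr_ge0 ?subr_ge0 ?mulr_ge0 // ltW.
    have q1 : 1 - p + p * tau <= expR (- (p * (1 - tau))).
      apply: le_trans (one_sub_le_expR _); lra.
    apply: le_trans (pow_le_expR _ q0 q1) _; rewrite ler_expR mulrN lerN2.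
    have zn : (z <= n)%N.
      rewrite -(ler_nat R); apply: le_trans zle _; rewrite -[X in _ <= X]mul1r ler_wpM2r //; lra.
    have pt : 0 <= p * (1 - tau) by rewrite mulr_ge0 //; lra.
    have nz : (1 - tau) * n%:R <= (n - z)%:R by rewrite natrB //; lra.
    have := ler_wpM2r pt nz; rewrite expr2; lra.
rewrite -expRD ler_expR; have : 0 <= tau ^+ 2 * (n%:R * p) by rewrite mulr_ge0 ?sqr_ge0.
rewrite !expr2; lra.
Qed.

Lemma low_sets_prob n (tau p : R) h z : 0 <= p <= 1 -> 0 < tau <= 1 / 3 -> (0 < z)%N ->
  h%:R <= tau ^+ 2 * (n%:R * p) -> z%:R <= tau * n%:R ->
  PrG p (fun E : graph n => (z <= #|lowset E h|)%N) <=
  (expR 1 * n%:R / z%:R * expR (- ((1 - 3 * tau) * (n%:R * p)))) ^+ z.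
Proof.
move=> p01 t01 z0 hle zle; have [t0 t1] := andP t01; have [p0 p1] := andP p01.
set x := expR (- _).
apply: le_trans (PrG_union_sets (t := z) (g := x ^+ z) p01
  (B := fun Z E => Z \subset lowset E h) _ _) _.
- by move=> E _ /subset_of_card[Z [sub Zz]]; exists Z.
- move=> Z Zz; apply: le_trans (@low_set_prob R n p tau h Z p01 _ _) _.
  + by rewrite ltW //=; lra.
  + by left.
  + rewrite Zz; apply: lerXn2r; rewrite ?nnegrE ?expR_ge0 ?low_weight_ge0 ?(ltW t0) //.
    exact: low_weight_le.
rewrite exprMn ler_wpM2r ?exprn_ge0 ?expR_ge0 //; exact: binom_le.
Qed.

Definition hcut (tau : R) n (p : R) := Num.truncn (tau ^+ 2 * (n%:R * p)).

Lemma hcut_le tau n p : 0 <= p <= 1 -> (hcut tau n p)%:R <= tau ^+ 2 * (n%:R * p) :> R.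
Proof.
move=> /andP[p0 _].
have t0 : 0 <= tau ^+ 2 * (n%:R * p) by rewrite mulr_ge0 ?sqr_ge0 // mulr_ge0.
by have /andP[] := truncn_itv t0.
Qed.

Lemma hcut_gt tau n p : 0 <= p <= 1 -> tau ^+ 2 * (n%:R * p) < (hcut tau n p)%:R + 1 :> R.
Proof.
move=> /andP[p0 _].
have t0 : 0 <= tau ^+ 2 * (n%:R * p) by rewrite mulr_ge0 ?sqr_ge0 // mulr_ge0.
by have /andP[_] := truncn_itv t0; rewrite -natr1.
Qed.

Lemma whp_no_low (tau eps : R) : 0 < tau <= 1 / 3 -> 0 < eps ->
  1 + eps / 2 <= (1 - 3 * tau) * (1 + eps) ->
  whp (fun n p => (1 + eps) * ln n%:R <= n%:R * p)
    (fun n p E => lowset E (hcut tau n p) = set0).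
Proof.
move=> t01 e0 te; have [t0 t1] := andP t01.
apply: (whp_bound (err := fun n p => expR (1 - eps / 2 * ln n%:R))); last first.
  move=> e ep0; have [N H] := @ultimately_ln (fun n p => (1 + eps) * ln n%:R <= n%:R * p) ((1 + e^-1) / (eps / 2)).
  exists N => n p nN p01 r; have := H n p nN p01 r; rewrite ler_pdivrMr ?divr_gt0 // => le.
  rewrite (_ : 1 - eps / 2 * ln n%:R = - (eps / 2 * ln n%:R - 1)); last by ring.
  by apply: expRN_small => //; lra.
have [N H] := @ultimately_large R (fun n p => (1 + eps) * ln n%:R <= n%:R * p) tau^-1.
exists (maxn N 1) => n p; rewrite geq_max => /andP[nN n1] p01 d.
have z1 : (1%N)%:R <= tau * n%:R :> R.
  by have := H n p nN p01 d; rewrite mulrC -ler_pdivrMr // div1r.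
apply: le_trans (_ : PrG p (fun E : graph n => (1 <= #|lowset E (hcut tau n p)|)%N) <= _).
  by apply: PrG_le => // E _ /eqP; rewrite -card_gt0.
apply: le_trans (low_sets_prob p01 t01 (ltnSn 0) (hcut_le tau n p01) z1) _.
rewrite expr1 divr1 -{1}(expR_ln_nat n1) -!expRD ler_expR.
have ln0 : 0 <= ln n%:R :> R by rewrite ln_ge0 // ler1n.
have := ler_wpM2r ln0 te; have t3 : 0 <= 1 - 3 * tau by lra.
have := ler_wpM2l t3 d; rewrite mulrA; lra.
Qed.

Lemma whp_maxdeg : whp (fun n (p : R) => n%:R * p <= 2 * ln n%:R)
  (fun n p E => forall u, (deg E u <= Num.truncn (8 * ln n%:R : R))%N).
Proof.
apply: (whp_bound (err := fun n p => expR (- ln n%:R))); last first.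
  move=> e e0; have [N H] := @ultimately_ln (fun n p => n%:R * p <= 2 * ln n%:R) e^-1.
  by exists N => n p nN p01 r; apply: expRN_small => //; exact: H nN p01 r.
exists 1%N => n p n1 p01 d; set D := Num.truncn _.
have ln0 : 0 <= 8 * ln n%:R :> R by rewrite mulr_ge0 // ln_ge0 // ler1n.
have /andP[_ Dlt] := truncn_itv ln0; rewrite -/D in Dlt.
apply: le_trans (_ : PrG p (fun E : graph n => exists u, (D.+1 <= deg E u)%N) <= _).
  apply: PrG_le => // E _ nd; apply: contrapT => H; apply: nd => u; rewrite leqNgt.
  by apply/negP => lt; apply: H; exists u.
apply: le_trans (maxdeg_prob n D.+1 p01) _.
rewrite -{1}(expR_ln_nat n1) -expRD ler_expR; lra.
Qed.

(** The factor [(hcut tau n p).+1] leaves room for the low vertices together with all their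
    neighbours. *)
Lemma whp_lows_few (tau : R) : 0 < tau <= 1 / 10 -> exists C : R,
  whp (fun n p => C <= n%:R * p)
    (fun n p E => (10 * (hcut tau n p).+1 * #|lowset E (hcut tau n p)| <= n)%N).
Proof.
move=> /andP[t0 t1]; have t01 : 0 < tau <= 1 / 3 by rewrite t0 /=; lra.
have t2 : 0 < tau ^+ 2 by rewrite exprn_gt0.
have [C1 [C11 C1P]] := @poly_exp (10 * expR 1 * 2) (1 / 5) 1 (ltac:(lra)).
pose C := C1 + 40 / tau ^+ 3 + 1.
have C3 : 0 <= 40 / tau ^+ 3 by rewrite divr_ge0 // exprn_ge0 // ltW.
exists C.
apply: (whp_bound (err := fun n p => expR (- (n%:R / 50)))); last first.
  move=> e e0; have [N H] := @ultimately_large R (fun n p => C <= n%:R * p) (50 * e^-1).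
  by exists N => n p nN p01 r; apply: expRN_small => //; have := H n p nN p01 r; lra.
have [N H] := @ultimately_large R (fun n p => C <= n%:R * p) (2 / tau).
exists (maxn N 1) => n p; rewrite geq_max => /andP[nN n1] p01 dC; have {H} nt := H n p nN p01 dC.
have [p0 p1] := andP p01.
have n0 : 0 < n%:R :> R by rewrite ltr0n.
set h := hcut tau n p; have hle := hcut_le tau n p01; have hgt := hcut_gt tau n p01.
rewrite -/h in hle hgt.
set d := n%:R * p in dC hle hgt *.
have h1 : 0 < h.+1%:R :> R by rewrite ltr0n.
pose z := (n %/ (10 * h.+1)).+1.
have z0 : (0 < z)%N by [].
have zgt : (n < 10 * h.+1 * z)%N by rewrite mulnC ltn_ceil.
have zgtR : n%:R <= 10 * h.+1%:R * z%:R :> R by rewrite -!natrM ler_nat ltnW.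
have zle : z%:R <= tau * n%:R.
  have le1 : (n %/ (10 * h.+1))%:R * (10 * h.+1%:R) <= n%:R :> R.
    by rewrite -!natrM ler_nat leq_trunc_div.
  have h40 : 40 / tau <= h.+1%:R.
    rewrite -[h.+1%:R]natr1; apply: le_trans _ (ltW hgt).
    have : tau ^+ 2 * (40 / tau ^+ 3) <= tau ^+ 2 * d by rewrite ler_wpM2l ?(ltW t2) //; rewrite /C in dC; lra.
    by apply: le_trans; rewrite le_eqVlt; apply/orP; left; apply/eqP; field; rewrite lt0r_neq0.
  have : (n %/ (10 * h.+1))%:R <= tau * n%:R / 2.
    have q0 : 0 <= (n %/ (10 * h.+1))%:R :> R by [].
    have : (n %/ (10 * h.+1))%:R * (400 / tau) <= n%:R.
      apply: le_trans le1; rewrite ler_wpM2l //; lra.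
    rewrite mulrA ler_pdivrMr // => le2; lra.
  have -> : z%:R = (n %/ (10 * h.+1))%:R + 1 :> R by rewrite /z natr1.
  have : 1 <= tau * n%:R / 2.
    by move: nt; rewrite ler_pdivrMr // mulrC; lra.
  lra.
apply: le_trans (_ : PrG p (fun E : graph n => (z <= #|lowset E h|)%N) <= _).
  apply: PrG_le => // E _ /negP; rewrite -ltnNge => lt.
  by rewrite /z ltn_divLR // mulnC.
apply: le_trans (low_sets_prob p01 t01 z0 hle zle) _; rewrite -/d.
have d1 : 1 <= d by rewrite /C in dC; lra.
have base : expR 1 * n%:R / z%:R * expR (- ((1 - 3 * tau) * d)) <= expR (- (d / 2)).
  apply: (@le_trans _ _ (10 * expR 1 * 2 * d ^+ 1 * expR (- ((7 / 10) * d)))).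
    apply: ler_pM; rewrite ?expR_ge0 //.
    - by rewrite divr_ge0 ?mulr_ge0 ?expR_ge0.
    - rewrite ler_pdivrMr ?ltr0n // expr1.
      have hd : h.+1%:R <= 2 * d.
        rewrite -[h.+1%:R]natr1; have : tau ^+ 2 * d <= 1 * d.
          by rewrite ler_wpM2r //; [lra | rewrite expr_le1 //; lra].
        lra.
      have z0R : 0 <= z%:R :> R by [].
      have := ler_wpM2r z0R hd; have e0 : 0 <= expR 1 :> R by apply: expR_ge0.
      move=> hz; have : n%:R <= 10 * (2 * d * z%:R) by lra.
      by move/(ler_wpM2l e0); lra.
    - by rewrite ler_expR lerN2 ler_wpM2r //; lra.
  have dC1 : C1 <= d by rewrite /C in dC; lra.
  apply: le_trans (ler_wpM2r (expR_ge0 _) (C1P d dC1)) _.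
  by rewrite -expRD ler_expR; lra.
have base0 : 0 <= expR 1 * n%:R / z%:R * expR (- ((1 - 3 * tau) * d)).
  by rewrite mulr_ge0 ?expR_ge0 // divr_ge0 ?mulr_ge0 ?expR_ge0.
apply: le_trans (pow_le_expR z base0 base) _; rewrite ler_expR mulrN lerN2.
have hd : h.+1%:R <= 5 / 2 * d.
  rewrite -[h.+1%:R]natr1; have : tau ^+ 2 * d <= 1 * d.
    by rewrite ler_wpM2r //; [lra | rewrite expr_le1 //; lra].
  lra.
have z0R : 0 <= z%:R :> R by [].
have := ler_wpM2r z0R hd; lra.
Qed.
End Asymptotics.

(** * Isolated vertices and the size of the discarded set *)

Section CleanWhp.
Variable R : realType.

(** Near [log n] there are at most [n ^ gam] low vertices, so separating them and their neighbours
    takes only a small multiple of [log n] paths. *)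
Lemma whp_lows_tiny (tau eps gam : R) : 0 < tau <= 1 / 3 -> 0 < gam <= 1 / 2 ->
  1 - gam / 2 <= (1 - 3 * tau) * (1 - eps) ->
  whp (fun n p => (1 - eps) * ln n%:R <= n%:R * p)
    (fun n p E => #|lowset E (hcut tau n p)|%:R <= expR (gam * ln n%:R)).
Proof.
move=> t01 /andP[g0 g1] te; have [t0 t1] := andP t01.
apply: (whp_bound (err := fun n p => expR (- (gam / 2 * ln n%:R - 1)))); last first.
  move=> e ep0; have [N H] := @ultimately_ln R (fun n p => (1 - eps) * ln n%:R <= n%:R * p) ((1 + e^-1) / (gam / 2)).
  exists N => n p nN p01 r; have := H n p nN p01 r; rewrite ler_pdivrMr ?divr_gt0 // => le.
  by apply: expRN_small => //; lra.
have [N H] := @ultimately_ln R (fun n p => (1 - eps) * ln n%:R <= n%:R * p) (4 / tau + 2 / gam).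
exists (maxn N 1) => n p; rewrite geq_max => /andP[nN n1] p01 d; have {H} nt := H n p nN p01 d.
set l := ln n%:R in d nt *; have nl : n%:R = expR l :> R by rewrite /l expR_ln_nat.
have ti0 : 0 <= 4 / tau by rewrite divr_ge0 // ltW.
have gi0 : 0 <= 2 / gam by rewrite divr_ge0 // ltW.
have e0 : 0 <= expR (gam * l) by apply: expR_ge0.
have /andP[zl zg] := truncn_itv e0.
set z0 := Num.truncn _ in zl zg; set h := hcut tau n p; pose z := z0.+1.
have zE : z%:R = z0%:R + 1 :> R by rewrite natr1.
have l0 : 0 <= l by lra.
have zle : z%:R <= tau * n%:R.
  have el2 : 2 / tau <= expR (l / 2).
    apply: le_trans (expR_ge1Dx _); have -> : 2 / tau = (4 / tau) / 2 by field; rewrite lt0r_neq0.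
    lra.
  have el1 : 1 <= expR (l / 2) by apply: le_trans (expR_ge1Dx _); lra.
  have le1 : expR (gam * l) <= expR (l / 2) by rewrite ler_expR mulrC ler_wpM2l //; lra.
  have -> : n%:R = expR (l / 2) * expR (l / 2) :> R by rewrite -expRD nl; congr expR; lra.
  rewrite zE mulrA; apply: (@le_trans _ _ (2 * expR (l / 2))); first by lra.
  rewrite ler_wpM2r ?expR_ge0 //; move: el2; rewrite ler_pdivrMr //; lra.
apply: le_trans (_ : PrG p (fun E : graph n => (z <= #|lowset E h|)%N) <= _).
  apply: PrG_le => // E _ /negP; rewrite -ltNge => lt.
  by rewrite /z -(ltr_nat R); apply: le_lt_trans lt.
apply: le_trans (low_sets_prob p01 t01 (ltn0Sn z0) (hcut_le tau n p01) zle) _.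
set b := _ * _.
have b0 : 0 <= b by rewrite /b mulr_ge0 ?expR_ge0 // divr_ge0 ?mulr_ge0 ?expR_ge0.
have ble : b <= expR (- (gam / 2 * l - 1)).
  rewrite /b mulrAC ler_pdivrMr ?ltr0n // nl -!expRD.
  apply: (@le_trans _ _ (expR (- (gam / 2 * l - 1)) * expR (gam * l))).
    rewrite -expRD ler_expR; have := ler_wpM2r l0 te; have t3 : 0 <= 1 - 3 * tau by lra.
    have := ler_wpM2l t3 d; rewrite nl mulrA; lra.
  by rewrite ler_wpM2l ?expR_ge0 //; apply: ltW.
have b1 : b <= 1.
  apply: le_trans ble _; rewrite -[X in _ <= X]expR0 ler_expR.
  have : 2 / gam <= l by lra.
  by rewrite ler_pdivrMr //; lra.
apply: le_trans ble; rewrite exprS -[X in _ <= X]mulr1 ler_wpM2l //.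
by apply: exprn_ile1.
Qed.

(** The mean number of leaves up to lower order, provided that [n p ^ 2] is small. *)
Definition leafM n (p : R) : R := n%:R ^+ 2 * p * expR (- (n%:R * p)).

Lemma leafM_ge0 n p : 0 <= p <= 1 -> 0 <= leafM n p.
Proof. by move=> /andP[p0 _]; rewrite /leafM !mulr_ge0 ?expR_ge0 ?sqr_ge0. Qed.

Lemma isolated_prob n (p : R) z : 0 <= p <= 1 -> (0 < z)%N ->
  PrG p (fun E : graph n => (z <= #|lowset E 0|)%N) <=
  (expR 1 * n%:R / z%:R * expR (- (n%:R * p) + p * z%:R)) ^+ z.
Proof.
move=> p01 z0; have [p0 p1] := andP p01; set x := expR (- _ + _).
apply: le_trans (PrG_union_sets (t := z) (g := x ^+ z) p01
  (B := fun Z E => Z \subset lowset E 0) _ _) _.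
- by move=> E _ /subset_of_card[Z [sub Zz]]; exists Z.
- move=> Z Zz; apply: le_trans (@low_set_prob R n p 0 0 Z p01 _ _) _.
  + by rewrite lexx ler01.
  + by right.
  + rewrite Zz; apply: lerXn2r; rewrite ?nnegrE ?expR_ge0 ?low_weight_ge0 //.
    rewrite /low_weight expr0 mul1r mulr0 addr0.
    have q0 : 0 <= 1 - p by rewrite subr_ge0.
    apply: le_trans (pow_le_expR _ q0 (one_sub_le_expR p)) _.
    rewrite ler_expR mulrN; have : n%:R - z%:R <= (n - z)%:R :> R.
      rewrite lerBlDr -natrD ler_nat; lia.
    by move/(ler_wpM2r p0); lra.
rewrite exprMn ler_wpM2r ?exprn_ge0 ?expR_ge0 //; exact: binom_le.
Qed.

(** The mean number of isolated vertices is about [leafM n p / (n p)], smaller by the large factor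
    [n p]. The alternative [ln n] in the maximum keeps the failure probability tending to 0 when
    [leafM] is small. *)
Lemma whp_isolated (del : R) : 0 < del <= 1 -> exists C : R,
  whp (fun n p => C <= n%:R * p <= 2 * ln n%:R)
    (fun n p E => #|lowset E 0|%:R <= del * Num.max (leafM n p) (ln n%:R)).
Proof.
move=> /andP[d0 d1]; exists (1 + expR 6 / del).
set rng := fun _ _ => _.
apply: (whp_bound (err := fun n p => expR (- (del * ln n%:R)))); last first.
  move=> e ep0; have [N H] := @ultimately_ln R rng (e^-1 / del).
  exists N => n p nN p01 r; have := H n p nN p01 r; rewrite ler_pdivrMr // => le.
  by apply: expRN_small => //; lra.
have [C2 [C21 C2P]] := @poly_exp R 2 1 2 (ltac:(lra)).
have [N H] := @ultimately_ln R rng C2.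
exists (maxn N 1) => n p; rewrite geq_max => /andP[nN n1] p01 r; have {H} lC := H n p nN p01 r.
have /andP[dC dl] : rng n p := r; have [p0 p1] := andP p01.
set l := ln n%:R in dl lC *; have nl : n%:R = expR l :> R by rewrite /l expR_ln_nat.
have l1 : 1 <= l by lra.
have n0 : 0 < n%:R :> R by rewrite ltr0n.
set d := n%:R * p in dC dl *.
have e6 : 0 <= expR 6 / del by rewrite divr_ge0 ?expR_ge0 // ltW.
have dge1 : 1 <= d by lra.
set M := leafM n p; have M0 : 0 <= M by apply: leafM_ge0.
have Md : n%:R * expR (- d) = M / d.
  have dn0 : d != 0 by rewrite lt0r_neq0 //; lra.
  have -> : M = n%:R * expR (- d) * d by rewrite /M /leafM /d; ring.
  by rewrite mulfK.
set mx := Num.max M l; have Mmx : M <= mx by rewrite le_max lexx.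
have lmx : l <= mx by rewrite le_max lexx orbT.
have mxle : mx <= M + l by rewrite ge_max; lra.
have B0 : 0 <= del * mx by rewrite mulr_ge0 ?(ltW d0) //; lra.
have /andP[zl zg] := truncn_itv B0; set z0 := Num.truncn _ in zl zg.
pose z := z0.+1; have zE : z%:R = z0%:R + 1 :> R by rewrite natr1.
apply: le_trans (_ : PrG p (fun E : graph n => (z <= #|lowset E 0|)%N) <= _).
  apply: PrG_le => // E _ /negP; rewrite -ltNge => lt.
  by rewrite /z -(ltr_nat R); apply: le_lt_trans lt.
apply: le_trans (isolated_prob n p01 (ltn0Sn z0)) _; rewrite -/z -/d.
have pM : p * M <= 2.
  have -> : p * M = d ^+ 2 * expR (- d) by rewrite /M /leafM /d; ring.
  rewrite expRN ler_pdivrMr ?expR_gt0 //.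
  have := @expR_ge1Dxn R d 1 (ltac:(lra)); have -> : (2`!)%:R = 2 :> R by []. lra.
have pl : p * l <= 1.
  rewrite -(ler_pM2l n0) mulr1 mulrA -/d; apply: (@le_trans _ _ (2 * l * l)).
    by rewrite ler_wpM2r //; lra.
  by have := C2P l lC; rewrite mul1r -nl expr2 mulrA.
have pz : p * z%:R <= 4.
  have : p * z%:R <= p * (M + l + 1).
    rewrite ler_wpM2l // zE lerD2r; apply: le_trans zl _.
    apply: le_trans mxle; rewrite -[X in _ <= X]mul1r ler_wpM2r //; lra.
  lra.
have zR : 0 < z%:R :> R by rewrite ltr0n.
set b := _ * _.
have b0 : 0 <= b by rewrite /b mulr_ge0 ?expR_ge0 // divr_ge0 ?mulr_ge0 ?expR_ge0.
have ble : b <= expR (- 1).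
  have -> : b = (M / d) * (expR 1 * expR (p * z%:R)) / z%:R.
    by rewrite /b expRD -Md; ring.
  rewrite ler_pdivrMr //.
  apply: (@le_trans _ _ (M / d * expR 5)).
    rewrite ler_wpM2l //; first by rewrite divr_ge0 //; lra.
    by rewrite -expRD ler_expR; lra.
  have dz : del * M <= z%:R.
    by apply: ltW; apply: le_lt_trans zg; rewrite ler_wpM2l // ltW.
  have d0' : 0 < d by lra.
  have e5 : expR 5 <= expR (- 1) * (del * d).
    have -> : expR 5 = expR (- 1) * expR 6 :> R by rewrite -expRD; congr expR; ring.
    rewrite ler_wpM2l ?expR_ge0 //.
    have : expR 6 / del <= d by lra.
    by rewrite ler_pdivrMr // mulrC.
  have Md0 : 0 <= M / d by rewrite divr_ge0 // ltW.
  apply: le_trans (ler_wpM2l Md0 e5) _.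
  have -> : M / d * (expR (- 1) * (del * d)) = expR (- 1) * (del * M).
    by field; rewrite lt0r_neq0.
  by rewrite ler_wpM2l ?expR_ge0.
apply: le_trans (pow_le_expR z b0 ble) _; rewrite ler_expR mulrN1 lerN2.
by apply: le_trans (ltW zg); rewrite ler_wpM2l // ltW.
Qed.

(** The number [L] is defined by [n = exp (L) z d] with [d = n p], and [mu = exp (L / 10)]. Then
    edges inside the set contribute at most [exp (z / 2)]. Low vertices contribute at most [2 ^ z],
    since [L <= 1.05 d] keeps [mu ^ 9] below the inverse of the low-degree bound; this is the origin
    of 1.05. Choosing the set costs about [exp (L z)] and [mu ^ (- 11 z)] gains [exp (1.1 L z)]. The
    surplus [exp (L z / 10)], with [L >= d / 4], absorbs the remaining factors. *)
Lemma rich_sets_prob n (tau p L : R) h z : 0 <= p <= 1 -> 0 < tau <= 1 / 100 -> (0 < z)%N ->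
  h%:R <= tau ^+ 2 * (n%:R * p) -> z%:R <= tau * n%:R -> 1 <= n%:R * p ->
  n%:R = expR L * (z%:R * (n%:R * p)) ->
  n%:R * expR (- (21 / 20 * (n%:R * p))) <= z%:R -> n%:R * p / 4 <= L ->
  expR 2 * 2 * (n%:R * p) <= expR (n%:R * p / 80) ->
  PrG p (fun E : graph n => exists2 Z : {set 'I_n}, #|Z| = z & rich E h Z) <=
  expR (- (z%:R * (n%:R * p / 80))).
Proof.
move=> p01 /andP[t0 t1] z0 hle zle; set d := n%:R * p => d1 nL zlow dL dbig.
have [p0 p1] := andP p01; have zR : 0 < z%:R :> R by rewrite ltr0n.
have n0 : 0 < n%:R :> R by rewrite nL mulr_gt0 ?expR_gt0 // mulr_gt0 //; lra.
have tau1 : 0 < tau <= 1 by rewrite t0 /=; lra.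
pose mu := expR (L / 10).
have mu1 : 1 <= mu by apply: le_trans (expR_ge1Dx _); lra.
have L105 : L <= 21 / 20 * d.
  rewrite -ler_expR -(ler_pM2r (expR_gt0 (- (21 / 20 * d)))) -[X in _ <= X]expRD subrr expR0.
  have zd : 0 < z%:R * d by rewrite mulr_gt0 //; lra.
  rewrite -(ler_pM2r zd) mul1r mulrAC -nL; apply: le_trans zlow _.
  by rewrite -[X in X <= _]mulr1 ler_wpM2l // ltW.
set x := low_weight tau p h (n - z).
have x0 : 0 <= x by apply: low_weight_ge0 => //; apply: ltW.
have xle : x <= expR (- ((1 - 3 * tau) * d)).
  by apply: low_weight_le => //; rewrite t0 /=; lra.
have mux : mu ^+ 9 * x <= 1.
  rewrite /mu -expRM_natl; apply: le_trans (ler_wpM2l (expR_ge0 _) xle) _.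
  rewrite -expRD -[X in _ <= X]expR0 ler_expR.
  have : tau * d <= 1 / 100 * d by rewrite ler_wpM2r //; lra.
  lra.
have mu10 : mu ^+ 10 = expR L by rewrite /mu -expRM_natl; congr expR; field.
apply: le_trans (PrG_union_sets (t := z)
  (g := mu^-1 ^+ (11 * z) * (1 + p * mu ^+ 10) ^+ 'C(z, 2) * (1 + mu ^+ 9 * x) ^+ z)
  p01 (B := fun Z E => rich E h Z) _ _) _.
- by move=> E _ [Z Zz rZ]; exists Z.
- by move=> Z Zz; rewrite /x -Zz; apply: rich_set_prob.
have f1 : 'C(n, z)%:R <= expR (z%:R * (1 + L)) * d ^+ z.
  apply: le_trans (binom_le R n z0) _.
  rewrite expRM_natl -exprMn expRD le_eqVlt; apply/orP; left; apply/eqP; congr (_ ^+ _).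
  by rewrite {1}nL; field; rewrite lt0r_neq0.
have f2 : mu^-1 ^+ (11 * z) = expR (- (z%:R * (11 / 10 * L))) :> R.
  by rewrite /mu -expRN -expRM_natl; congr expR; rewrite natrM; field.
have f3 : (1 + p * mu ^+ 10) ^+ 'C(z, 2) <= expR (z%:R / 2).
  have pe0 : 0 <= p * expR L by rewrite mulr_ge0 ?expR_ge0.
  rewrite mu10; apply: le_trans (pow_le_expR _ _ (expR_ge1Dx _)) _; first by rewrite addr_ge0.
  rewrite ler_expR; apply: le_trans (ler_wpM2r pe0 (bin2_le R z)) _.
  have pz : p * expR L * z%:R = 1.
    have d0 : d != 0 by rewrite lt0r_neq0 //; lra.
    apply: (mulIf d0); rewrite mul1r {2}/d {1}nL; rewrite /d; ring.
  have -> : z%:R ^+ 2 / 2 * (p * expR L) = (p * expR L * z%:R) * (z%:R / 2) by field.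
  by rewrite pz mul1r.
have f4 : (1 + mu ^+ 9 * x) ^+ z <= 2 ^+ z.
  have m0 : 0 <= mu ^+ 9 * x by rewrite mulr_ge0 // exprn_ge0 // expR_ge0.
  by apply: lerXn2r; rewrite ?nnegrE //; lra.
have mu0 : 0 <= mu by apply: expR_ge0.
have d0 : 0 <= d by lra.
apply: (@le_trans _ _ (expR (z%:R * (1 + L)) * d ^+ z *
   (expR (- (z%:R * (11 / 10 * L))) * expR (z%:R / 2) * 2 ^+ z))).
  apply: ler_pM => //.
    by rewrite !mulr_ge0 ?exprn_ge0 ?invr_ge0 // addr_ge0 // mulr_ge0 // exprn_ge0.
  rewrite -f2; apply: ler_pM => //.
  - by rewrite !mulr_ge0 ?exprn_ge0 ?invr_ge0 // addr_ge0 // mulr_ge0 // exprn_ge0.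
  - by rewrite exprn_ge0 // addr_ge0 // mulr_ge0 // exprn_ge0.
  - by rewrite ler_wpM2l ?exprn_ge0 ?invr_ge0.
have -> : expR (z%:R * (1 + L)) * d ^+ z *
   (expR (- (z%:R * (11 / 10 * L))) * expR (z%:R / 2) * 2 ^+ z) =
   (expR (3 / 2 - L / 10) * (2 * d)) ^+ z.
  rewrite (exprMn z (expR _) (2 * d)) (exprMn z 2 d) -expRM_natl.
  have -> : z%:R * (3 / 2 - L / 10) = z%:R * (1 + L) - z%:R * (11 / 10 * L) + z%:R / 2.
    by field.
  rewrite !expRD; move: (d ^+ z) (2 ^+ z) => a b; ring.
rewrite -(mulrN z%:R) expRM_natl.
apply: lerXn2r; rewrite ?nnegrE ?mulr_ge0 ?expR_ge0 //.
apply: (@le_trans _ _ (expR (- (d / 40)) * (expR 2 * 2 * d))).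
  have -> : expR (- (d / 40)) * (expR 2 * 2 * d) = expR (2 - d / 40) * (2 * d).
    by rewrite (expRD 2 (- (d / 40))); ring.
  by rewrite ler_wpM2r ?mulr_ge0 // ler_expR; lra.
by apply: le_trans (ler_wpM2l (expR_ge0 _) dbig) _; rewrite -expRD ler_expR; lra.
Qed.

(** All six sizes from [z0] to [z0 + 5] are excluded, where [z0] is the first integer above
    [n exp (- 1.05 d)]. The cap [n p <= 2 ln n] ensures that [n] exceeds these sizes by the factor
    [d exp (d / 4)] even when [z0 = 1]. *)
Lemma whp_clean (tau : R) : 0 < tau <= 1 / 100 -> exists C : R,
  whp (fun n p => C <= n%:R * p <= 2 * ln n%:R)
    (fun n p E => exists2 X : {set 'I_n}, #|X|%:R <= n%:R * expR (- (21 / 20 * (n%:R * p))) &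
       clean E (hcut tau n p) X).
Proof.
move=> t01; have /andP[t0 t1] := t01.
have [C1 [C11 C1P]] := @poly_exp R 12 (1 / 4) 1 (ltac:(lra)).
have [C2 [C21 C2P]] := @poly_exp R (expR 2 * 2) (1 / 80) 1 (ltac:(lra)).
pose C := C1 + C2 + 4 / tau; exists C.
have ti0 : 0 <= 4 / tau by rewrite divr_ge0 // ltW.
set rng := fun _ _ => _.
pose y n p : R := n%:R * expR (- (21 / 20 * (n%:R * p))).
have y0 n p : 0 <= y n p by rewrite mulr_ge0 ?expR_ge0.
pose z0 n p := (Num.truncn (y n p)).+1.
have z0gt n p : y n p < (z0 n p)%:R by have /andP[] := truncn_itv (y0 n p).
have z0le n p : (z0 n p)%:R <= y n p + 1.
  by rewrite /z0 -[_.+1%:R]natr1 lerD2r; have /andP[] := truncn_itv (y0 n p).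
apply: (whp_bound (err := fun n p => 6 * expR (- ((z0 n p)%:R * (n%:R * p / 80))))); last first.
  move=> e e0; have e6 : 0 < e / 6 by lra.
  pose K := 80 * (e / 6)^-1; have K0 : 0 <= K by rewrite mulr_ge0 // invr_ge0 ltW.
  have [N H] := @ultimately_large R rng (K * expR (21 / 20 * K)).
  exists N => n p nN p01 r; have {}H := H n p nN p01 r; have /andP[dC _] : rng n p := r.
  set d := n%:R * p in dC *.
  have d1 : 1 <= d by rewrite /C in dC; lra.
  suff : expR (- ((z0 n p)%:R * (d / 80))) <= e / 6 by lra.
  apply: expRN_small => //.
  have zd : K <= (z0 n p)%:R * d.
    have z1 : 1 <= (z0 n p)%:R :> R by rewrite ler1n.
    case: (lerP K d) => Kd.
      by rewrite -[X in X <= _]mul1r; apply: ler_pM.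
    apply: (@le_trans _ _ (K * 1)); first by rewrite mulr1.
    apply: ler_pM => //; apply: le_trans (ltW (z0gt n p)).
    rewrite /y -/d expRN ler_pdivlMr ?expR_gt0 //; apply: le_trans H.
    rewrite ler_wpM2l // ler_expR; lra.
  by rewrite /K in zd; lra.
exists 1%N => n p n1 p01 r; have [p0 p1] := andP p01; have /andP[dC dl] : rng n p := r.
have n0 : 0 < n%:R :> R by rewrite ltr0n.
have := y0 n p; have := z0gt n p; have := z0le n p; set zz := z0 n p; set yy := y n p.
move=> zle zgt yy0; set d := n%:R * p in dC dl *.
have d1 : 1 <= d by rewrite /C in dC; lra.
have dC1 : C1 <= d by rewrite /C in dC; lra.
have dC2 : C2 <= d by rewrite /C in dC; lra.
have dt : 4 / tau <= d by rewrite /C in dC; lra.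
have b1 := C1P d dC1; have b2 := C2P d dC2; rewrite expr1 in b1 b2.
have q0 : 0 < expR (1 / 4 * d) by apply: expR_gt0.
have ned : expR (1 / 4 * d) * expR (1 / 4 * d) <= n%:R.
  rewrite -expRD -(expR_ln_nat R n1) ler_expR; lra.
have yyle : yy * (expR (1 / 4 * d) * expR (1 / 4 * d)) <= n%:R.
  rewrite /yy /y -/d -mulrA -!expRD -[X in _ <= X]mulr1 ler_wpM2l ?(ltW n0) //.
  rewrite -[X in _ <= X]expR0 ler_expR; lra.
have zbig (z : nat) : (z <= zz + 5)%N -> z%:R * d * expR (1 / 4 * d) <= n%:R.
  move=> zz5; have zR : z%:R <= yy + 6.
    have : z%:R <= zz%:R + 5 :> R by rewrite -natrD ler_nat.
    lra.
  have z0R : 0 <= z%:R :> R by [].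
  apply: (@le_trans _ _ ((yy + 6) * (expR (1 / 4 * d) / 12) * expR (1 / 4 * d))).
    rewrite ler_wpM2r ?(ltW q0) //; apply: ler_pM => //; lra.
  have -> : (yy + 6) * (expR (1 / 4 * d) / 12) * expR (1 / 4 * d) =
    (yy * (expR (1 / 4 * d) * expR (1 / 4 * d))) / 12 + expR (1 / 4 * d) * expR (1 / 4 * d) / 2.
    by field.
  lra.
have pz (z : nat) : (zz <= z <= zz + 5)%N ->
    PrG p (fun E : graph n => exists2 Z : {set 'I_n}, #|Z| = z & rich E (hcut tau n p) Z) <=
    expR (- (zz%:R * (d / 80))).
  move=> /andP[zzz zz5]; have zn := zbig z zz5.
  have zpos : (0 < z)%N by apply: leq_trans zzz.
  have zR : 0 < z%:R :> R by rewrite ltr0n.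
  have zd0 : 0 < z%:R * d by rewrite mulr_gt0 //; lra.
  have nzd : 0 < n%:R / (z%:R * d) by rewrite divr_gt0.
  apply: (@le_trans _ _ (expR (- (z%:R * (d / 80))))); last first.
    rewrite ler_expR lerN2 ler_wpM2r ?ler_nat //; lra.
  apply: (@rich_sets_prob n tau p (ln (n%:R / (z%:R * d)))) => //.
  - exact: hcut_le.
  - have h1 : 1 <= tau * expR (1 / 4 * d).
      have : 1 / 4 * d <= expR (1 / 4 * d) by apply: le_trans (expR_ge1Dx _); lra.
      move/(ler_wpM2l (ltW t0)); apply: le_trans.
      by move: dt; rewrite ler_pdivrMr //; lra.
    have zz0 : 0 <= z%:R :> R by [].
    have h2 : z%:R <= z%:R * d by rewrite -[X in X <= _]mulr1 ler_wpM2l.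
    have h3 : z%:R * d * 1 <= z%:R * d * (tau * expR (1 / 4 * d)) by rewrite ler_wpM2l // ltW.
    have := ler_wpM2l (ltW t0) zn; lra.
  - by rewrite lnK ?posrE // mulfVK ?lt0r_neq0.
  - apply: (@le_trans _ _ zz%:R); first exact: ltW.
    by rewrite ler_nat.
  - rewrite -ler_expR lnK ?posrE // ler_pdivlMr // mulrC.
    by have -> : d / 4 = 1 / 4 * d by field.
  - by have -> : d / 80 = 1 / 80 * d by field.
apply: le_trans (PrG_union (I := 'I_6) (P := xpredT) (B := fun j E =>
   exists2 Z : {set 'I_n}, #|Z| = (zz + j)%N & rich E (hcut tau n p) Z) p01 _) _.
  move=> E EP nc; apply: contrapT => H; apply: nc.
  have Ep e : e \in E -> #|e| = 2 by move/(subsetP EP); rewrite inE => /eqP.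
  have [|Z /andP[Z1 Z5]|X Xz cX] := @clean_exists _ E Ep (hcut tau n p) zz.
  - by [].
  - apply/negP => rZ; apply: H; have jlt : (#|Z| - zz < 6)%N by rewrite ltnS leq_subLR.
    by exists (Ordinal jlt) => //; exists Z => //=; rewrite subnKC.
  exists X => //; have Xt : (#|X| <= Num.truncn yy)%N by rewrite -ltnS.
  apply: (@le_trans _ _ (Num.truncn yy)%:R); first by rewrite ler_nat.
  by have /andP[] := truncn_itv yy0.
rewrite -/zz; have -> : (6 : R) * expR (- (zz%:R * (d / 80))) = \sum_(j < 6) expR (- (zz%:R * (d / 80))).
  by rewrite sumr_const card_ord mulr_natl.
by apply: ler_sum => j _; apply: pz; rewrite leq_addr leq_add2l -ltnS ltn_ord.
Qed.
End CleanWhp.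

(** * The number of leaves *)

Section LeafCount.
Variables (R : realType) (n : nat).
Implicit Types (E : graph n) (u w : 'I_n) (x y : 'I_n * 'I_n).

Definition star u : graph n := pairs_between [set u] (~: [set u]).

Lemma disj_star u : [disjoint [set u] & ~: [set u]].
Proof. by rewrite -setI_eq0 setICr. Qed.

Lemma card_star u : #|star u| = n.-1.
Proof. by rewrite card_pairs_between ?disj_star // cards1 mul1n cardsC1 card_ord. Qed.

Lemma in_star u e : (e \in star u) = (e \in all_pairs n) && (u \in e).
Proof.
apply/idP/andP => [/[dup] eS /imsetP[[u' w]]|[]].
  rewrite in_setX inE => /andP[/= /eqP -> _] ew; split; last by rewrite ew !inE eqxx.
  exact: (subsetP (pairs_between_sub (disj_star u))) eS.
rewrite inE => e2 ue; have [w wu ->] : exists2 w, w != u & e = [set u; w].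
  have : #|e :\ u| == 1%N by move: e2; rewrite (cardsD1 u) ue add1n eqSS.
  case/cards1P => w eD; exists w; last by rewrite -(setD1K ue) eD.
  by have : w \in e :\ u by [rewrite eD inE]; rewrite !inE => /andP[].
by apply/imsetP; exists (u, w) => //; rewrite !inE /= eqxx.
Qed.

(** Here [x.1] is a leaf attached to [x.2]. Ordered pairs are counted instead of vertices because
    the event then prescribes one present edge and a set of absent ones. *)
Definition pendant x E := ([set [set x.1; x.2]] \subset E) &&
  [disjoint star x.1 :\ [set x.1; x.2] & E].

Definition ends2 : {set 'I_n * 'I_n} := [set x | x.1 != x.2].

Lemma card_ends2 : #|ends2| = (n * n.-1)%N.
Proof.
rewrite -sum1dep_card -(pair_big_dep xpredT (fun u w => u != w) (fun _ _ => 1%N)) /=.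
rewrite (eq_bigr (fun=> n.-1)) => [|u _]; first by rewrite sum_nat_const card_ord.
rewrite sum1dep_card -[n in RHS]card_ord -(cardC1 u).
by apply: eq_card => w; rewrite !inE eq_sym.
Qed.

Lemma ends2_star x : x \in ends2 -> [set x.1; x.2] \in star x.1.
Proof. by rewrite inE in_star !inE eqxx cards2 => ->. Qed.

Lemma pendant_only x E e : pendant x E -> e \in E -> e \in star x.1 -> e = [set x.1; x.2].
Proof.
case/andP=> _ dE eE eS; apply/eqP; apply: contraTT eE => ne.
by rewrite (disjointFr dE) // in_setD1 ne.
Qed.

Lemma leaf_count E : E \subset all_pairs n ->
  #|[set v | deg E v == 1%N]| = #|[set x in ends2 | pendant x E]|.
Proof.
move=> EP; have inj : {in [set x in ends2 | pendant x E] &, injective fst}.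
  move=> [u w] [u' w'] /setIdP[x2 xE] /setIdP[y2 yE] /= uu; subst u'.
  have e1 : [set u; w] = [set u; w'].
    by apply: (pendant_only yE) (ends2_star x2); case/andP: xE; rewrite sub1set.
  have : w \in [set u; w'] by rewrite -e1 !inE eqxx orbT.
  by move: x2; rewrite !inE eq_sym /= => /negbTE -> /eqP ->.
rewrite -(card_in_imset inj); apply: eq_card => v; rewrite inE (deg_star _ EP) -/(star v).
apply/cards1P/imsetP => [[e Ee]|[[u w] /setIdP[x2 xE] ->]].
  have : e \in E :&: star v by rewrite Ee inE.
  rewrite in_setI => /andP[eE /[dup] eS /imsetP[[u w]]].
  rewrite in_setX in_setC !in_set1 /= => /andP[/eqP -> wu] ew; exists (v, w) => //.
  apply/setIdP; split; first by rewrite inE /= eq_sym.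
  rewrite /pendant sub1set /= -ew eE /= disjoint_subset; apply/subsetP => f.
  rewrite in_setD1 => /andP[fe fS]; apply/negP => fE.
  have : f \in E :&: star v by rewrite in_setI fE fS.
  by rewrite Ee inE (negbTE fe).
exists [set u; w]; apply/setP => e; rewrite in_setI in_set1; apply/andP/eqP => [[]|->].
  exact: (pendant_only xE).
by split; [case/andP: xE; rewrite sub1set | apply: (ends2_star x2)].
Qed.

Variable p : R.
Hypothesis p01 : 0 <= p <= 1.

Lemma pendant_prob x : x \in ends2 ->
  Pr (all_pairs n) p (pendant x) = p * (1 - p) ^+ (n - 2).
Proof.
move=> x2; have eS := ends2_star x2.
have SP : star x.1 \subset all_pairs n by apply/subsetP => e; rewrite in_star => /andP[].
rewrite /pendant Pr_in_out ?cards1 ?expr1.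
- congr (_ * _ ^+ _); have -> : (n - 2 = n.-1.-1)%N by lia.
  by rewrite -(card_star x.1) (cardsD1 [set x.1; x.2] (star x.1)) eS.
- by rewrite sub1set (subsetP SP).
- by apply: subset_trans SP; apply: subsetDl.
- by rewrite disjoints1 !inE eqxx.
Qed.

(** The reversed pair is excluded because both ends of an isolated edge are leaves. With a common
    centre the event is impossible. Two different stars share at most one pair and two pairs are
    present, which leaves at least [2 (n - 1) - 1 - 2] absent ones. *)
Lemma pendant2_prob x y : x \in ends2 -> y \in ends2 -> y != x -> y != (x.2, x.1) ->
  Pr (all_pairs n) p (fun E => pendant x E && pendant y E) <= p ^+ 2 * (1 - p) ^+ (2 * n - 5).
Proof.
case/andP: p01 => p0 p1; have q0 : 0 <= 1 - p by rewrite subr_ge0.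
have q1 : 1 - p <= 1 by rewrite gerBl.
move=> x2 y2 yx yx'; have xS := ends2_star x2; have yS := ends2_star y2.
have SP u : star u \subset all_pairs n by apply/subsetP => e; rewrite in_star => /andP[].
have exy : [set x.1; x.2] != [set y.1; y.2].
  apply/eqP => ee.
  have : x.2 \in [set y.1; y.2] by rewrite -ee !inE eqxx orbT.
  have : x.1 \in [set y.1; y.2] by rewrite -ee !inE eqxx.
  case: x y x2 y2 yx yx' {xS yS ee} => [u w] [u' w']; rewrite !inE /= !xpair_eqE.
  move=> uw _ yx yx' /orP[/eqP uE|/eqP uE] /orP[/eqP wE|/eqP wE]; subst => //.
  - by rewrite eqxx in uw.
  - by rewrite !eqxx in yx.
  - by rewrite !eqxx in yx'.
  - by rewrite eqxx in uw.
have [xy1|xy1] := eqVneq x.1 y.1.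
  rewrite [X in X <= _](_ : _ = Pr (all_pairs n) p xpred0); last first.
    apply: eq_Ex => E _; congr (_%:R); apply/eqP; rewrite eqb0; apply/negP => /andP[xE yE].
    move/eqP: exy; apply; apply: (pendant_only yE); last by rewrite -xy1.
    by case/andP: xE; rewrite sub1set.
  rewrite /Pr Ex_cst mulr_ge0 ?exprn_ge0 //.
set S := [set [set x.1; x.2]; [set y.1; y.2]].
set U := (star x.1 :|: star y.1) :\: S.
have SU : S \subset star x.1 :|: star y.1.
  by apply/subsetP => e /set2P[] ->; rewrite in_setU ?xS ?yS ?orbT.
have UP : star x.1 :|: star y.1 \subset all_pairs n by rewrite subUset !SP.
apply: (@le_trans _ _ (Pr (all_pairs n) p (fun E => (S \subset E) && [disjoint U & E]))).
  apply: Pr_le => // E _ /andP[xE yE]; apply/andP; split.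
    apply/subsetP => e /set2P[] ->; first by case/andP: xE; rewrite sub1set.
    by case/andP: yE; rewrite sub1set.
  rewrite disjoint_subset; apply/subsetP => e; rewrite in_setD in_set2 in_setU negb_or.
  move=> /andP[/andP[ex ey] /orP[eS|eS]]; apply/negP => eE.
    by rewrite (pendant_only xE eE eS) eqxx in ex.
  by rewrite (pendant_only yE eE eS) eqxx in ey.
rewrite Pr_in_out; [|exact: subset_trans UP|by apply: subset_trans UP; apply: subsetDl|]; last first.
  by rewrite -setI_eq0 /U setIDA setIC -setIDA setDv setI0.
rewrite cards2 exy ler_wpM2l ?exprn_ge0 //.
apply: ler_wiXn2l => //.
have I1 : (#|star x.1 :&: star y.1| <= 1)%N.
  rewrite -(cards1 [set x.1; y.1]); apply/subset_leq_card/subsetP => e.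
  rewrite in_setI !in_star => /andP[/andP[e2 xe] /andP[_ ye]]; rewrite in_set1 eq_sym eqEcard.
  by move: e2; rewrite inE => /eqP ->; rewrite cards2 xy1 subUset !sub1set xe ye.
have := cardsD (star x.1 :|: star y.1) S; rewrite (setIidPr SU) -/U cardsU !card_star cards2 exy.
by move: I1; move: (#|U|) (#|_ :&: _|); clear => a b b1 ->; lia.
Qed.

Let X E : R := #|[set v | deg E v == 1%N]|%:R.
Let m : R := (n * n.-1)%:R * (p * (1 - p) ^+ (n - 2)).

Lemma leaf_sum E : E \subset all_pairs n -> X E = \sum_(x in ends2) (pendant x E)%:R.
Proof.
move=> EP; rewrite /X leaf_count // -sum1dep_card natr_sum big_mkcondr /=.
by apply: eq_bigr => x _; case: (pendant x E).
Qed.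

Lemma leaf_mean : Ex (all_pairs n) p X = m.
Proof.
rewrite (eq_Ex p leaf_sum) Ex_sum (eq_bigr (fun=> p * (1 - p) ^+ (n - 2))).
  by rewrite sumr_const card_ends2 -[LHS]mulr_natl.
by move=> x x2; rewrite -(pendant_prob x2).
Qed.

Lemma leaf_second_moment :
  Ex (all_pairs n) p (fun E => X E ^+ 2) <=
  2 * m + (n * n.-1)%:R ^+ 2 * (p ^+ 2 * (1 - p) ^+ (2 * n - 5)).
Proof.
case/andP: (p01) => p0 p1; set B := p ^+ 2 * _; pose a := p * (1 - p) ^+ (n - 2).
have B0 : 0 <= B by rewrite mulr_ge0 // exprn_ge0 // subr_ge0.
have a0 : 0 <= a by rewrite mulr_ge0 // exprn_ge0 // subr_ge0.
have -> : Ex (all_pairs n) p (fun E => X E ^+ 2) =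
  \sum_(x in ends2) \sum_(y in ends2) Pr (all_pairs n) p (fun E => pendant x E && pendant y E).
  rewrite (@eq_Ex _ _ _ _ _ (fun E => \sum_(x in ends2) \sum_(y in ends2)
    (pendant x E && pendant y E)%:R)); last first.
    move=> E EP; rewrite leaf_sum // expr2 big_distrl /=; apply: eq_bigr => x _.
    by rewrite big_distrr /=; apply: eq_bigr => y _; rewrite -natrM mulnb.
  by rewrite Ex_sum; apply: eq_bigr => x _; rewrite Ex_sum.
have -> : 2 * m + (n * n.-1)%:R ^+ 2 * B = \sum_(x in ends2) (2 * a + (n * n.-1)%:R * B).
  by rewrite sumr_const card_ends2 -[_ *+ _]mulr_natl /m -/a; ring.
apply: ler_sum => x x2.
have one z : \sum_(y in ends2) (if y == z then a else 0) <= a.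
  rewrite -big_mkcondr /=; case: (boolP (z \in ends2)) => z2.
    by rewrite (big_pred1 z) // => y /=; case: eqP => [->|]; rewrite ?z2 ?andbF.
  rewrite big1 // => y /andP[y2 /eqP yz]; by rewrite -yz y2 in z2.
apply: (@le_trans _ _ (\sum_(y in ends2) ((if y == x then a else 0) +
   (if y == (x.2, x.1) then a else 0) + B))).
  apply: ler_sum => y y2.
  have le : Pr (all_pairs n) p (fun E => pendant x E && pendant y E) <= a.
    by rewrite /a -(pendant_prob x2); apply: Pr_le => // E _ /andP[].
  case: eqP => [_|/eqP yx]; first by apply: le_trans le _; case: ifP => _; lra.
  case: eqP => [_|/eqP yx']; first by apply: le_trans le _; lra.
  by rewrite !add0r; apply: pendant2_prob.
rewrite !big_split /= sumr_const card_ends2 -[_ *+ (n * n.-1)]mulr_natl lerD2r.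
by have := one x; have := one (x.2, x.1); lra.
Qed.

(** The power [(1 - p) ^ (2 n - 5)] exceeds the square of [(1 - p) ^ (n - 2)] by the factor
    [1 / (1 - p)]; this correlation is the term [m ^ 2 p / (1 - p)]. *)
Lemma leaf_deviation a : p < 1 -> (2 < n)%N -> 0 < a ->
  PrG p (fun E => a <= `|X E - m|) <= (2 * m + m ^+ 2 * (p / (1 - p))) / a ^+ 2.
Proof.
move=> pl1 n2 a0; apply: le_trans (Pr_chebyshev (a := a) p01 a0 leaf_mean _) _.
  by move=> E _ /asboolP.
rewrite ler_wpM2r ?invr_ge0 ?sqr_ge0 // lerBlDr; apply: le_trans leaf_second_moment _.
rewrite -addrA lerD2l le_eqVlt; apply/orP; left; apply/eqP.
have q0 : 1 - p != 0 by rewrite subr_eq0 eq_sym lt_eqF.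
have -> : m ^+ 2 * (p / (1 - p)) + m ^+ 2 = m ^+ 2 / (1 - p) by field.
have e : (1 - p) ^+ (2 * n - 5) * (1 - p) = ((1 - p) ^+ (n - 2)) ^+ 2.
  by rewrite -exprSr -(exprM _ _ 2); congr (_ ^+ _); lia.
apply: (mulIf q0); rewrite mulfVK // -!mulrA e /m.
move: (_ ^+ (n - 2)) (_%:R) => a1 a2; ring.
Qed.
End LeafCount.

Section LeafWhp.
Variable R : realType.

Lemma leaf_mean_close n (p ka : R) : 0 <= p <= 1 -> (2 < n)%N -> 0 < ka <= 1 / 8 ->
  p <= ka -> n%:R^-1 <= ka -> n%:R * p ^+ 2 <= ka ->
  `|(n * n.-1)%:R * (p * (1 - p) ^+ (n - 2)) - leafM n p| <= 4 * ka * leafM n p.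
Proof.
move=> p01 n2 /andP[k0 k1] pk nk npk; have [p0 p1] := andP p01.
have n0 : 0 < n%:R :> R by rewrite ltr0n; apply: leq_trans n2.
have q0 : 0 < 1 - p by lra.
have M0 := leafM_ge0 n p01; set M := leafM n p in M0 *.
pose e := expR (- (n%:R * p)); have e0 : 0 <= e by apply: expR_ge0.
have ME : M = n%:R ^+ 2 * p * e by [].
have n1E : n.-1%:R = n%:R - 1 :> R by rewrite -subn1 natrB //; apply: leq_trans n2.
have up : (1 - p) ^+ (n - 2) <= e * (1 + 4 * ka).
  apply: le_trans (pow_le_expR _ (ltW q0) (one_sub_le_expR p)) _.
  have -> : (n - 2)%:R * - p = - (n%:R * p) + 2 * p by rewrite natrB ?(ltnW n2) //; ring.
  rewrite expRD ler_wpM2l //; have := expR_ge1Dx (- (2 * p)); rewrite expRN => h.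
  have E0 := expR_gt0 (2 * p); have := ler_wpM2r (ltW E0) h.
  rewrite mulVf ?lt0r_neq0 // => h1.
  have h2 : (1 - 2 * p) * (1 + 4 * p) >= 1 by have : p * p <= p * ka; [rewrite ler_wpM2l|nra].
  have h3 : 0 < 1 - 2 * p by lra.
  rewrite -(ler_pM2l h3); apply: le_trans (_ : 1 <= _); first by lra.
  by apply: le_trans h2 _; rewrite ler_pM2l //; lra.
have low : e * (1 - 2 * ka) <= (1 - p) ^+ (n - 2).
  apply: (@le_trans _ _ ((1 - p) ^+ n)); last by apply: ler_wiXn2l; rewrite ?(ltW q0) ?gerBl ?leq_subr.
  have h1 : expR (- (p / (1 - p))) <= 1 - p.
    rewrite expRN -[X in _ <= X]invrK lef_pV2 ?posrE ?expR_gt0 ?invr_gt0 //.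
    by apply: le_trans (expR_ge1Dx _); rewrite le_eqVlt; apply/orP; left; apply/eqP; field; rewrite lt0r_neq0.
  apply: (@le_trans _ _ (expR (- (p / (1 - p))) ^+ n)); last by apply: lerXn2r; rewrite ?nnegrE ?expR_ge0 ?(ltW q0).
  rewrite -expRM_natl; apply: (@le_trans _ _ (expR (- (n%:R * p) + - (2 * (n%:R * p ^+ 2))))).
    rewrite expRD ler_wpM2l //; have := expR_ge1Dx (- (2 * (n%:R * p ^+ 2))); lra.
  rewrite ler_expR; have h2 : p / (1 - p) <= p + 2 * p ^+ 2.
    rewrite ler_pdivrMr //; have : p ^+ 2 * p <= p ^+ 2 * ka by rewrite ler_wpM2l ?sqr_ge0.
    by have := sqr_ge0 p; nra.
  by have := ler_wpM2l (ltW n0) h2; lra.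
have nn1 : n%:R * n%:R * (1 - ka) <= n%:R * n.-1%:R.
  rewrite -mulrA ler_pM2l // n1E; have := ler_wpM2l (ltW n0) nk; rewrite mulfV ?lt0r_neq0 //; lra.
have nn2 : n%:R * n.-1%:R <= n%:R * n%:R :> R by rewrite ler_pM2l // n1E; lra.
have nn0 : 0 <= n%:R * n.-1%:R :> R by rewrite mulr_ge0.
have mU : n%:R * n.-1%:R * (p * (1 - p) ^+ (n - 2)) <= M * (1 + 4 * ka).
  have -> : M * (1 + 4 * ka) = n%:R * n%:R * (p * (e * (1 + 4 * ka))) by rewrite ME; ring.
  have pq : 0 <= p * (1 - p) ^+ (n - 2) by rewrite mulr_ge0 ?exprn_ge0 ?(ltW q0).
  by apply: ler_pM => //; rewrite ler_wpM2l.
have mL : M * (1 - 3 * ka) <= n%:R * n.-1%:R * (p * (1 - p) ^+ (n - 2)).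
  apply: (@le_trans _ _ (n%:R * n%:R * (1 - ka) * (p * (e * (1 - 2 * ka))))).
    have -> : n%:R * n%:R * (1 - ka) * (p * (e * (1 - 2 * ka))) = M * ((1 - ka) * (1 - 2 * ka)).
      by rewrite ME; ring.
    by rewrite ler_wpM2l //; have := sqr_ge0 ka; nra.
  have a1 : 0 <= n%:R * n%:R * (1 - ka) by rewrite !mulr_ge0 // ?(ltW n0) //; lra.
  have a2 : 0 <= p * (e * (1 - 2 * ka)) by rewrite !mulr_ge0 //; lra.
  by apply: ler_pM => //; rewrite ler_wpM2l.
have kM : 0 <= ka * M by rewrite mulr_ge0 // ltW.
rewrite natrM ler_norml; lra.
Qed.

Lemma whp_leaves (del : R) : 0 < del <= 1 ->
  whp (fun n p => n%:R * p <= 2 * ln n%:R)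
    (fun n p E => `|#|[set v | deg E v == 1%N]|%:R - leafM n p| <=
       del * Num.max (leafM n p) (ln n%:R)).
Proof.
move=> /andP[d0 d1]; set rng := fun _ _ => _; pose ka := del / 8.
have k0 : 0 < ka by rewrite /ka; lra.
have k1 : ka <= 1 / 8 by rewrite /ka; lra.
apply: (whp_bound (err := fun n p => 48 / del ^+ 2 / ln n%:R)); last first.
  move=> e e0; have [N H] := @ultimately_ln R rng (1 + 48 / del ^+ 2 / e).
  exists N => n p nN p01 r; have := H n p nN p01 r => le.
  have x0 : 0 <= 48 / del ^+ 2 / e by rewrite !divr_ge0 ?sqr_ge0 // ltW.
  have l0 : 0 < ln n%:R :> R by lra.
  by rewrite ler_pdivrMr // (mulrC e) -ler_pdivrMr //; lra.
have [C [C1 CP]] := @poly_exp R (4 / ka) 1 2 (ltac:(lra)).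
have [N H] := @ultimately_ln R rng C.
exists (maxn N 3) => n p; rewrite geq_max => /andP[nN n3] p01 r; have {H} lC := H n p nN p01 r.
have [p0 p1] := andP p01; have n0 : 0 < n%:R :> R by rewrite ltr0n; apply: leq_trans n3.
have {}r : n%:R * p <= 2 * ln n%:R := r.
have := CP _ lC; rewrite mul1r expR_ln_nat; last by apply: leq_trans n3.
set l := ln n%:R in lC r *; have l1 : 1 <= l by lra.
move=> lk; have {lk} lk : 4 * l ^+ 2 / n%:R <= ka.
  by rewrite ler_pdivrMr // (mulrC ka) -ler_pdivrMr // mulrAC.
have l2 : l <= l ^+ 2 by rewrite expr2 -[X in X <= _]mulr1 ler_wpM2l //; lra.
have nk : n%:R^-1 <= ka.
  apply: le_trans lk; rewrite -[X in X <= _]mul1r ler_wpM2r ?invr_ge0 ?(ltW n0) //; lra.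
have pl : p * l <= ka.
  apply: le_trans lk; rewrite ler_pdivlMr // mulrC mulrA; have : n%:R * p * l <= 2 * l * l.
    by rewrite ler_wpM2r //; lra.
  by have := sqr_ge0 l; rewrite expr2; lra.
have pk : p <= ka.
  apply: le_trans pl; rewrite -[X in X <= _]mulr1 ler_wpM2l //.
have npk : n%:R * p ^+ 2 <= ka.
  have -> : n%:R * p ^+ 2 = (n%:R * p) ^+ 2 / n%:R by field; rewrite lt0r_neq0.
  apply: le_trans lk; rewrite ler_wpM2r ?invr_ge0 ?(ltW n0) //.
  have np0 : 0 <= n%:R * p by rewrite mulr_ge0.
  have -> : 4 * l ^+ 2 = (2 * l) ^+ 2 by ring.
  by apply: lerXn2r => //; rewrite nnegrE //; lra.
have k01 : 0 < ka <= 1 / 8 by rewrite k0.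
have close := leaf_mean_close p01 n3 k01 pk nk npk.
set m := _ * (p * _) in close; have M0 := leafM_ge0 n p01; set M := leafM n p in close M0 *.
set mx := Num.max M l; have Mmx : M <= mx by rewrite le_max lexx.
have lmx : l <= mx by rewrite le_max lexx orbT.
pose a := del / 2 * mx; have mx0 : 0 < mx by lra.
have a0 : 0 < a by rewrite /a mulr_gt0 //; lra.
have kM : 4 * ka * M <= del / 2 * mx.
  by have -> : 4 * ka = del / 2; [rewrite /ka; field | rewrite ler_wpM2l //; lra].
apply: le_trans (_ : PrG p (fun E : graph n => a <= `|#|[set v | deg E v == 1%N]|%:R - m|) <= _).
  apply: PrG_le => // E _ /negP; rewrite -ltNge => lt.
  have := ler_distD m (#|[set v | deg E v == 1%N]|%:R) M; rewrite /a; lra.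
have pl1 : p < 1 by lra.
apply: le_trans (leaf_deviation p01 pl1 n3 a0) _; rewrite -/m.
have m0 : 0 <= m by rewrite /m !mulr_ge0 ?exprn_ge0 //; lra.
have m2 : m <= 2 * M.
  have := le_trans (ler_norm _) close; have : 4 * ka * M <= 1 * M by rewrite ler_wpM2r //; lra.
  lra.
have q0 : 0 < 1 - p by lra.
have p2 : p / (1 - p) <= 2 * p.
  by rewrite ler_pdivrMr //; have : p * p <= p * ka; [rewrite ler_wpM2l|nra].
have b1 : m ^+ 2 * (p / (1 - p)) <= 8 * M ^+ 2 * p.
  have -> : 8 * M ^+ 2 * p = (2 * M) ^+ 2 * (2 * p) by ring.
  apply: ler_pM => //; rewrite ?sqr_ge0 ?divr_ge0 ?(ltW q0) //.
  by apply: lerXn2r => //; rewrite nnegrE //; lra.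
have a2 : 0 < a ^+ 2 by rewrite exprn_gt0.
rewrite ler_pdivrMr //.
have -> : 48 / del ^+ 2 / l * a ^+ 2 = 12 * (mx ^+ 2 / l).
  by rewrite /a; field; rewrite !lt0r_neq0 //; lra.
have lg0 : 0 < l by lra.
have c1 : M <= mx ^+ 2 / l.
  rewrite ler_pdivlMr // expr2; apply: ler_pM => //; lra.
have c2 : M ^+ 2 * p <= mx ^+ 2 / l.
  rewrite ler_pdivlMr // -mulrA -[X in _ <= X]mulr1; apply: ler_pM; rewrite ?sqr_ge0 //.
  - by rewrite mulr_ge0 //; lra.
  - by apply: lerXn2r => //; rewrite nnegrE //; lra.
  - by apply: le_trans pl _; lra.
lra.
Qed.
End LeafWhp.

(** * The three ranges of the edge probability *)

Section UpperBounds.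
Local Open Scope nat_scope.

Definition hostable (V : finType) (E : {set {set V}}) q := exists K K1 a,
  [/\ booster_rich E K, has_connector E K1 a, locally_sparse E a q,
      K1 + (18 * q + 1) * #|V| <= K & 12 * a <= #|V|].

(** This is [54 ^ (20 q) <= 64 ^ (20 q)]: with [60 q] independent coins per neighbourhood a margin
    of [4 ^ q] is left for the local lemma. *)
Lemma coin_margin q : 4 ^ q * 2 ^ (18 * q) * 3 ^ (60 * q) <= 4 ^ (60 * q).
Proof.
have -> : 4 ^ q = 2 ^ (2 * q) by rewrite expnM.
rewrite -expnD (_ : 60 * q = 3 * (20 * q)); last by rewrite mulnA.
rewrite (_ : 2 * q + 18 * q = 20 * q); last by rewrite -mulnDl.
by case: (20 * q) => [//|k]; rewrite !expnM -expnMn leq_exp2r.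
Qed.

Section Sizes.
Variables (R : realType) (V : finType) (E : {set {set V}}).
Hypothesis Epairs : forall e, e \in E -> #|e| = 2.
Variables (q h : nat) (X : {set V}).
Hypotheses (cleanX : clean E h X) (hq : 200 * q <= h) (q0 : 0 < q) (V30 : 30 <= #|V|).
Hypothesis low_small : 10 * h.+1 * #|lowset E h| <= #|V|.
Hypothesis X_small : 10 * #|X| <= #|V|.

Lemma bulk_large : 2 * #|V| + 3 <= 3 * #|bulk E h X|.
Proof.
have c := cardsC (X :|: lowset E h); rewrite -/(bulk E h X) in c.
have u := (leq_card_setU X (lowset E h)).1.
have s : #|lowset E h| <= h.+1 * #|lowset E h| by rewrite leq_pmull.
move: c u s low_small X_small V30; rewrite -mulnA; clear.
move: (#|X|) (#|V|) (#|lowset E h|) (h.+1 * _) (#|X :|: _|) (#|bulk _ _ _|).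
move=> a b c d e f; lia.
Qed.

Lemma lows_nb_small : #|lows_nb E h X| <= h * #|lowset E h|.
Proof.
apply: (@leq_trans (h * #|lows E h X|)).
  by apply: leq_card_bigcup => v; rewrite in_setD inE => /andP[].
by rewrite leq_mul2l subset_leq_card ?orbT // subsetDl.
Qed.

Lemma ample_unattached : ample E q h X (unattached E h X).
Proof.
split; first exact: subsetDl.
  have := bulk_large; have := cardsID (lows_nb E h X) (bulk E h X); rewrite -/(unattached E h X).
  have := subset_leq_card (subsetIr (bulk E h X) (lows_nb E h X)).
  have s : h * #|lowset E h| <= h.+1 * #|lowset E h| by rewrite leq_mul2r leqnSn orbT.
  move: s lows_nb_small low_small V30; rewrite -mulnA; clear.
  move: (#|V|) (h.+1 * _) (h * _) (#|lows_nb E h X|) (#|unattached E h X|) (#|bulk E h X|).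
  by move: (#|bulk E h X :&: _|) => a b c d e f g; lia.
move=> u ub; apply: leq_trans (unattached_nb Epairs cleanX ub).
by move: hq q0; clear; lia.
Qed.

Lemma ample_bulk : ample E q h X (bulk E h X).
Proof.
have [_ c d] := ample_unattached; split=> //.
  by apply: leq_trans c _; rewrite leq_mul2l subset_leq_card // subsetDl.
by move=> u ub; apply: leq_trans (d u ub) _; rewrite subset_leq_card // setIS // subsetDl.
Qed.
End Sizes.

Section Spectrum.
Variables (R : realType) (n : nat) (E : {set {set 'I_n}}).
Hypothesis Epairs : forall e, e \in E -> #|e| = 2.
Variables (q h De : nat) (X : {set 'I_n}).
Hypotheses (hostE : hostable E q) (cleanX : clean E h X).
Hypothesis maxdeg : forall u, deg E u <= De.
Hypotheses (hq : 200 * q <= h) (q0 : 0 < q) (n30 : 30 <= n).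
Hypothesis low_small : 10 * h.+1 * #|lowset E h| <= n.
Hypothesis X_small : 10 * #|X| <= n.

Let V30 : 30 <= #|'I_n|. Proof. by rewrite card_ord. Qed.
Let low_small' : 10 * h.+1 * #|lowset E h| <= #|'I_n|. Proof. by rewrite card_ord. Qed.
Let X_small' : 10 * #|X| <= #|'I_n|. Proof. by rewrite card_ord. Qed.

Let leaf_number := #|[set v | deg E v == 1]|.

Lemma sp_le_family (FF : seq {set 'I_n}) k :
  (forall F, F \in FF -> ample E q h X F /\ lows_nb E h X \subset F) ->
  (forall u v, u \in unattached E h X -> v \in unattached E h X -> u != v ->
     separates FF u v) ->
  h.+1 * #|lowset E h| <= 2 ^ k ->
  sp E <= #|X| + #|lowset E 0| + maxn (size FF) (2 * (leaf_number %/ 3)) + k + k + 5.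
Proof.
move=> FFa FFs lk; have [K [K1 [a [bE cE lE KK a12]]]] := hostE.
have l1 : #|lows E h X| <= 2 ^ k.
  apply: leq_trans lk; apply: leq_trans (subset_leq_card (subsetDl _ _)) _.
  by rewrite leq_pmull.
have l2 : #|lows_nb E h X| <= 2 ^ k.
  apply: leq_trans lk; apply: leq_trans (lows_nb_small E h X) _.
  by rewrite leq_mul2r leqnSn orbT.
have [Ws [tr sep sz]] := separating_family Epairs bE cE lE q0 KK a12 V30 cleanX FFa FFs
  (ample_bulk Epairs cleanX hq q0 V30 low_small' X_small')
  (ample_unattached Epairs cleanX hq q0 V30 low_small' X_small')
  (lows_nb_bulk Epairs cleanX) l1 l2.
apply: leq_trans (sp_le tr sep) (leq_trans sz _); rewrite !leq_add2r.
apply: leq_add; last first.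
  rewrite geq_max leq_maxl /=; apply: leq_trans (leq_maxr _ _).
  rewrite leq_mul2l leq_div2r // subset_leq_card //.
  by apply/subsetP => v /setIdP[_ d1]; rewrite inE.
rewrite leq_add2l subset_leq_card //.
by apply/subsetP => v /setIdP[_ d1]; rewrite inE leqn0.
Qed.

Lemma sp_le_color k : n <= 2 ^ k ->
  sp E <= #|X| + #|lowset E 0| + maxn ((De ^ 2).+1 * k.+1) (2 * (leaf_number %/ 3)) + k + k + 5.
Proof.
move=> nk; have [||||FF [sz FFa FFs]] := color_family Epairs cleanX maxdeg (k := k) (q := q).
- by move: hq q0; clear; lia.
- by move: hq q0; clear; lia.
- by rewrite card_ord.
- exact: bulk_large low_small' X_small'.
apply: leq_trans (sp_le_family FFa FFs (k := k) _) _.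
  by apply: leq_trans nk; apply: leq_trans low_small; rewrite -mulnA leq_pmull.
rewrite !leq_add2r leq_add2l geq_max leq_maxr andbT; exact: leq_trans sz (leq_maxl _ _).
Qed.

Lemma coins k : 0 < k -> n <= 2 ^ k -> 8 * De ^ 2 * k <= 4 ^ q -> 0 < De ->
  exists FF : seq {set 'I_n}, [/\ size FF = k,
    forall F, F \in FF -> ample E q h X F /\ lows_nb E h X \subset F &
    forall u v, u \in unattached E h X -> v \in unattached E h X -> u != v ->
      separates FF u v].
Proof.
move=> k0 nk Dk De0; apply: (coin_family R Epairs cleanX maxdeg (m := 60 * q)) => //.
- by apply: leq_trans nk; rewrite -[X in _ <= X]card_ord; apply: max_card.
- apply: (@leq_trans (4 ^ q * 2 ^ (18 * q) * 3 ^ (60 * q))); first by rewrite !leq_mul2r Dk !orbT.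
  exact: coin_margin.
- by move: hq q0; clear; lia.
- exact: bulk_large low_small' X_small'.
Qed.

Lemma sp_le_coins k k' : 0 < k -> n <= 2 ^ k -> 8 * De ^ 2 * k <= 4 ^ q -> 0 < De ->
  h.+1 * #|lowset E h| <= 2 ^ k' ->
  sp E <= #|X| + #|lowset E 0| + maxn k (2 * (leaf_number %/ 3)) + k' + k' + 5.
Proof.
move=> k0 nk Dk De0 lk; have [FF [sz FFa FFs]] := coins k0 nk Dk De0.
by rewrite -{1}sz; apply: sp_le_family.
Qed.

Lemma sp_le_dense k : 0 < k -> n <= 2 ^ k -> 8 * De ^ 2 * k <= 4 ^ q -> 0 < De ->
  X = set0 -> lowset E h = set0 -> sp E <= k.
Proof.
move=> k0 nk Dk De0 X0 low0; have [FF [<- FFa FFs]] := coins k0 nk Dk De0.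
have [K [K1 [a [bE cE lE KK a12]]]] := hostE.
have allun u : u \in unattached E h X.
  rewrite in_setD in_setC in_setU X0 low0 !inE andbT; apply/bigcupP => -[v].
  by rewrite in_setD low0 !inE andbF.
apply: sp_le => [W /FFa[aW _]|u v]; last exact: FFs.
have := traceable_ample Epairs bE cE lE q0 KK a12 V30 cleanX aW (sub0set _).
by rewrite setU0; apply; left.
Qed.
End Spectrum.

Lemma sp_mono n (E E' : {set {set 'I_n}}) : E \subset E' -> sp E' <= sp E.
Proof.
move=> EE; rewrite /sp; case: ex_minnP => m' _; apply; case: ex_minnP => m /asboolP[F [sF pF mF]] _.
apply/asboolP; exists F; split=> //; apply: sub_all pF => -[//|x s] /= /andP[-> ps] /=.
by apply: sub_path ps => u v; apply: (subsetP EE).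
Qed.
End UpperBounds.

(** * Typical graphs satisfy the conditions on hosts *)

Section Standard.
Variable R : realType.

(** The divisor 200 ensures [200 q <= h], enough for [18 q] neighbours in a path set and for the
    [120 q] unattached neighbours that provide [60 q] distinct coins. *)
Definition qcut (tau : R) n (p : R) : nat := Num.truncn (tau ^+ 2 / 200 * (n%:R * p)).

Lemma qcut_le tau n p : 0 <= p <= 1 -> (qcut tau n p)%:R <= tau ^+ 2 / 200 * (n%:R * p) :> R.
Proof.
move=> /andP[p0 _].
have t0 : 0 <= tau ^+ 2 / 200 * (n%:R * p) by rewrite mulr_ge0 ?divr_ge0 ?sqr_ge0 // mulr_ge0.
by have /andP[] := truncn_itv t0.
Qed.

Lemma qcut_gt tau n p : 0 <= p <= 1 -> tau ^+ 2 / 200 * (n%:R * p) < (qcut tau n p)%:R + 1 :> R.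
Proof.
move=> /andP[p0 _].
have t0 : 0 <= tau ^+ 2 / 200 * (n%:R * p) by rewrite mulr_ge0 ?divr_ge0 ?sqr_ge0 // mulr_ge0.
by rewrite natr1; have /andP[] := truncn_itv t0.
Qed.

Lemma truncn_leR (x : R) : 0 <= x -> (Num.truncn x)%:R <= x.
Proof. by move/truncn_itv/andP => []. Qed.

Lemma whp_hostable (tau : R) : 0 < tau <= 1 / 100 -> exists C : R,
  whp (fun n p => C <= n%:R * p) (fun n p E => hostable E (qcut tau n p)).
Proof.
move=> /andP[t0 t1]; have t2 : 0 < tau ^+ 2 by rewrite exprn_gt0.
have t2l : tau ^+ 2 <= 1 / (100 * 100).
  rewrite expr2; have -> : 1 / (100 * 100) = 1 / 100 * (1 / 100) :> R by field.
  by apply: ler_pM => //; apply: ltW.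
pose eta := tau ^+ 2 / 200; have e0 : 0 < eta by rewrite /eta divr_gt0.
have e1 : eta <= 1 by rewrite /eta; lra.
pose b := expR 1 ^+ 3 / eta ^+ 2.
have b0 : 0 < b by rewrite /b divr_gt0 ?exprn_gt0 ?expR_gt0.
have bi : 0 < (36 * b)^-1 by rewrite invr_gt0 mulr_gt0.
(* The value [1 / 12] is for [12 * a <= n] in the host criterion, the other one for [whp_sparse]. *)
pose al := Num.min (1 / 12) (36 * b)^-1.
have al0 : 0 < al by rewrite /al lt_min bi andbT; lra.
have al12 : al <= 1 / 12 by rewrite ge_min lexx.
have alb : 36 * b * al <= 1.
  have b36 : 0 < 36 * b by rewrite mulr_gt0.
  by rewrite mulrC -ler_pdivlMr // mul1r ge_min lexx orbT.
have [C1 W1] := whp_connector al0.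
have e01 : 0 < eta <= 1 by rewrite e0.
have W2 := whp_sparse e01 al0 alb; have W3 := @whp_booster_rich R.
have i0 : 0 <= 2 / eta by rewrite divr_ge0 // ltW.
pose C := `|C1| + 2 / eta + 100 * 100 * 10.
have n1 := ler_norm C1; have n0 := normr_ge0 C1.
exists C; have W := whp_and (A := fun n p E => _) (whp_and
  (whp_weaken (rng' := fun n p => C <= n%:R * p) W1 _ _)
  (whp_weaken (rng' := fun n p => C <= n%:R * p) W2 _ _))
  (whp_weaken (rng' := fun n p => C <= n%:R * p) W3 _ _).
apply: whp_weaken (W _ _ _ _ _ _ _ _ _) _ _.
- exists 0%N => n p _ _; rewrite /C => d; clear -d n1 n0 i0; lra.
- by exists 0%N => n p _ _ _ E _; apply.
- exists 0%N => n p _ _; rewrite /C => d; rewrite -[eta * _]mulrC -ler_pdivrMr //; clear -d n0; lra.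
- by exists 0%N => n p _ _ _ E _; apply.
- exists 0%N => n p _ _; rewrite /C => d.
  have : (1800 : R) <= 100 * 100 * 10 by clear; lra.
  clear -d n0 i0; lra.
- by exists 0%N => n p _ _ _ E _; apply.
- by exists 0%N.
exists 0%N => n p _ p01 dC E EP [[c s] bo].
eexists; eexists; eexists; split; [exact: bo | exact: c | exact: s | |]; last first.
  rewrite card_ord -(ler_nat R) natrM.
  have := @truncn_leR (al * n%:R) (mulr_ge0 (ltW al0) (ler0n _ _)).
  by have := ler_wpM2r (ler0n R n) al12; clear; lra.
(* The budget [K] is about [n d / 10000]. The connector uses half of it, the [18 q] edges per vertex
   less than a tenth, and the boosters, at most one per vertex, a tenth because [d >= 100000]. *)
have dge : 100 * 100 * 10 <= n%:R * p by rewrite /C in dC; clear -dC n0 i0; lra.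
have qle := qcut_le tau n p01; rewrite -/(qcut tau n p); move: qle.
set d := n%:R * p in dge *; set q := qcut tau n p => qle.
have nr : 0 <= n%:R :> R by [].
have D0 : 0 <= n%:R * d by rewrite mulr_ge0 //; apply: le_trans dge; clear; lra.
have k1 : (Num.truncn (n%:R * d / (20 * 100 * 10)))%:R <= n%:R * d / (20 * 100 * 10).
  by apply: truncn_leR; rewrite divr_ge0 // !mulr_ge0.
have /truncn_itv/andP[_] : 0 <= n%:R * d / (100 * 100) by rewrite divr_ge0 // !mulr_ge0.
set K := Num.truncn _; set K1 := Num.truncn _ in k1 *; rewrite -[K.+1%:R]natr1 => Kg.
rewrite -ltnS -(ltr_nat R) -[K.+1%:R]natr1 card_ord natrD (natrM _ _ n) (natrD _ _ 1) natrM.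
have h1 : q%:R * n%:R <= 1 / (100 * 100) / 200 * (n%:R * d).
  apply: le_trans (ler_wpM2r nr qle) _.
  have -> : tau ^+ 2 / 200 * d * n%:R = tau ^+ 2 * (n%:R * d / 200) by ring.
  have -> : 1 / (100 * 100) / 200 * (n%:R * d) = 1 / (100 * 100) * (n%:R * d / 200) by ring.
  by rewrite ler_wpM2r // divr_ge0.
have h2 : n%:R * (100 * 100 * 10) <= n%:R * d by rewrite ler_wpM2l.
set nd := n%:R * d in h1 h2 k1 Kg *.
clear -h1 h2 k1 Kg nr; lra.
Qed.
End Standard.

(** * Logarithms to base 2 and the properties shared by all ranges *)

Section Numerics.
Variable R : realType.

Lemma ln2_ge_half : 1 / 2 <= ln 2 :> R.
Proof. by rewrite -ler_expR lnK ?posrE //; apply: expR_half_le2. Qed.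

Lemma ln2_le1 : ln 2 <= 1 :> R.
Proof. by rewrite -ler_expR lnK ?posrE //; apply: le_trans (expR_ge1Dx 1); lra. Qed.

Lemma ln_pow2 k : ln (2 ^ k)%:R = k%:R * ln 2 :> R.
Proof. by rewrite natrX lnXn // mulr_natl. Qed.

Lemma up_log_le (m : nat) : (0 < m)%N -> (up_log 2 m)%:R <= ln m%:R / ln 2 + 1 :> R.
Proof.
move=> m0; have l2 := ln2_ge_half; have l20 : 0 < ln 2 :> R by lra.
case: (leqP m 1) => [m1|m1].
  have -> : m = 1%N by apply/eqP; rewrite eqn_leq m1.
  by rewrite up_log1 ln1 mul0r add0r.
have : ln (2 ^ (up_log 2 m).-1)%:R <= ln m%:R :> R.
  by rewrite ler_ln ?posrE ?ltr0n ?expn_gt0 // ler_nat; apply/ltnW/up_log_gtn.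
rewrite ln_pow2 -ler_pdivlMr // => h.
have := up_log_gt0 2 m; rewrite m1 /= => k0; rewrite -(prednK k0) -[X in X <= _]natr1; lra.
Qed.

Lemma ln_le_pow (m k : nat) : (0 < m)%N -> (m <= 2 ^ k)%N -> ln m%:R / ln 2 <= k%:R :> R.
Proof.
move=> m0; have l2 := ln2_ge_half; have l20 : 0 < ln 2 :> R by lra.
by move=> mk; rewrite ler_pdivrMr // -ln_pow2 ler_ln ?posrE ?ltr0n ?expn_gt0 // ler_nat.
Qed.

Lemma ceil_log2 (m : nat) : (1 < m)%N -> Num.ceil (ln (m%:R : R) / ln 2) = (up_log 2 m)%:Z.
Proof.
move=> m1; have l2 := ln2_ge_half; have l20 : 0 < ln 2 :> R by lra.
have m0 := ltnW m1; apply: ceil_def; rewrite ln_le_pow ?up_logP // andbT.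
have := up_log_gt0 2 m; rewrite m1 /= => k0.
have : ln (2 ^ (up_log 2 m).-1)%:R < ln m%:R :> R.
  by rewrite ltr_ln ?posrE ?ltr0n ?expn_gt0 // ltr_nat; apply: up_log_gtn.
rewrite ln_pow2 -ltr_pdivlMr //.
by apply: le_lt_trans; rewrite -{1}(prednK k0) -[(up_log _ _).-1.+1]addn1 PoszD addrK.
Qed.

(** As [q] is at least of order [ln n], the right side is at least a power of [n], while the left
    side is of order [(ln n) ^ 3]. *)
Lemma coin_room (c : R) : 0 < c -> exists L : R, 1 <= L /\
  forall (n q : nat), (0 < n)%N -> L <= ln n%:R -> c * ln n%:R <= q%:R + 1 ->
    (8 * Num.truncn (8 * ln n%:R : R) ^ 2 * up_log 2 n <= 4 ^ q)%N.
Proof.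
move=> c0; have [L [L1 LP]] := @poly_exp R (8 * 64 * 3 * expR 1) c 3 c0.
exists L; split=> // n q n0 lL cq; set l := ln n%:R in lL cq *.
have l1 : 1 <= l by lra.
have l2 := ln2_ge_half; have l20 : 0 < ln 2 :> R by lra.
have t8 : (Num.truncn (8 * l))%:R <= 8 * l by apply: truncn_leR; rewrite mulr_ge0 //; lra.
have ul : (up_log 2 n)%:R <= 3 * l.
  apply: le_trans (up_log_le n0) _; rewrite -/l.
  have : l / ln 2 <= 2 * l by rewrite ler_pdivrMr // -mulrA; have := @ler_wpM2l R l (ltac:(lra)) _ _ l2; lra.
  lra.
rewrite -(ler_nat R) !natrM !natrX.
apply: (@le_trans _ _ (8 * (8 * l) ^+ 2 * (3 * l))).
  have t0 : 0 <= (Num.truncn (8 * l))%:R :> R by [].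
  have l8 : 0 <= 8 * l by rewrite mulr_ge0 //; lra.
  rewrite -expr2; apply: ler_pM => //; first by rewrite mulr_ge0 ?exprn_ge0.
  by rewrite ler_wpM2l // lerXn2r // nnegrE.
have -> : 8 * (8 * l) ^+ 2 * (3 * l) = 8 * 64 * 3 * l ^+ 3 by ring.
apply: (@le_trans _ _ (expR (c * l - 1))).
  rewrite expRD expRN ler_pdivlMr ?expR_gt0 // mulrAC; exact: LP.
apply: (@le_trans _ _ (expR (q%:R * 1))); first by rewrite ler_expR; lra.
rewrite expRM_natl; apply: lerXn2r; rewrite ?nnegrE ?expR_ge0 //.
have -> : expR 1 = expR (1 / 2) ^+ 2 :> R by rewrite -expRM_natl; congr expR; field.
have -> : 4 = 2 ^+ 2 :> R by ring.
by apply: lerXn2r; rewrite ?nnegrE ?expR_ge0 // expR_half_le2.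
Qed.

Definition standard (tau : R) n (p : R) (E : graph n) (X : {set 'I_n}) :=
  [/\ clean E (hcut tau n p) X, hostable E (qcut tau n p),
      forall u, (deg E u <= Num.truncn (8 * ln n%:R : R))%N,
      (10 * (hcut tau n p).+1 * #|lowset E (hcut tau n p)| <= n)%N &
      #|X|%:R <= n%:R * expR (- (21 / 20 * (n%:R * p)))].

Lemma whp_standard (tau : R) : 0 < tau <= 1 / 100 -> exists C : R,
  whp (fun n p => C <= n%:R * p <= 2 * ln n%:R)
    (fun n p E => exists X, standard tau p E X).
Proof.
move=> t01; have [C1 W1] := whp_clean t01; have [C2 W2] := whp_hostable t01.
have t10 : 0 < tau <= 1 / 10 by lra.
have [C3 W3] := whp_lows_few t10; have W4 := @whp_maxdeg R.
exists (`|C1| + `|C2| + `|C3|).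
have := ler_norm C1; have := ler_norm C2; have := ler_norm C3.
have := normr_ge0 C1; have := normr_ge0 C2; have := normr_ge0 C3 => b3 b2 b1 a3 a2 a1.
apply: (whp_weaken (whp_and (whp_and
  (whp_weaken (rng' := fun n p => `|C1| + `|C2| + `|C3| <= n%:R * p <= 2 * ln n%:R) W1 _ _)
  (whp_weaken W2 _ _)) (whp_and (whp_weaken W3 _ _) (whp_weaken W4 _ _)))).
- by exists 0%N => n p _ _ /andP[]; lra.
- by exists 0%N => n p _ _ _ E _; apply.
- by exists 0%N => n p _ _ /andP[]; lra.
- by exists 0%N => n p _ _ _ E _; apply.
- by exists 0%N => n p _ _ /andP[]; lra.
- by exists 0%N => n p _ _ _ E _; apply.
- by exists 0%N => n p _ _ /andP[].
- by exists 0%N => n p _ _ _ E _; apply.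
- by exists 0%N.
by exists 0%N => n p _ _ _ E _ [[[X Xs cX] hE] [lE dE]]; exists X.
Qed.

Lemma standard_numerics (tau : R) : 0 < tau -> exists C : R,
  ultimately (fun n p => C <= n%:R * p) (fun n p =>
    [/\ (0 < qcut tau n p)%N, (200 * qcut tau n p <= hcut tau n p)%N, (30 <= n)%N &
        10 * (n%:R * expR (- (21 / 20 * (n%:R * p)))) <= n%:R]).
Proof.
move=> t0; have t2 : 0 < tau ^+ 2 by rewrite exprn_gt0.
have i0 : 0 <= 200 / tau ^+ 2 by rewrite divr_ge0 // ltW.
exists (200 / tau ^+ 2 + 10); exists 30%N => n p n30 p01 dC.
have := hcut_gt tau n p01; have := qcut_le tau n p01.
set d := n%:R * p in dC *; set q := qcut tau n p; set h := hcut tau n p => qd hd.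
split=> //.
- rewrite /q /qcut truncn_gt0 -/d; have : 200 / tau ^+ 2 <= d by lra.
  by rewrite ler_pdivrMr //; lra.
- rewrite -ltnS -(ltr_nat R) -[h.+1%:R]natr1 natrM; lra.
have n0 : 0 <= n%:R :> R by [].
rewrite mulrCA -[X in _ <= X]mulr1 ler_wpM2l //.
rewrite expRN ler_pdivrMr ?expR_gt0 // mul1r; apply: le_trans (expR_ge1Dx _); lra.
Qed.
End Numerics.

(** * The sparse range *)

Section Regimes.
Variable R : realType.

Lemma whp_sub (rng rng' : nat -> R -> Prop) A : whp rng A ->
  ultimately rng' (fun n p => rng n p) -> whp rng' A.
Proof. by move=> wA sub; apply: whp_weaken wA sub _; exists 0%N => n p _ _ _ E _. Qed.

(** The family obtained by colouring has order [(ln n) ^ 3] members and so is negligible against the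
    leaves in this range. *)
Lemma leafM_large (eps A : R) : 0 < eps ->
  ultimately (fun n p => 1 <= n%:R * p <= (1 - eps) * ln n%:R)
    (fun n p => A * ln n%:R ^+ 3 <= leafM n p).
Proof.
move=> e0; have [C [C1 CP]] := @poly_exp R A eps 3 e0.
have [N H] := @ultimately_ln R (fun n p => 1 <= n%:R * p <= (1 - eps) * ln n%:R) C.
exists (maxn N 1) => n p; rewrite geq_max => /andP[nN n1] p01 r; have lC := H n p nN p01 r.
have /andP[d1 d2] := r; apply: le_trans (CP _ lC) _.
have -> : leafM n p = n%:R * p * (n%:R * expR (- (n%:R * p))) by rewrite /leafM; ring.
rewrite -[X in X <= _]mul1r; apply: ler_pM; rewrite ?expR_ge0 //.
by rewrite -{2}(expR_ln_nat R n1) -expRD ler_expR; lra.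
Qed.

Lemma up_log_le3 n : (0 < n)%N -> 1 <= ln n%:R :> R -> (up_log 2 n)%:R <= 3 * ln n%:R :> R.
Proof.
move=> n0 l1; apply: le_trans (up_log_le R n0) _; have l2 := ln2_ge_half R.
have l20 : 0 < ln 2 :> R by lra.
have l0 : 0 <= ln n%:R :> R by lra.
have : ln n%:R / ln 2 <= 2 * ln n%:R :> R.
  by rewrite ler_pdivrMr // -mulrA; have := ler_wpM2l l0 l2; lra.
lra.
Qed.

Lemma third_le (L : nat) : (2 * (L %/ 3))%:R <= 2 / 3 * L%:R :> R.
Proof.
have : (3 * (L %/ 3))%:R <= L%:R :> R by rewrite ler_nat mulnC leq_divM.
by rewrite !natrM; lra.
Qed.

Lemma leaf_lower n (E : graph n) : E \subset all_pairs n ->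
  2 / 3 * #|[set v | deg E v == 1%N]|%:R <= (sp E)%:R + 1 :> R.
Proof.
move=> EP; have Ep e : e \in E -> #|e| = 2%N by move/(subsetP EP); rewrite inE => /eqP.
have := sp_lower_leaves Ep; rewrite -(ler_nat R) natrD !natrM; lra.
Qed.

Lemma whp_sparse_regime (eps del : R) : 0 < eps <= 1 -> 0 < del <= 1 -> exists C : R,
  whp (fun n p => C <= n%:R * p <= (1 - eps) * ln n%:R)
    (fun n p E => (2 / 3 - del) * leafM n p <= (sp E)%:R <= (2 / 3 + del) * leafM n p).
Proof.
move=> /andP[e0 e1] /andP[d0 d1]; pose del1 := del / 8.
have del0 : 0 < del1 by rewrite /del1; lra.
have del01 : 0 < del1 <= 1 by rewrite /del1; lra.
pose tau : R := 1 / 100; have t01 : 0 < tau <= 1 / 100 by rewrite /tau; lra.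
have t0 : 0 < tau by case/andP: t01.
have [C1 W1] := whp_standard t01; have [C2 W2] := whp_isolated del01.
have W3 := whp_leaves del01; have [C3 U3] := standard_numerics t0.
pose C := `|C1| + `|C2| + `|C3| + 20 / del1 + 1; exists C.
have a1 := ler_norm C1; have a2 := ler_norm C2; have a3 := ler_norm C3.
have b1 := normr_ge0 C1; have b2 := normr_ge0 C2; have b3 := normr_ge0 C3.
have b4 : 0 <= 20 / del1 by rewrite divr_ge0 // ltW.
set rng := fun _ _ => _.
have lnpos n : (0 < n)%N -> 0 <= ln n%:R :> R by move=> n0; rewrite ln_ge0 // ler1n.
have sub n p : (0 < n)%N -> rng n p -> [/\ C1 <= n%:R * p, C2 <= n%:R * p, C3 <= n%:R * p,
    20 / del1 <= n%:R * p & 1 <= n%:R * p] /\ n%:R * p <= 2 * ln n%:R.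
  move=> n0 /andP[c1 c2]; have l0 := lnpos n n0; have el := mulr_ge0 (ltW e0) l0.
  by rewrite /C in c1; clear -c1 c2 el l0 a1 a2 a3 b1 b2 b3 b4; split; [split|]; lra.
(* The overhead is [192 + 64 + 3 + 1] from the colouring family, [6] from two codes of length at
   most [3 ln n], and [5]: in total [271] times [(ln n) ^ 3]. *)
have U4 := leafM_large (271 / del1) e0.
have [N4 {}U4] := U4; have [N3 {}U3] := U3; have [N5 U5] := @ultimately_ln R rng 1.
apply: (whp_weaken (whp_and (whp_and (whp_sub (rng' := rng) W1 _) (whp_sub W2 _)) (whp_sub W3 _))).
- by exists 1%N => n p n0 _ /(sub n p n0)[[? ? ? ? ?] ?]; apply/andP.
- by exists 1%N => n p n0 _ /(sub n p n0)[[? ? ? ? ?] ?]; apply/andP.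
- by exists 1%N => n p n0 _ /(sub n p n0)[].
- by exists 0%N.
exists (maxn (maxn N4 N3) (maxn N5 1)) => n p; rewrite !geq_max => /andP[/andP[n4 n3] /andP[n5 n0]] p01 r E EP.
move=> [[[X [cX hE dE lE Xs]] iE] LE].
have [[c1 c2 c3 c4 c5] cl] := sub n p n0 r; have /andP[_ dle] : rng n p := r.
have {}U3 := U3 n p n3 p01 c3; have [q0 hq n30 xn] := U3.
have l1 := U5 n p n5 p01 r.
have {}U4 : 271 / del1 * ln n%:R ^+ 3 <= leafM n p by apply: U4 => //; rewrite c5.
have Ep e : e \in E -> #|e| = 2%N by move/(subsetP EP); rewrite inE => /eqP.
set l := ln n%:R in l1 dE iE LE U4 dle; set M := leafM n p in iE LE U4 *; set d := n%:R * p in c5 c4 Xs xn dle.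
have n1 : 0 < n%:R :> R by rewrite ltr0n.
have Xn : (10 * #|X| <= n)%N.
  by rewrite -(ler_nat R) natrM; apply: le_trans xn; rewrite ler_wpM2l.
have M271 : 271 * l ^+ 3 <= del1 * M.
  by move: U4; rewrite mulrAC ler_pdivrMr // (mulrC M).
have l3 : 1 <= l ^+ 3 by rewrite exprn_ege1.
have l2l : l ^+ 2 <= l ^+ 3 by rewrite [l ^+ 3]exprS -[X in X <= _]mul1r ler_wpM2r ?sqr_ge0.
have ll2 : l <= l ^+ 2 by rewrite expr2 -[X in X <= _]mul1r ler_wpM2r //; clear -l1; lra.
have M0 : 0 <= M by apply: leafM_ge0.
have dMM : del1 * M <= M by rewrite -[X in _ <= X]mul1r ler_wpM2r //; rewrite /del1; clear -d1; lra.
have mxM : Num.max M l = M by rewrite max_l //; clear -M271 l3 l2l ll2 dMM; lra.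
rewrite mxM in iE LE.
(* The bound on [X] is the fraction [exp (- d / 20) / d] of [leafM n p]. *)
have Xd : #|X|%:R <= del1 * M.
  apply: le_trans Xs _; have -> : del1 * M = n%:R * (expR (- d) * (del1 * d)).
    by rewrite /M /leafM /d; ring.
  rewrite ler_pM2l // (_ : - (21 / 20 * d) = - d + - (d / 20)); last by field.
  rewrite expRD ler_wpM2l ?expR_ge0 //; apply: (@le_trans _ _ (del1 * 1)); last by rewrite ler_wpM2l // ltW.
  rewrite mulr1; apply: expRN_small => //; move: c4; rewrite ler_pdivrMr // => c4.
  by rewrite -[X in X <= _]mul1r ler_pdivrMr //; clear -c4; lra.
have low := leaf_lower EP; set L := #|[set v | _]| in LE low.
move: LE; rewrite ler_distl => /andP[LE1 LE2].
apply/andP; split; first by rewrite /del1 in LE1 M271; clear -LE1 M271 low l3; lra.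
have up := sp_le_color Ep hE cX dE hq q0 n30 lE Xn (up_logP n (isT : (1 < 2)%N)).
set De := Num.truncn _ in up; set k := up_log 2 n in up; rewrite -/L in up.
have kle : k%:R <= 3 * l by apply: up_log_le3.
have Dle : De%:R <= 8 * l by apply: truncn_leR; rewrite mulr_ge0 //; clear -l1; lra.
have {}up : (sp E)%:R <= #|X|%:R + #|lowset E 0|%:R + (((De ^ 2).+1 * k.+1)%:R + 2 / 3 * L%:R) + k%:R + k%:R + 5 :> R.
  apply: (@le_trans _ _ (#|X| + #|lowset E 0| + ((De ^ 2).+1 * k.+1 + 2 * (L %/ 3)) + k + k + 5)%:R).
    rewrite ler_nat; apply: leq_trans up _; rewrite !leq_add2r leq_add2l geq_max leq_addr leq_addl //.
  by rewrite 6!natrD !lerD2r !lerD2l; apply: third_le.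
have pl : ((De ^ 2).+1 * k.+1)%:R <= (64 * l ^+ 2 + 1) * (3 * l + 1) :> R.
  rewrite natrM; apply: ler_pM => //; rewrite -[_.+1%:R]natr1 lerD2r //.
  have -> : 64 * l ^+ 2 = (8 * l) ^+ 2 by ring.
  by rewrite natrX lerXn2r // nnegrE // mulr_ge0 //; clear -l1; lra.
have pl2 : (64 * l ^+ 2 + 1) * (3 * l + 1) = 192 * l ^+ 3 + 64 * l ^+ 2 + 3 * l + 1 by ring.
rewrite /del1 in Xd iE LE2 M271 *; clear -Xd iE LE2 M271 up kle pl pl2 l2l ll2 l1 l3; lra.
Qed.
End Regimes.

(** * Edge probabilities of order log n / n *)

Section LogRegimes.
Variable R : realType.

Lemma coin_hyps (tau : R) : 0 < tau -> exists L : R, 1 <= L /\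
  forall n p, (0 < n)%N -> 0 <= p <= 1 -> L <= ln n%:R -> 1 / 2 * ln n%:R <= n%:R * p ->
  [/\ (1 < n)%N, (0 < up_log 2 n)%N, (0 < Num.truncn (8 * ln n%:R : R))%N &
      (8 * Num.truncn (8 * ln n%:R : R) ^ 2 * up_log 2 n <= 4 ^ qcut tau n p)%N].
Proof.
move=> t0; have t2 : 0 < tau ^+ 2 by rewrite exprn_gt0.
have c0 : 0 < tau ^+ 2 / 200 * (1 / 2) by lra.
have [L [L1 LP]] := coin_room c0.
exists L; split=> // n p n0 p01 lL d; have l1 : 1 <= ln n%:R :> R by lra.
have n1 : (1 < n)%N.
  rewrite ltnNge; apply/negP => n1; have n1E : n = 1%N by apply/eqP; rewrite eqn_leq n1.
  by move: l1; rewrite n1E ln1; lra.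
split=> //; first by rewrite up_log_gt0.
  by rewrite truncn_gt0; lra.
apply: LP => //; apply: le_trans (ltW (qcut_gt tau n p01)).
by rewrite -mulrA ler_wpM2l // ltW // divr_gt0.
Qed.

(** The cap [2 * ln n] keeps the maximum degree of order [ln n], as the local lemma requires; larger
    [p] are brought into this range by monotonicity. *)
Lemma whp_dense_regime (eps : R) : 0 < eps <= 1 ->
  whp (fun n p => (1 + eps) * ln n%:R <= n%:R * p <= 2 * ln n%:R)
    (fun n p E => (sp E <= up_log 2 n)%N).
Proof.
move=> /andP[e0 e1]; pose tau : R := eps / 100.
have t01 : 0 < tau <= 1 / 100 by rewrite /tau; lra.
have t0 : 0 < tau by case/andP: t01.
have t03 : 0 < tau <= 1 / 3 by case/andP: t01 => _ ?; rewrite t0 /=; lra.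
have te : 1 + eps / 2 <= (1 - 3 * tau) * (1 + eps).
  have : eps * eps <= 1 * eps by rewrite ler_wpM2r // ltW.
  by rewrite /tau; nra.
have [C1 W1] := whp_standard t01; have W2 := whp_no_low t03 e0 te.
have [C3 [N3 U3]] := standard_numerics t0; have [L [L1 LP]] := coin_hyps t0.
set rng := fun _ _ => _.
have [N4 U4] := @ultimately_ln R rng (`|C1| + `|C3| + L).
have a1 := ler_norm C1; have a3 := ler_norm C3.
have b1 := normr_ge0 C1; have b3 := normr_ge0 C3.
have sub n p : (N4 <= n)%N -> 0 <= p <= 1 -> rng n p ->
    [/\ C1 <= n%:R * p, C3 <= n%:R * p, L <= ln n%:R & ln n%:R <= n%:R * p].
  move=> n4 p01 r; have := U4 n p n4 p01 r; have /andP[dl _] : rng n p := r => lb.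
  have l0 : 0 <= ln n%:R :> R by lra.
  have el := mulr_ge0 (ltW e0) l0; clear -lb dl el a1 a3 b1 b3 L1; split; lra.
apply: (whp_weaken (whp_and (whp_sub (rng' := rng) W1 _) (whp_sub W2 _))).
- exists N4 => n p n4 p01 /[dup] /(sub n p n4 p01)[? _ _ _] /andP[_ ?]; exact/andP.
- by exists 0%N => n p _ _ /andP[].
- by exists 0%N.
exists (maxn (maxn N4 N3) 1) => n p; rewrite !geq_max => /andP[/andP[n4 n3] n0] p01 r E EP.
move=> [[X [cX hE dE lE Xs]] lo0]; have [c1 c3 cL cl] := sub n p n4 p01 r.
have [q0 hq n30 xn] := U3 n p n3 p01 c3.
have l12 : 1 / 2 * ln n%:R <= n%:R * p by lra.
have [n1 k0 De0 room] := LP n p n0 p01 cL l12.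
have Ep e : e \in E -> #|e| = 2%N by move/(subsetP EP); rewrite inE => /eqP.
have Xn : (10 * #|X| <= n)%N.
  by rewrite -(ler_nat R) natrM; apply: le_trans xn; rewrite ler_wpM2l.
(* In this range [n exp (- 1.05 d) < 1], so nothing is discarded. *)
have X0 : X = set0.
  apply/eqP; rewrite -cards_eq0 -leqn0 -ltnS -(ltr_nat R); apply: le_lt_trans Xs _.
  rewrite -{1}(expR_ln_nat R n0) -expRD -[X in _ < X]expR0 ltr_expR; clear -cl cL L1; lra.
exact: (sp_le_dense R Ep hE cX dE hq q0 n30 lE Xn k0 (up_logP n (isT : (1 < 2)%N)) room De0 X0 lo0).
Qed.

(** The window depends on [del]: with [n ^ gam] low vertices the two codes for them and for their
    neighbours take about [4 gam log2 n] paths, which is admissible only for [gam] small against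
    [del]. *)
Lemma whp_critical_regime (del : R) : 0 < del <= 1 -> exists eps : R, 0 < eps <= 1 / 2 /\
  whp (fun n p => (1 - eps) * ln n%:R <= n%:R * p <= 2 * ln n%:R)
    (fun n p E =>
      (1 - del) * Num.max (ln n%:R / ln 2) (2 / 3 * leafM n p) <= (sp E)%:R <=
      (1 + del) * Num.max (ln n%:R / ln 2) (2 / 3 * leafM n p)).
Proof.
(* With these choices [(1 - 3 tau) (1 - eps)] equals [(1 - gam / 4) ^ 2], as the bound on low
   vertices demands. *)
move=> /andP[d0 d1]; pose gam := del / 40; pose eps := gam / 4; pose tau := gam / 12.
have g0 : 0 < gam by rewrite /gam; lra.
have g1 : gam <= 1 / 40 by rewrite /gam; lra.
have g01 : 0 < gam <= 1 by rewrite g0; lra.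
have g02 : 0 < gam <= 1 / 2 by rewrite g0; lra.
have t0 : 0 < tau by rewrite /tau; lra.
have t1 : tau <= 1 / 480 by rewrite /tau; lra.
have t01 : 0 < tau <= 1 / 100 by rewrite t0 /=; lra.
have t03 : 0 < tau <= 1 / 3 by rewrite t0 /=; lra.
have te : 1 - gam / 2 <= (1 - 3 * tau) * (1 - eps).
  by have := mulr_ge0 (ltW g0) (ltW g0); rewrite /tau /eps; nra.
exists eps; split; first by rewrite /eps; lra.
have [C1 W1] := whp_standard t01; have W2 := whp_lows_tiny t03 g02 te.
have [C3 [N3 U3]] := standard_numerics t0; have [L [L1 LP]] := coin_hyps t0.
have [C4 W4] := whp_isolated g01; have W5 := whp_leaves g01.
have [C6 [C61 C6P]] := @poly_exp R 3 gam 1 g0.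
set rng := fun _ _ => _; pose B := `|C1| + `|C3| + `|C4|.
have a1 := ler_norm C1; have a3 := ler_norm C3; have a4 := ler_norm C4.
have b1 := normr_ge0 C1; have b3 := normr_ge0 C3; have b4 := normr_ge0 C4.
have [N4 U4] := @ultimately_ln R rng (2 * B + C6 + L + 9 / gam).
have b5 : 0 <= 9 / gam by rewrite divr_ge0 // ltW.
have [B0 BC1 BC3 BC4] : [/\ 0 <= B, C1 <= B, C3 <= B & C4 <= B].
  by rewrite /B; clear -a1 a3 a4 b1 b3 b4; split; lra.
have e160 : eps <= 1 / 160 by rewrite /eps; clear -g1; lra.
have {a1 a3 a4 b1 b3 b4} sub n p : (N4 <= n)%N -> 0 <= p <= 1 -> rng n p ->
    [/\ B <= n%:R * p, L <= ln n%:R, C6 <= ln n%:R, 9 / gam <= ln n%:R &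
        159 / 160 * ln n%:R <= n%:R * p].
  move=> n4 p01 r; have := U4 n p n4 p01 r; have /andP[dl _] : rng n p := r => lb.
  have l0 : 0 <= ln n%:R :> R by clear -lb B0 C61 L1 b5; lra.
  have h : 159 / 160 * ln n%:R <= n%:R * p.
    by apply: le_trans dl; rewrite ler_wpM2r //; clear -e160; lra.
  by clear -lb h l0 B0 C61 L1 b5; split; lra.
apply: (whp_weaken (whp_and (whp_and (whp_sub (rng' := rng) W1 _) (whp_sub W2 _))
  (whp_and (whp_sub W4 _) (whp_sub W5 _)))).
- exists N4 => n p n4 p01 /[dup] /(sub n p n4 p01)[h _ _ _ _] /andP[_ ?].
  by apply/andP; split=> //; apply: le_trans h.
- by exists 0%N => n p _ _ /andP[].
- exists N4 => n p n4 p01 /[dup] /(sub n p n4 p01)[h _ _ _ _] /andP[_ ?].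
  by apply/andP; split=> //; apply: le_trans h.
- by exists 0%N => n p _ _ /andP[].
- by exists 0%N.
exists (maxn (maxn N4 N3) 1) => n p; rewrite !geq_max => /andP[/andP[n4 n3] n0] p01 r E EP.
move=> [[[X [cX hE dE lE Xs]] tiny] [iE LE]]; have [cB cL cC6 c9 cl] := sub n p n4 p01 r.
have /andP[_ dle] : rng n p := r.
have [q0 hq n30 xn] := U3 n p n3 p01 (le_trans BC3 cB).
have l1 : 1 <= ln n%:R :> R := le_trans L1 cL.
have l12 : 1 / 2 * ln n%:R <= n%:R * p by clear -cl l1; lra.
have [n1 k0 De0 room] := LP n p n0 p01 cL l12.
have Ep e : e \in E -> #|e| = 2%N by move/(subsetP EP); rewrite inE => /eqP.
have Xn : (10 * #|X| <= n)%N.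
  by rewrite -(ler_nat R) natrM; apply: le_trans xn; rewrite ler_wpM2l.
have X1 : #|X|%:R <= 1 :> R.
  apply: le_trans Xs _.
  rewrite -{1}(expR_ln_nat R n0) -expRD -[X in _ <= X]expR0 ler_expR; clear -cl l1; lra.
have low := leaf_lower R EP.
pose k' := up_log 2 ((hcut tau n p).+1 * #|lowset E (hcut tau n p)|).
have up := sp_le_coins R Ep hE cX dE hq q0 n30 lE Xn k0 (up_logP n (isT : (1 < 2)%N)) room De0
  (up_logP _ (isT : (1 < 2)%N)); rewrite -/k' in up.
have l2 := ln2_ge_half R; have l20 : 0 < ln 2 :> R by clear -l2; lra.
have lower := ln_le_pow R n0 (sp_lower_log E).
have kle := up_log_le R n0.
have k'le : k'%:R <= 2 * gam * (ln n%:R / ln 2) + 1.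
  have ll0 : 0 <= ln n%:R / ln 2 :> R by rewrite divr_ge0 ?(ltW l20) //; clear -l1; lra.
  rewrite /k'; have [->|m0] := posnP ((hcut tau n p).+1 * #|lowset E (hcut tau n p)|).
    by rewrite up_log0 addr_ge0 // mulr_ge0 // mulr_ge0 // ltW.
  apply: le_trans (up_log_le R m0) _; rewrite lerD2r mulrA ler_wpM2r ?invr_ge0 ?(ltW l20) //.
  rewrite -ler_expR lnK ?posrE ?ltr0n // natrM.
  have -> : 2 * gam * ln n%:R = gam * ln n%:R + gam * ln n%:R by ring.
  rewrite expRD; apply: ler_pM => //.
  apply: le_trans (C6P _ cC6); rewrite expr1 -[_.+1%:R]natr1.
  have h2 : tau ^+ 2 <= 1 by clear -t0 t1; rewrite expr_le1 //; lra.
  have np0 : 0 <= n%:R * p by clear -cl l1; lra.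
  have h3 := hcut_le tau n p01; have h4 := ler_wpM2r np0 h2; clear -h3 h4 dle l1; lra.
set lk := ln n%:R / ln 2 in kle k'le lower *; set M := leafM n p in iE LE *.
set mx := Num.max lk _; set L0 := #|[set v | _]| in LE low up.
have mx1 : lk <= mx by rewrite le_max lexx.
have mx2 : 2 / 3 * M <= mx by rewrite le_max lexx orbT.
have llk : ln n%:R <= lk.
  by rewrite /lk ler_pdivlMr // -[X in _ <= X]mulr1 ler_wpM2l ?ln2_le1 //; clear -l1; lra.
have mm : Num.max M (ln n%:R) <= 3 / 2 * mx by rewrite ge_max; clear -llk mx1 mx2 l1; lra.
have gmm := ler_wpM2l (ltW g0) mm.
(* The additive constants of the upper bound sum to [9]: one for [X], one from rounding up [log2 n],
   two from the two copies of [k'], and the final [5]. *)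
have g9 : 9 <= gam * mx.
  by move: c9; rewrite ler_pdivrMr // mulrC => c9; apply: le_trans c9 _; rewrite ler_wpM2l ?(ltW g0) //; clear -llk mx1; lra.
have glk : gam * lk <= gam * mx by rewrite ler_wpM2l // ltW.
have {}iE := le_trans iE gmm; have := le_trans LE gmm; rewrite ler_distl => /andP[LE1 LE2].
have gd : gam * mx = del * mx / 40 by rewrite /gam; ring.
have t3 := third_le R L0.
have {}up : (sp E)%:R <= #|X|%:R + #|lowset E 0|%:R + Num.max (up_log 2 n)%:R (2 * (L0 %/ 3))%:R + k'%:R + k'%:R + 5 :> R.
  rewrite -natr_max -!natrD ler_nat //.
have {}mmx : Num.max (up_log 2 n)%:R (2 * (L0 %/ 3))%:R <= mx + 1 + gam * mx.
  by rewrite ge_max; clear -kle t3 LE2 mx1 mx2 g9; apply/andP; split; lra.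
clear - iE LE1 LE2 low up k'le mmx g9 glk gd X1 lower mx1 mx2 d0.
apply/andP; split; last by lra.
rewrite mulrBl mul1r.
have [mE|mE] : mx = lk \/ mx = 2 / 3 * M.
- by rewrite /mx; case: (leP lk (2 / 3 * M)); [right | left].
- lra.
- lra.
Qed.
End LogRegimes.

(** * From uniform estimates to the three statements *)

Section Final.
Variable R : realType.

Lemma aas_PrG (p : nat -> R) (B : forall n, {set {set 'I_n}} -> bool) :
  (forall n, 0 <= p n <= 1) ->
  (forall e, 0 < e -> exists N, forall n, (N <= n)%N ->
     PrG (p n) (fun E : graph n => ~ B n E) <= e) -> aas p B.
Proof.
move=> p01 H e e0; have [N {}H] := H e e0; exists N => n nN.
rewrite Gnp_probE -[X in _ <= X]opprK lerNr opprB -lerBlDr opprK.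
apply: le_trans (H n nN); rewrite addrC -Pr_compl; apply: Pr_le => // E _ nB.
by apply/asboolP/negP.
Qed.

Lemma aas_whp (p : nat -> R) (rng : nat -> R -> Prop) A (B : forall n, {set {set 'I_n}} -> bool) :
  whp rng A -> (forall n, 0 <= p n <= 1) -> eventually (fun n => rng n (p n)) ->
  eventually (fun n => forall E : graph n, E \subset all_pairs n -> A n (p n) E -> B n E) ->
  aas p B.
Proof.
move=> wA p01 [N1 H1] [N2 H2]; apply: aas_PrG => // e e0; have [N H] := wA e e0.
exists (maxn N (maxn N1 N2)) => n; rewrite !geq_max => /and3P[n0 n1 n2].
apply: le_trans (H n (p n) n0 (p01 n) (H1 n n1)); apply: PrG_le => // E EE nB HA.
by apply: nB; apply: H2.
Qed.

(** Uniformity in [p] permits this splitting even if [p n] changes between the ranges infinitely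
    often. *)
Lemma whp_cases (rng1 rng2 rng : nat -> R -> Prop) A : whp rng1 A -> whp rng2 A ->
  ultimately rng (fun n p => rng1 n p \/ rng2 n p) -> whp rng A.
Proof.
move=> w1 w2 [N H] e e0; have [N1 H1] := w1 e e0; have [N2 H2] := w2 e e0.
exists (maxn N (maxn N1 N2)) => n q; rewrite !geq_max => /and3P[n0 n1 n2] q01 r.
by case: (H n q n0 q01 r); [apply: H1 | apply: H2].
Qed.

(** The critical estimate holds in a window whose width depends on [del]. What lies below it belongs
    to the sparse range, where [leafM] is at least [3 (ln n) ^ 3] and the maximum is its second
    argument. *)
Lemma whp_window (eps del : R) : 0 < eps <= 1 / 2 -> 0 < del <= 1 ->
  whp (fun n p => (1 - eps) * ln n%:R <= n%:R * p <= (1 + eps) * ln n%:R)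
    (fun n p E =>
      (1 - del) * Num.max (ln n%:R / ln 2) (2 / 3 * leafM n p) <= (sp E)%:R <=
      (1 + del) * Num.max (ln n%:R / ln 2) (2 / 3 * leafM n p)).
Proof.
move=> /andP[e0 e1] d01; have [eps1 [/andP[e10 e11] W2]] := whp_critical_regime d01.
have [d0 d1] := andP d01; have d23 : 0 < 2 / 3 * del <= 1 by lra.
have e1' : 0 < eps1 <= 1 by rewrite e10 /=; lra.
have [C W1] := whp_sparse_regime e1' d23.
pose C' := `|C| + 1; have C'C : C <= C' by have := ler_norm C; rewrite /C'; lra.
have C'1 : 1 <= C' by have := normr_ge0 C; rewrite /C'; lra.
set rng := fun _ _ => _.
have [N1 U1] := @ultimately_ln R rng (2 * C').
have [N2 U2] := leafM_large 3 e10.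
have [N3 U3] := @ultimately_ln R (fun n p => C' <= n%:R * p <= (1 - eps1) * ln n%:R) 1.
apply: (whp_cases (rng1 := fun n p => C' <= n%:R * p <= (1 - eps1) * ln n%:R) _ W2); last first.
  exists N1 => n q nN q01 r; have lC := U1 n q nN q01 r; have /andP[r1 r2] : rng n q := r.
  have l0 : 0 <= ln n%:R :> R by lra.
  have h1 : 1 / 2 * ln n%:R <= (1 - eps) * ln n%:R :> R by rewrite ler_wpM2r //; lra.
  have h2 : (1 + eps) * ln n%:R <= 2 * ln n%:R :> R by rewrite ler_wpM2r //; lra.
  case: (lerP (n%:R * q) ((1 - eps1) * ln n%:R)) => c; [left | right]; lra.
apply: whp_weaken W1 _ _.
  by exists 0%N => n q _ _ /andP[c1 c2]; rewrite c2 (le_trans C'C).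
exists (maxn N2 N3) => n q; rewrite geq_max => /andP[n2 n3] q01 r E EE.
have l1 := U3 n q n3 q01 r; have /andP[r1 r2] := r.
have M3 : 3 * ln n%:R ^+ 3 <= leafM n q by apply: U2 => //; rewrite r2 (le_trans C'1).
have ll : ln n%:R <= ln n%:R ^+ 3 :> R by rewrite -[X in X <= _]expr1 ler_weXn2l.
have l2 := ln2_ge_half R; have l20 : 0 < ln 2 :> R by lra.
have lk : ln n%:R / ln 2 <= 2 * ln n%:R :> R.
  have l0 : 0 <= ln n%:R :> R by lra.
  by rewrite ler_pdivrMr // -mulrA; have := ler_wpM2l l0 l2; lra.
rewrite max_r; last by lra.
move=> /andP[h1 h2]; apply/andP; split; lra.
Qed.
End Final.

Theorem theorem1p1 (R : realType) :
  exists eps0 : R, 0 < eps0 /\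
  forall eps : R, 0 < eps -> eps < eps0 ->
  (* (i) *)
  (forall p : nat -> R, (forall n, 0 <= p n <= 1) ->
     eventually (fun n => (1 + eps) * ln n%:R / n%:R <= p n) ->
     aas p (fun n E => (sp E)%:Z == Num.ceil (ln (n%:R : R) / ln 2))) /\
  (* (ii) *)
  (forall p : nat -> R, (forall n, 0 <= p n <= 1) ->
     eventually (fun n => (1 - eps) * ln n%:R / n%:R <= p n
                          <= (1 + eps) * ln n%:R / n%:R) ->
     forall delta : R, 0 < delta ->
     aas p (fun n E =>
       let M := Num.max (ln n%:R / ln 2)
                  (2 / 3 * n%:R ^+ 2 * p n * expR (- (n%:R * p n))) in
       (1 - delta) * M <= (sp E)%:R <= (1 + delta) * M)) /\
  (* (iii) *)
  (forall delta : R, 0 < delta -> exists C : R,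
   forall p : nat -> R, (forall n, 0 <= p n <= 1) ->
     eventually (fun n => C / n%:R <= p n <= (1 - eps) * ln n%:R / n%:R) ->
     aas p (fun n E =>
       let M := n%:R ^+ 2 * p n * expR (- (n%:R * p n)) in
       (2 / 3 - delta) * M <= (sp E)%:R <= (2 / 3 + delta) * M)).
Proof.
(* Below [1 / 2] the window of (ii) keeps [n p] between [ln n / 2] and [2 ln n]. *)
exists (1 / 2); split=> [|eps e0 e1]; first by lra.
have div_le n (x p : R) : (0 < n)%N -> (x / n%:R <= p) = (x <= n%:R * p).
  by move=> n0; rewrite ler_pdivrMr ?ltr0n // mulrC.
have le_div n (x p : R) : (0 < n)%N -> (p <= x / n%:R) = (n%:R * p <= x).
  by move=> n0; rewrite ler_pdivlMr ?ltr0n // mulrC.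
have cap (delta : R) : 0 < delta -> 0 < Num.min delta 1 <= 1.
  by move=> d0; rewrite lt_min d0 ltr01 ge_min lexx orbT.
split; [|split].
- move=> p p01 [N1 pN]; apply: aas_PrG => // e ep0.
  have e01 : 0 < eps <= 1 by rewrite e0 /=; lra.
  have [N2 H] := whp_dense_regime e01 ep0.
  exists (maxn (maxn N1 N2) 2) => n; rewrite !geq_max => /andP[/andP[n1 n2] n0].
  have nR : 0 < n%:R :> R by rewrite ltr0n ltnW.
  (* Adding edges cannot increase [sp], so the whole range is reduced to its lower end [q]. *)
  pose q : R := (1 + eps) * ln n%:R / n%:R; have qp : q <= p n by apply: pN.
  have l0 : 0 <= ln n%:R :> R by rewrite ln_ge0 // ler1n ltnW.
  have q0 : 0 <= q by rewrite /q divr_ge0 ?mulr_ge0 //; lra.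
  have /andP[_ p1] := p01 n; have q01 : 0 <= q <= 1 by rewrite q0 (le_trans qp).
  apply: (@le_trans _ _ (PrG q (fun E : graph n => ~ (sp E <= up_log 2 n)%N))); last first.
    apply: H => //; have -> : n%:R * q = (1 + eps) * ln n%:R by rewrite /q mulrC divfK ?lt0r_neq0.
    by rewrite lexx ler_wpM2r //; lra.
  apply: le_trans (Ex_increasing (n := n) (Q := fun E => (sp E <= up_log 2 n)%N) q0 qp p1 _).
    apply: PrG_le => // E EE nE spE; apply: nE; rewrite ceil_log2 // eqz_nat eqn_leq spE /=.
    by apply: up_log_min => //; apply: sp_lower_log.
  by move=> E E' EE; apply: leq_trans; apply: sp_mono.
- move=> p p01 [N1 pN] delta d0.
  have e01 : 0 < eps <= 1 / 2 by rewrite e0 ltW.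
  have dle : Num.min delta 1 <= delta by rewrite ge_min lexx.
  apply: (aas_whp (whp_window e01 (cap delta d0)) p01).
    exists (maxn N1 1) => n; rewrite geq_max => /andP[n1 n0].
    by have := pN n n1; rewrite div_le // le_div.
  exists 1%N => n n0 E EE /=; rewrite -!(mulrA (2 / 3)) !mulrA -/(leafM n (p n)).
  set M := Num.max _ _; have M0 : 0 <= M.
    have l20 : 0 <= ln 2 :> R by have := ln2_ge_half R; lra.
    by rewrite le_max divr_ge0 // ln_ge0 // ler1n.
  have h := ler_wpM2r M0 dle; move=> /andP[h1 h2]; apply/andP; split; lra.
- move=> delta d0; have e01 : 0 < eps <= 1 by rewrite e0 /=; lra.
  have [C W] := whp_sparse_regime e01 (cap delta d0); exists C => p p01 [N1 pN].
  have dle : Num.min delta 1 <= delta by rewrite ge_min lexx.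
  apply: (aas_whp W p01).
    exists (maxn N1 1) => n; rewrite geq_max => /andP[n1 n0].
    by have := pN n n1; rewrite div_le // le_div.
  exists 1%N => n n0 E EE /=; rewrite -/(leafM n (p n)).
  have h := ler_wpM2r (leafM_ge0 n (p01 n)) dle; move=> /andP[h1 h2]; apply/andP; split; lra.
Qed.
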